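(* Let $1 \leq d \leq n$ be integers. If $E\subset \mathbb{R}^n$ is compact and strongly $d$-rectifiable, then $$\lim_{p\nearrow d} \frac{\operatorname{Cap}_p(E)^p}{d-p} = \frac{\mathcal{H}^d(E)}{|\mathbb{S}^{d-1}|} ,$$ where $|\mathbb{S}^{d-1}|=2\pi^{d/2}/\Gamma(d/2)$ is the surface area of the unit sphere in $\mathbb{R}^d$.
   Context: Riesz energy and capacity: for a nonempty compact set $E\subset\mathbb{R}^n$ and $p>0$, the Riesz $p$-energy is $V_p(E) = \min_\mu \int_E \int_E |x-y|^{-p} \, d\mu(x)\, d\mu(y) \in (0,+\infty]$, where the minimum is over all (Borel) probability measures $\mu$ on $E$ (the minimum is attained, possibly with value $+\infty$). For the empty set, $V_p(\emptyset)=+\infty$. The Riesz $p$-capacity is $\operatorname{Cap}_p(E) = V_p(E)^{-1/p}$, which equals $0$ when $V_p(E)=+\infty$. $\mathcal{H}^d$ is $d$-dimensional Hausdorff measure, normalized to agree with Lebesgue measure on subsets of $\mathbb{R}^d$. $\dim$ denotes Hausdorff dimension. Strongly $d$-rectifiable (integers $1\le d\le n$): a set $E\subset \mathbb{R}^n$ is strongly $d$-rectifiable if for each $\epsilon>0$ there exist a finite collection of compact subsets $K_1,\ldots,K_m \subset \mathbb{R}^d$ and corresponding bi-Lipschitz functions $\varphi_i: K_i\to E$ such that, writing $E_i=\varphi_i(K_i)$: (1) each $\varphi_i$ has bi-Lipschitz constant less than $1+\epsilon$; (2) $\mathcal{H}^d(E_i \cap E_j)=0$ when $i\neq j$; (3)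 $\dim(F) < d$, where $F=E\setminus \bigcup_{i=1}^m E_i$. Here $\varphi$ has bi-Lipschitz constant $\lambda\ge 1$ if $\lambda^{-1}|x-y|\le|\varphi(x)-\varphi(y)|\le\lambda|x-y|$ for all $x,y$ in its domain. *)

(* Defs.v *)
From HB Require Import structures.
From mathcomp Require Import all_boot all_order all_algebra.
From mathcomp Require Import all_classical all_reals all_analysis.

Set Implicit Arguments.
Unset Strict Implicit.
Unset Printing Implicit Defensive.

Import Order.TTheory GRing.Theory Num.Theory.
Import numFieldNormedType.Exports.

Local Open Scope classical_set_scope.
Local Open Scope ring_scope.

(* The norm of MathComp-Analysis on 'rV[R]_n is the sup norm.  It induces the
   usual topology (so [open] and [compact] are the library's), but metric
   notions must go through the Euclidean distance. *)
Definition edist (R : realType) (n : nat) (x y : 'rV[R]_n) : R :=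
  Num.sqrt (\sum_(i < n) (x ord0 i - y ord0 i) ^+ 2).

Definition borel_rV (R : realType) (n : nat) :=
  g_sigma_algebraType (@open 'rV[R]_n).

Section Riesz.
Local Open Scope ereal_scope.
Context {R : realType} {n : nat}.

(* For p > 0, |x - y|^(-p) is +oo on the diagonal, whereas [powR] would
   give 0. *)
Definition riesz_kernel (p : R) (x y : 'rV[R]_n) : \bar R :=
  if x == y then +oo else (edist x y `^ (- p))%R%:E.

(* A probability measure on E is a Borel probability measure on R^n carried
   by E.  There is none on the empty set, whose energy is thus +oo. *)
Definition riesz_energy (p : R) (E : set 'rV[R]_n) : \bar R :=
  ereal_inf [set \int[mu]_(x in E) \int[mu]_(y in E) riesz_kernel p x y
            | mu in [set mu : probability (borel_rV R n) R | mu E = 1]].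

(* The energy is nonnegative, so the last case does not occur. *)
Definition riesz_capacity (p : R) (E : set 'rV[R]_n) : R :=
  match riesz_energy p E with
  | v%:E => (v `^ (- p^-1))%R
  | +oo => 0%R
  | -oo => 0%R
  end.

End Riesz.

Section Hausdorff.
Local Open Scope ereal_scope.
Context {R : realType}.

Definition ediam (n : nat) (U : set 'rV[R]_n) : \bar R :=
  ereal_sup [set (edist x y)%:E | x in U & y in U].

(* diam(U)^s, with the convention that the empty set contributes 0 and a
   singleton contributes 0^0 = 1 when s = 0. *)
Definition hausdorff_gauge (n : nat) (s : R) (U : set 'rV[R]_n) : \bar R :=
  if U == set0 then 0 else poweR (ediam U) s.

Definition hausdorff_content (n : nat) (s delta : R) (A : set 'rV[R]_n) :
    \bar R :=
  ereal_inf [set \sum_(0 <= i <oo) hausdorff_gauge s (U i)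
            | U in [set U : nat -> set 'rV[R]_n |
                     A `<=` \bigcup_i U i /\
                     forall i, ediam (U i) <= delta%:E]].

(* Hausdorff measure without normalizing constant. *)
Definition hausdorff_raw (n : nat) (s : R) (A : set 'rV[R]_n) : \bar R :=
  ereal_sup [set hausdorff_content s delta A
            | delta in [set delta : R | (0 < delta)%R]].

Definition unit_cube {d : nat} : set 'rV[R]_d :=
  [set x | forall i, (0 <= x ord0 i <= 1)%R].

(* On R^d, [hausdorff_raw d%:R] is translation invariant, and finite and
   positive on the unit cube, hence a multiple of Lebesgue measure; dividing by
   its value on the unit cube makes it agree with Lebesgue measure. *)
Definition hausdorff_measure (n d : nat) (A : set 'rV[R]_n) : \bar R :=
  hausdorff_raw d%:R A / hausdorff_raw d%:R (unit_cube : set 'rV[R]_d).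

Definition hausdorff_dim (n : nat) (A : set 'rV[R]_n) : \bar R :=
  ereal_inf [set s%:E | s in [set s : R | (0 <= s)%R /\
                                          hausdorff_raw s A = 0]].

End Hausdorff.

(* The map is total, but only its values on K matter. *)
Definition bilipschitz_on (R : realType) (d n : nat) (lambda : R)
    (K : set 'rV[R]_d) (phi : 'rV[R]_d -> 'rV[R]_n) : Prop :=
  1 <= lambda /\
  forall x y, K x -> K y ->
    lambda^-1 * edist x y <= edist (phi x) (phi y) <= lambda * edist x y.

Definition strongly_rectifiable (R : realType) (n d : nat)
    (E : set 'rV[R]_n) : Prop :=
  forall eps : R, 0 < eps ->
  exists (m : nat) (K : 'I_m -> set 'rV[R]_d)
         (phi : 'I_m -> 'rV[R]_d -> 'rV[R]_n),
    [/\ forall i, compact (K i) /\ phi i @` K i `<=` E,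
        forall i, exists2 lambda : R, lambda < 1 + eps &
          bilipschitz_on lambda (K i) (phi i),
        forall i j, i != j ->
          hausdorff_measure d ((phi i @` K i) `&` (phi j @` K j)) = 0%E &
        (hausdorff_dim (E `\` \bigcup_i (phi i @` K i)) < d%:R%:E)%E].

Definition Gamma (R : realType) (s : R) : R :=
  (\int[lebesgue_measure]_(t in `]0%R, +oo[) (t `^ (s - 1) * expR (- t)))%R.

(* Surface area of the unit sphere of R^d. *)
Definition sphere_area (R : realType) (d : nat) : R :=
  2 * pi `^ (d%:R / 2) / Gamma (d%:R / 2).

(* Main.v *)
(* The argument rests on the Gaussian representation
     |x|^-p = Gamma(p/2)^-1 \int_0^oo t^(p/2-1) exp(-t |x|^2) dt.
   On R^d the Gaussian energy of mu at scale t is, up to a constant factor, the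
   squared L^2 norm of the convolution of mu with a Gaussian, so a probability
   measure carried by a compact K has Gaussian energy at least about
   (pi/t)^(d/2) / |K| for large t, and integrating over t >= T gives
     (d - p) V_p(K) >= (1 - o(1)) |S^(d-1)| / |K|   as p -> d.
   Normalized Lebesgue measure on K gives the matching upper bound.

   Both bounds are transferred to E through the bi-Lipschitz pieces.  For the
   lower bound, measures of finite energy do not charge the residual set, and
   interactions between different pieces are discarded; for the upper bound,
   the pieces are shrunk to disjoint compact sets, so that interactions between
   different pieces stay bounded as p -> d.  The sizes of the pieces and of E
   are compared through the unnormalized Hausdorff measure, which on compact
   subsets of R^d is its value on the unit cube times Lebesgue measure. *)
Require Import Defs.
From HB Require Import structures.
From mathcomp Require Import all_boot all_order all_algebra.
From mathcomp Require Import all_classical all_reals all_analysis.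
From mathcomp Require Import measurable_realfun.
From mathcomp Require Import ring lra zify.
Import Defs.
Import Order.TTheory GRing.Theory Num.Theory.
Import numFieldNormedType.Exports.
Local Open Scope classical_set_scope.
Local Open Scope ring_scope.
Set Implicit Arguments.
Unset Strict Implicit.
Unset Printing Implicit Defensive.

(** * Euclidean distance, dyadic cubes and Borel sets *)

(** For t >= T the weight t^(p/2-1) times the Gaussian mass (pi/t)^(d/2) integrates to 2 pi^(d/2)
    T^(-(d-p)/2) / (d-p), and T^(-(d-p)/2) tends to 1. Smaller scales are dropped in the lower bound
    and stay bounded in the upper one. Hence T, the pieces, their neighbourhoods and their
    separation are all fixed before p -> d, and division by Gamma(d/2) turns 2 pi^(d/2) into
    |S^(d-1)|. The obstacle in the lower bound is that a measure may distribute its mass among the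
    pieces in any way. Cauchy-Schwarz on one piece would give m_i^2 / |K_i|; its linear minorant 2 b
    m_i - b^2 |K_i|, with one b for all pieces, lets only the sums of masses and of volumes enter,
    and b is optimized at the end. Convolution pushes some mass out of K_i, but for large t almost
    all of it stays in a neighbourhood whose volume is close to |K_i| by compactness. *)

Section euclidean_distance.
Context {R : realType} {n : nat}.
Implicit Types x y : 'rV[R]_n.

Definition sqdist x y : R := \sum_(i < n) (x ord0 i - y ord0 i) ^+ 2.

Lemma sqdist_ge0 x y : 0 <= sqdist x y.
Proof. by apply: sumr_ge0 => i _; exact: sqr_ge0. Qed.

Lemma euclid_ge0 x y : 0 <= edist x y.
Proof. exact: sqrtr_ge0. Qed.

Lemma euclid_sqr x y : edist x y ^+ 2 = sqdist x y.
Proof. by rewrite sqr_sqrtr// sqdist_ge0. Qed.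

Lemma euclidC x y : edist x y = edist y x.
Proof.
by congr Num.sqrt; apply: eq_bigr => i _; rewrite -sqrrN opprB.
Qed.

Lemma euclidxx x : edist x x = 0.
Proof.
by rewrite /edist big1 ?sqrtr0// => i _; rewrite subrr expr0n.
Qed.

Lemma coord_le_euclid x y i : `|x ord0 i - y ord0 i| <= edist x y.
Proof.
rewrite -(@ler_pXn2r _ 2)// ?nnegrE// ?euclid_ge0// euclid_sqr real_normK//; last exact: num_real.
rewrite /sqdist (bigD1 i)//= lerDl.
by apply: sumr_ge0 => j _; exact: sqr_ge0.
Qed.

Lemma euclid_eq0 x y : edist x y = 0 -> x = y.
Proof.
move=> xy; apply/rowP => i; apply/eqP; rewrite -subr_eq0 -normr_le0 -xy.
exact: coord_le_euclid.
Qed.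

Lemma euclid_gt0 x y : x != y -> 0 < edist x y.
Proof.
move=> xy; rewrite lt_def euclid_ge0 andbT; apply: contra xy => /eqP.
by move=> /euclid_eq0 ->.
Qed.

Lemma coord_le_norm x i : `|x ord0 i| <= `|x|.
Proof.
rewrite [leRHS](mx_normrE x).
exact: (le_bigmax _ (fun ij : 'I_1 * 'I_n => `|x ij.1 ij.2|) (ord0, i)).
Qed.

Lemma norm_le_coord x (r : R) : 0 <= r -> (forall i, `|x ord0 i| <= r) -> `|x| <= r.
Proof.
move=> r0 xr; rewrite [leLHS](mx_normrE x); apply/bigmax_leP; split => //= -[i j] _ /=.
by rewrite ord1.
Qed.

Lemma norm_le_euclid x y : `|x - y| <= edist x y.
Proof.
apply: norm_le_coord; first exact: euclid_ge0.
by move=> i; rewrite !mxE; exact: coord_le_euclid.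
Qed.

(** The constant [n] instead of its square root is crude, but only comparability of the two norms is
    used. *)
Lemma euclid_le_bound x y (r : R) : 0 <= r ->
  (forall i, `|x ord0 i - y ord0 i| <= r) -> edist x y <= n%:R * r.
Proof.
move=> r0 xy; rewrite -(@ler_pXn2r _ 2)// ?nnegrE ?euclid_ge0// ?mulr_ge0//.
rewrite euclid_sqr exprMn.
apply: (@le_trans _ _ (\sum_(i < n) r ^+ 2)).
  apply: ler_sum => i _; rewrite -[leLHS]real_normK ?num_real//.
  by rewrite ler_pXn2r// nnegrE.
rewrite sumr_const card_ord -[leLHS]mulr_natl; apply: ler_wpM2r; first exact: sqr_ge0.
by rewrite -natrX ler_nat -mulnn; case: (n) => // k; exact: leq_pmull.
Qed.

Lemma euclid_le_norm x y : edist x y <= n%:R * `|x - y|.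
Proof.
by apply: euclid_le_bound => // i; have := coord_le_norm (x - y) i; rewrite !mxE.
Qed.

End euclidean_distance.

Section dyadic.
Context {R : realType} {n : nat}.

(** The half-open dyadic cubes of side 2^-k are the fibres of this map: two points share a cube when
    their values agree, and there are countably many cubes because integer vectors are countable. *)
Definition dyadic (k : nat) (x : 'rV[R]_n) : 'rV[int]_n :=
  \row_i Num.floor (2 ^+ k * x ord0 i).

Lemma dyadicP k (x : 'rV[R]_n) z : dyadic k x = z <->
  (forall i, ((z ord0 i)%:~R / 2 ^+ k <= x ord0 i < (z ord0 i + 1)%:~R / 2 ^+ k)).
Proof.
have k0 : 0 < 2 ^+ k :> R by rewrite exprn_gt0.
split=> [<- i|h].
  rewrite mxE ler_pdivrMr// ltr_pdivlMr// mulrC; exact: floor_itv.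
apply/rowP => i; rewrite mxE; apply: floor_def.
by have := h i; rewrite ler_pdivrMr// ltr_pdivlMr// mulrC.
Qed.

Lemma dyadic_close k (x y : 'rV[R]_n) : dyadic k x = dyadic k y ->
  `|x - y| <= 2 ^- k.
Proof.
move=> xy; apply: norm_le_coord; first by rewrite invr_ge0 exprn_ge0.
move=> i; rewrite !mxE.
have /(_ i) /andP[x1 x2] := (dyadicP k x (dyadic k x)).1 erefl.
have /(_ i) /andP[y1 y2] := (dyadicP k y (dyadic k x)).1 (esym xy).
move: x1 x2 y1 y2; rewrite rmorphD/= mulrDl mul1r => x1 x2 y1 y2.
by rewrite ler_norml; apply/andP; split; lra.
Qed.

Lemma dyadicS k (x y : 'rV[R]_n) : dyadic k.+1 x = dyadic k.+1 y ->
  dyadic k x = dyadic k y.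
Proof.
move=> xy.
(* Cubes are nested because the index at level k is the index at level k+1 halved and rounded
   down. *)
have half (u : R) : Num.floor u = (Num.floor (2 * u) %/ 2)%Z.
  apply: floor_def; have /andP[u1 u2] := floor_itv (2 * u).
  set m := Num.floor (2 * u) in u1 u2 *.
  have := divz_eq m 2; have := modz_ge0 m (isT : 2 != 0 :> int).
  have := ltz_pmod m (isT : 0 < 2 :> int).
  set q := (m %/ 2)%Z; set r := (m %% 2)%Z => r2 r0 mE.
  have r0' : 0 <= r%:~R :> R by rewrite ler0z.
  have r1' : r%:~R <= 1 :> R by rewrite -[1]/(1%:~R) ler_int; lia.
  have {}mE : m%:~R = q%:~R * 2 + r%:~R :> R by rewrite mE rmorphD rmorphM.
  move: u1 u2; rewrite !rmorphD/= mE => u1 u2; apply/andP; split; lra.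
apply/rowP => i; have /rowP/(_ i) := xy.
by rewrite !mxE exprS -!mulrA => h; rewrite half h -half.
Qed.

Lemma nbhs_dyadic (O : set 'rV[R]_n) x : nbhs x O ->
  exists k, forall y, dyadic k y = dyadic k x -> O y.
Proof.
move=> /nbhs_ballP[e e0 eO].
have [k ke] : exists k, 2 ^- k < e :> R.
  have := @cvg_geometric R 1 (2^-1) _; rewrite ger0_norm ?invr_ge0//.
  have -> : 2^-1 < 1 :> R by rewrite invf_lt1// ltr1n.
  move=> /(_ isT)/cvgrPdist_lt/(_ e e0)[k _ /(_ k (leqnn _))].
  rewrite sub0r normrN /geometric/= mul1r exprVn => h.
  by exists k; rewrite (le_lt_trans (ler_norm _) h).
exists k => y yx; apply: eO; rewrite -ball_normE/=.
by rewrite distrC (le_lt_trans _ ke)// dyadic_close.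
Qed.

Lemma open_dyadic (O : set 'rV[R]_n) : open O -> O =
  \bigcup_k \bigcup_(z in [set z | dyadic k @^-1` [set z] `<=` O])
     dyadic k @^-1` [set z].
Proof.
move=> oO; apply/seteqP; split=> [x Ox|x [k _ [z zO /= xz]]]; last exact: zO.
have [k kO] := nbhs_dyadic (open_nbhs_nbhs (conj oO Ox)).
by exists k => //; exists (dyadic k x) => //= y /kO.
Qed.

End dyadic.

Section borel_row_vectors.
Context {R : realType} {n : nat}.

Lemma open_measurable_rV (O : set 'rV[R]_n) : open O -> measurable (O : set (borel_rV R n)).
Proof. by move=> oO; exact: sub_sigma_algebra. Qed.

Lemma closed_measurable_rV (C : set 'rV[R]_n) : closed C -> measurable (C : set (borel_rV R n)).
Proof.
by move/closed_openC/open_measurable_rV/measurableC; rewrite setCK.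
Qed.

Lemma continuous_measurable_rV (f : 'rV[R]_n -> R) : continuous f ->
  measurable_fun setT (f : borel_rV R n -> R).
Proof.
move=> cf; apply: (measurability _ (RGenOpens.measurableE R)).
move=> _ [_ [a [b ->]] <-]; rewrite setTI; apply: open_measurable_rV.
by move/continuousP : cf; apply; exact: interval_open.
Qed.

Lemma measurable_coord (i : 'I_n) :
  measurable_fun setT ((fun x => x ord0 i) : borel_rV R n -> R).
Proof. by apply: continuous_measurable_rV; exact: coord_continuous. Qed.

(** An open set is a countable union of dyadic cubes, and the preimage of a cube is a finite
    intersection of preimages of intervals under the coordinates. *)
Lemma measurable_fun_rV d (T : measurableType d) (f : T -> borel_rV R n) :
  (forall i, measurable_fun setT (fun t => (f t : 'rV[R]_n) ord0 i)) ->
  measurable_fun setT f.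
Proof.
move=> mf; apply: (@measurability _ _ T (borel_rV R n) setT f (@open 'rV[R]_n)) => //.
move=> _ [U oU <-]; rewrite setTI (open_dyadic oU) preimage_bigcup.
apply: bigcupT_measurable => k; rewrite preimage_bigcup bigcup_mkcond.
apply: countable_bigcupT_measurable => // z; case: ifPn => // _.
rewrite (_ : _ @^-1` _ = \bigcap_i [set t | Num.floor (2 ^+ k * (f t : 'rV[R]_n) ord0 i) = z ord0 i]).
  apply: fin_bigcap_measurable => // i _.
  rewrite (_ : [set _ | _] = (fun t => (f t : 'rV[R]_n) ord0 i) @^-1`
     `[(z ord0 i)%:~R / 2 ^+ k, (z ord0 i + 1)%:~R / 2 ^+ k[%classic).
    by rewrite -[X in measurable X]setTI; apply: mf.
  have k0 : 0 < 2 ^+ k :> R by rewrite exprn_gt0.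
  apply/seteqP; split=> t /=; rewrite in_itv/= ler_pdivrMr// ltr_pdivlMr// mulrC.
    by move=> <-; exact: floor_itv.
  by move=> h; apply: floor_def.
apply/seteqP; split=> t /=; first by move=> /rowP h i _; have := h i; rewrite mxE.
by move=> h; apply/rowP => i; rewrite mxE; exact: h.
Qed.

Lemma measurable_sqdist d (T : measurableType d) (f g : T -> borel_rV R n) :
  measurable_fun setT f -> measurable_fun setT g ->
  measurable_fun setT (fun t => sqdist (f t) (g t)).
Proof.
move=> mf mg; apply: measurable_sum => i; apply: measurable_funX.
apply: measurable_funB.
  exact: (measurableT_comp (measurable_coord i) mf).
exact: (measurableT_comp (measurable_coord i) mg).
Qed.

End borel_row_vectors.

(** * Lebesgue measure and Gaussian integrals *)

Section image_measure.
Local Open Scope ereal_scope.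
Context d d' (T : measurableType d) (T' : measurableType d') (R : realType).

(** A copy of [pushforward] carrying the proof of measurability, so that measure and finite measure
    structures can be attached to it. *)
Definition image_measure (m : {measure set T -> \bar R}) (f : T -> T')
  (mf : measurable_fun setT f) : set T' -> \bar R := pushforward m f.

Section image_measure_measure.
Variables (m : {measure set T -> \bar R}) (f : T -> T').
Hypothesis mf : measurable_fun setT f.

Let mpre A : measurable A -> measurable (f @^-1` A).
Proof. by move=> mA; rewrite -[X in measurable X]setTI; exact: mf. Qed.

Let image_measure0 : image_measure m mf set0 = 0.
Proof. by rewrite /image_measure /pushforward preimage_set0 measure0. Qed.

Let image_measure_ge0 A : 0 <= image_measure m mf A.
Proof. exact: measure_ge0. Qed.

Let image_measure_sigma_additive : semi_sigma_additive (image_measure m mf).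
Proof.
move=> F mF tF mUF; rewrite /image_measure /pushforward preimage_bigcup.
apply: measure_semi_sigma_additive => [k||]; first exact: mpre.
  apply/trivIsetP => /= i j _ _ ij; rewrite -preimage_setI.
  by move/trivIsetP : tF => /(_ _ _ _ _ ij) ->//; rewrite preimage_set0.
by rewrite -preimage_bigcup; exact: mpre.
Qed.

HB.instance Definition _ := isMeasure.Build _ _ _
  (image_measure m mf) image_measure0 image_measure_ge0
  image_measure_sigma_additive.

End image_measure_measure.

Lemma image_measure_fin (m : {finite_measure set T -> \bar R}) (f : T -> T')
  (mf : measurable_fun setT f) : fin_num_fun (image_measure m mf).
Proof.
move=> A mA; apply: fin_num_measure.
by rewrite -[X in measurable X]setTI; exact: mf.
Qed.

HB.instance Definition _ (m : {finite_measure set T -> \bar R}) (f : T -> T')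
  (mf : measurable_fun setT f) :=
  Measure_isFinite.Build _ _ _ (image_measure m mf) (image_measure_fin m mf).

End image_measure.

Section row_vector_cons.
Context {R : realType} {n : nat}.

(** The new coordinate gets index [ord0], so that [big_ord_recl] separates it in sums and
    products. *)
Definition consrV (xa : borel_rV R n * measurableTypeR R) : borel_rV R n.+1 :=
  \row_i (if unlift ord0 i is Some j then (xa.1 : 'rV[R]_n) ord0 j else xa.2).

Lemma consrV0 xa : (consrV xa : 'rV[R]_n.+1) ord0 ord0 = xa.2.
Proof. by rewrite mxE unlift_none. Qed.

Lemma consrVS xa i :
  (consrV xa : 'rV[R]_n.+1) ord0 (lift ord0 i) = (xa.1 : 'rV[R]_n) ord0 i.
Proof. by rewrite mxE liftK. Qed.

Lemma measurable_consrV : measurable_fun setT consrV.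
Proof.
apply: measurable_fun_rV => i; case: (unliftP ord0 i) => [j|] ->.
  under eq_fun do rewrite consrVS.
  exact: (measurableT_comp (measurable_coord j) measurable_fst).
by under eq_fun do rewrite consrV0; exact: measurable_snd.
Qed.

End row_vector_cons.

(** * Lebesgue measure on R^n as an iterated product *)

Section lebesgue_rV.
Local Open Scope ereal_scope.
Context {R : realType}.

(** The recursion can return a plain measure because the product asks sigma-finiteness of its second
    factor only, which is the one-dimensional one. Sigma-finiteness in all dimensions, needed for
    Tonelli, follows in [leb_sigma_finite]. On the one-point space R^0 the measure is the Dirac
    mass. *)
Fixpoint lebesgue_rV_rec (n : nat) : {measure set (borel_rV R n) -> \bar R} :=
  if n is m.+1 then
    image_measure (product_measure1 (lebesgue_rV_rec m) (@lebesgue_measure R))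
      measurable_consrV
  else @dirac _ (borel_rV R 0) (0%R : 'rV[R]_0) R.

Definition leb (n : nat) : set (borel_rV R n) -> \bar R := lebesgue_rV_rec n.
Arguments leb n A : clear implicits.

HB.instance Definition _ n := Measure.on (leb n).

Lemma leb0E A : leb 0 A = @dirac _ (borel_rV R 0) (0%R : 'rV[R]_0) R A.
Proof. by []. Qed.

Lemma lebSE n A : leb n.+1 A = (leb n \x @lebesgue_measure R) (consrV @^-1` A).
Proof. by []. Qed.

Lemma leb_sigma_finite n : sigma_finite setT (leb n).
Proof.
pose I k : set R := `[(- k%:R)%R, k%:R]%classic.
have Ifin k : lebesgue_measure (I k) < +oo.
  by rewrite lebesgue_measure_itv/=; case: ifP => _ //; exact: ltry.
pose B m k : set (borel_rV R m) := [set x : 'rV[R]_m | forall i, I k (x ord0 i)].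
exists (B n).
  apply/seteqP; split=> // x _; exists (Num.truncn `|x : 'rV[R]_n|%R).+1 => //= i.
  rewrite /I/= in_itv/= -ler_norml (le_trans (coord_le_norm _ _))//.
  by rewrite ltW// truncnS_gt.
have mB m k : measurable (B m k).
  rewrite [X in measurable X](_ : _ = \bigcap_i ((fun x : 'rV[R]_m => x ord0 i) @^-1` I k)).
    apply: fin_bigcap_measurable => // i _.
    by rewrite -[X in measurable X]setTI; apply: (measurable_coord i) => //; exact: measurable_itv.
  by apply/seteqP; split => x /= h i; [move=> _|]; exact: h.
move=> k; split; first exact: mB.
elim: n => [|n ih]; first by rewrite leb0E diracE; case: (_ \in _); rewrite ?ltry.
rewrite lebSE (_ : _ @^-1` _ = B n k `*` I k).
  rewrite product_measure1E; [|exact: mB|exact: measurable_itv].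
  apply: lte_mul_pinfty; rewrite ?ge0_fin_numE ?measure_ge0//.
  exact: Ifin.
apply/seteqP; split => -[x a] /= h.
  by split=> [i|]; [have := h (lift ord0 i); rewrite consrVS|have := h ord0; rewrite consrV0].
move=> i; case: (unliftP ord0 i) => [j|] ->; rewrite ?consrVS ?consrV0//=; first exact: h.1.
exact: h.2.
Qed.

HB.instance Definition _ n := Measure_isSigmaFinite.Build _ _ _ (leb n)
  (leb_sigma_finite n).

Lemma leb_tonelli n (f : borel_rV R n.+1 -> \bar R) :
  measurable_fun setT f -> (forall x, 0 <= f x) ->
  \int[leb n.+1]_x f x =
  \int[leb n]_x \int[lebesgue_measure]_a f (consrV (x, a)).
Proof.
move=> mf f0.
have mfc : measurable_fun setT (f \o consrV).
  exact: measurableT_comp measurable_consrV.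
pose P : {measure set (borel_rV R n * measurableTypeR R) -> \bar R} := (leb n \x (@lebesgue_measure R))%E.
have H := @ge0_integral_pushforward _ _ _ _ R consrV measurable_consrV
  P setT f measurableT mf (fun x _ => f0 x).
apply: etrans; first exact: H.
rewrite preimage_setT.
exact: (@fubini_tonelli1 _ _ _ _ R (leb n) (@lebesgue_measure R) (f \o consrV) mfc (fun x => f0 _)).
Qed.

(** Source of the explicit values of [leb]: indicators give volumes of boxes, one-dimensional
    Gaussians give Gaussian integrals. *)
Lemma leb_integral_prod n (g : 'I_n -> R -> R) (I : 'I_n -> R) :
  (forall i, measurable_fun setT (g i)) -> (forall i a, 0 <= g i a)%R ->
  (forall i, \int[lebesgue_measure]_a (g i a)%:E = (I i)%:E) ->
  \int[leb n]_x (\prod_(i < n) g i ((x : 'rV[R]_n) ord0 i))%R%:E =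
  (\prod_(i < n) I i)%R%:E.
Proof.
elim: n g I => [|n ih] g I mg g0 gI.
  rewrite [LHS](eq_integral (cst 1)); last by move=> x _; rewrite big_ord0.
  rewrite integral_cst// big_ord0 mul1e.
  by apply: etrans (leb0E _) _; rewrite diracE in_setT.
rewrite leb_tonelli; first last.
- by move=> x; rewrite lee_fin prodr_ge0.
- apply/measurable_EFinP; apply: measurable_prod => i _.
  exact: (measurableT_comp (mg i) (measurable_coord i)).
have mP : measurable_fun setT (fun x : borel_rV R n => (\prod_(i < n) g (lift ord0 i) ((x : 'rV[R]_n) ord0 i))%R%:E).
  apply/measurable_EFinP; apply: measurable_prod => i _.
  exact: (measurableT_comp (mg _) (measurable_coord i)).
under eq_integral => x _.
  under eq_integral => a _.
    rewrite big_ord_recl consrV0/=.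
    under eq_bigr do rewrite consrVS/=.
    rewrite mulrC EFinM.
    over.
  rewrite ge0_integralZl//=; first last.
  - by rewrite lee_fin prodr_ge0.
  - by move=> a _; rewrite lee_fin.
  - apply/measurable_EFinP; exact: mg.
  rewrite gI.
  over.
have I0 : (0 <= I ord0)%R.
  by rewrite -lee_fin -gI; apply: integral_ge0 => a _; rewrite lee_fin.
rewrite ge0_integralZr//=; last by move=> x _; rewrite lee_fin prodr_ge0.
rewrite big_ord_recl mulrC EFinM; congr *%E.
exact: (ih (fun i => g (lift ord0 i)) (fun i => I (lift ord0 i))).
Qed.

End lebesgue_rV.

Arguments leb {R} n A.

(** * Volumes of boxes and Gaussian integrals *)

Section lebesgue_boxes_gaussians.
Local Open Scope ereal_scope.
Context {R : realType}.

Lemma measurable_box n (A : 'I_n -> set (measurableTypeR R)) : (forall i, measurable (A i)) ->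
  measurable ([set x : 'rV[R]_n | forall i, A i (x ord0 i)] : set (borel_rV R n)).
Proof.
move=> mA; rewrite [X in measurable X](_ : _ =
    \bigcap_i ((fun x : 'rV[R]_n => x ord0 i) @^-1` A i)).
  apply: fin_bigcap_measurable => // i _.
  by rewrite -[X in measurable X]setTI; apply: (measurable_coord i) => //; exact: mA.
by apply/seteqP; split => x /= h i; [move=> _|]; exact: h.
Qed.

Lemma leb_box n (A : 'I_n -> set (measurableTypeR R)) (l : 'I_n -> R) :
  (forall i, measurable (A i)) ->
  (forall i, lebesgue_measure (A i) = (l i)%:E) ->
  leb n [set x : 'rV[R]_n | forall i, A i (x ord0 i)] = (\prod_(i < n) l i)%R%:E.
Proof.
move=> mA lA; rewrite -(@leb_integral_prod _ _ (fun i => \1_(A i)))//; first last.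
- by move=> i; rewrite integral_indic// setIT; exact: lA.
- by move=> i; apply: measurable_indic; exact: mA.
transitivity (\int[leb n]_x (\1_[set x : 'rV[R]_n | forall i, A i (x ord0 i)] x)%:E).
  by rewrite integral_indic ?setIT//; exact: measurable_box.
apply: eq_integral => x _; congr EFin; rewrite indicE.
have [/set_mem/= xA|xA] := boolP (x \in _).
  by rewrite big1// => i _; rewrite indicE mem_set//=; exact: xA.
suff [i xi] : exists i, ~ A i ((x : 'rV[R]_n) ord0 i).
  by rewrite (bigD1 i)//= indicE memNset// mul0r.
apply/existsNP => h; move: xA; rewrite mem_set//.
Qed.

Let dyadic_itv k (z : int) : set (measurableTypeR R) :=
  `[(z%:~R / 2 ^+ k)%R, ((z + 1)%:~R / 2 ^+ k)%R[%classic.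

Lemma dyadic_cubeE n k (z : 'rV[int]_n) : dyadic k @^-1` [set z] =
  [set x : 'rV[R]_n | forall i, dyadic_itv k (z ord0 i) (x ord0 i)].
Proof.
apply/seteqP; split => x /=.
  by move/dyadicP => h i; rewrite /dyadic_itv/= in_itv/=; exact: h.
by move=> h; apply/dyadicP => i; have := h i; rewrite /dyadic_itv/= in_itv/=.
Qed.

Lemma measurable_dyadic n k (z : 'rV[int]_n) :
  measurable (dyadic k @^-1` [set z] : set (borel_rV R n)).
Proof.
by rewrite dyadic_cubeE; apply: (measurable_box (A := fun i => dyadic_itv k (z ord0 i))) => i; exact: measurable_itv.
Qed.

Lemma leb_dyadic n k (z : 'rV[int]_n) :
  @leb R n (dyadic k @^-1` [set z]) = ((2 ^- k) ^+ n)%R%:E.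
Proof.
rewrite dyadic_cubeE (@leb_box _ (fun i => dyadic_itv k (z ord0 i)) (fun=> (2 ^- k)%R)).
- by rewrite prodr_const card_ord.
- by move=> i; exact: measurable_itv.
move=> i; rewrite /dyadic_itv lebesgue_measure_itv/= lte_fin ltr_pM2r ?invr_gt0 ?exprn_gt0//.
rewrite ltr_int ltzD1 lexx EFinN -EFinD; congr EFin.
by rewrite rmorphD/=; lra.
Qed.

Definition gauss (t : R) n (x z : 'rV[R]_n) : R := expR (- (t * sqdist x z)).

Lemma gauss_ge0 t n (x z : 'rV[R]_n) : (0 <= gauss t x z)%R.
Proof. exact: expR_ge0. Qed.

Lemma gauss_le1 t n (x z : 'rV[R]_n) : (0 <= t)%R -> (gauss t x z <= 1)%R.
Proof. by move=> t0; rewrite -expR0 ler_expR oppr_le0 mulr_ge0// sqdist_ge0. Qed.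

Lemma gaussC t n (x z : 'rV[R]_n) : gauss t x z = gauss t z x.
Proof. by rewrite /gauss -!euclid_sqr euclidC. Qed.

Lemma measurable_gauss d (T : measurableType d) n (t : T -> R) (f g : T -> borel_rV R n) :
  measurable_fun setT t -> measurable_fun setT f -> measurable_fun setT g ->
  measurable_fun setT (fun w => gauss (t w) (f w) (g w)).
Proof.
move=> mt mf mg; apply: (measurableT_comp (@measurable_expR R)).
apply: measurable_funN; apply: measurable_funM => //.
exact: measurable_sqdist.
Qed.

Lemma integral_gauss1 (t m : R) : (0 < t)%R ->
  \int[lebesgue_measure]_a (expR (- (t * (m - a) ^+ 2)))%:E = (Num.sqrt (pi / t))%:E.
Proof.
(* The integrand is a multiple of the normal density of mean [m] and variance 1/(2t). *)
move=> t0; set s := Num.sqrt (t^-1 / 2).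
have s2 : (s ^+ 2 = t^-1 / 2)%R by rewrite sqr_sqrtr// mulr_ge0// invr_ge0 ltW.
have s0 : s != 0%R by rewrite gt_eqF// sqrtr_gt0 mulr_gt0 ?invr_gt0.
have pE : normal_peak s = (Num.sqrt (pi / t))^-1%R.
  rewrite /normal_peak s2; congr (Num.sqrt _)^-1%R.
  by rewrite -mulr_natr; field; rewrite gt_eqF.
have q0 : (0 < Num.sqrt (pi / t) :> R)%R by rewrite sqrtr_gt0 divr_gt0 ?pi_gt0.
transitivity (\int[lebesgue_measure]_a ((Num.sqrt (pi / t))%:E * (normal_pdf m s a)%:E)).
  apply: eq_integral => a _; rewrite normal_pdfE// pE -EFinM; congr EFin.
  rewrite mulVKf ?gt_eqF// /normal_fun s2; congr expR.
  by rewrite -mulr_natr; field; rewrite gt_eqF.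
rewrite ge0_integralZl//; first by rewrite integral_normal_pdf mule1.
- by apply/measurable_EFinP; exact: measurable_normal_pdf.
- by move=> a _; rewrite lee_fin normal_pdf_ge0.
Qed.

Lemma gauss_prod t n (x z : 'rV[R]_n) :
  gauss t x z = (\prod_(i < n) expR (- (t * (x ord0 i - z ord0 i) ^+ 2)))%R.
Proof.
by rewrite /gauss /sqdist mulr_sumr -sumrN expR_sum.
Qed.

(** The total mass (pi/t)^(n/2) of exp(-t|z|^2) on R^n. *)
Definition gauss_mass n (t : R) : R := Num.sqrt (pi / t) ^+ n.

Lemma gauss_mass_gt0 n t : (0 < t)%R -> (0 < gauss_mass n t)%R.
Proof. by move=> t0; rewrite exprn_gt0// sqrtr_gt0 divr_gt0 ?pi_gt0. Qed.

Lemma integral_gauss n (t : R) (x : 'rV[R]_n) : (0 < t)%R ->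
  \int[leb n]_z (gauss t x z)%:E = (gauss_mass n t)%:E.
Proof.
move=> t0; rewrite /gauss_mass -[in RHS](card_ord n) -prodr_const.
rewrite -(@leb_integral_prod _ _ (fun i a => expR (- (t * (x ord0 i - a) ^+ 2))%R))//.
- by apply: eq_integral => z _; rewrite gauss_prod.
- move=> i; apply: (measurableT_comp (@measurable_expR R)).
  apply: measurable_funN; apply: measurable_funM => //.
  by apply: measurable_funX; apply: measurable_funB.
- by move=> i; exact: integral_gauss1.
Qed.

Lemma sqrt_4 (u : R) : (0 < u)%R -> (Num.sqrt (u / 4) = Num.sqrt u / 2)%R.
Proof.
move=> u0; apply/eqP; rewrite -(@eqrXn2 _ 2)// ?divr_ge0 ?sqrtr_ge0//.
by rewrite exprMn !sqr_sqrtr ?divr_ge0 ?ltW//; apply/eqP; field.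
Qed.

(** Dividing the squared mass at 2t by the convolution constant, the mass at 4t, leaves the mass at
    t, which is the factor in the bound on the Gaussian energy. *)
Lemma gauss_mass_4 n (t : R) : (0 < t)%R ->
  (gauss_mass n (2 * t) ^+ 2 = gauss_mass n t * gauss_mass n (4 * t))%R.
Proof.
move=> t0; rewrite /gauss_mass -exprM mulnC exprM -exprMn; congr (_ ^+ _)%R.
have u0 : (0 < pi / t :> R)%R by rewrite divr_gt0 ?pi_gt0.
rewrite sqr_sqrtr; last by rewrite divr_ge0 ?pi_ge0// mulr_ge0// ltW.
rewrite (_ : pi / (4 * t) = pi / t / 4)%R; last by field; rewrite gt_eqF.
rewrite sqrt_4// mulrA -expr2 sqr_sqrtr ?ltW//.
by field; rewrite gt_eqF.
Qed.

(** Parallelogram identity around the midpoint m of x and y: 2|x-z|^2 + 2|y-z|^2 = |x-y|^2 +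
    4|m-z|^2. *)
Lemma gauss_convolution n (t : R) (x y : 'rV[R]_n) : (0 < t)%R ->
  \int[leb n]_z (gauss (2 * t) x z * gauss (2 * t) y z)%:E =
  (gauss_mass n (4 * t) * gauss t x y)%:E.
Proof.
move=> t0; pose m : 'rV[R]_n := (2^-1 *: (x + y))%R.
transitivity (\int[leb n]_z ((gauss t x y)%:E * (gauss (4 * t) m z)%:E)).
  apply: eq_integral => z _; rewrite -!EFinM /gauss -!expRD; congr (expR _)%:E.
  have E : (2 * sqdist x z + 2 * sqdist y z = sqdist x y + 4 * sqdist m z)%R.
    rewrite /sqdist !mulr_sumr -!big_split/=; apply: eq_bigr => i _.
    by rewrite !mxE; field.
  rewrite -!opprD; congr (- _)%R.
  transitivity (t * (2 * sqdist x z + 2 * sqdist y z))%R; first by ring.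
  by rewrite E; ring.
rewrite ge0_integralZl//.
- by rewrite integral_gauss ?mulr_gt0// -EFinM mulrC.
- by apply/measurable_EFinP; exact: measurable_gauss.
- by move=> z _; rewrite lee_fin gauss_ge0.
- by rewrite lee_fin gauss_ge0.
Qed.

Lemma gauss_mass_half n (t : R) : (0 < t)%R ->
  (gauss_mass n t = Num.sqrt 2 ^+ n * gauss_mass n (2 * t))%R.
Proof.
move=> t0; rewrite /gauss_mass -exprMn -sqrtrM//; congr (Num.sqrt _ ^+ _)%R.
by field; rewrite gt_eqF.
Qed.

(** Outside [A] the Euclidean distance to [x] is at least [r], so half of the exponent 2t|x-z|^2
    yields the factor exp(-t r^2); what remains is a Gaussian at scale t, whose mass is 2^(n/2)
    times that at 2t. *)
Lemma gauss_tail n (t r : R) (x : 'rV[R]_n) (A : set (borel_rV R n)) :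
  (0 < t)%R -> (0 <= r)%R -> measurable A ->
  (forall z : 'rV[R]_n, (`|x - z| < r)%R -> A z) ->
  (gauss_mass n (2 * t) * (1 - Num.sqrt 2 ^+ n * expR (- (t * r ^+ 2))))%:E <=
  \int[leb n]_(z in A) (gauss (2 * t) x z)%:E.
Proof.
move=> t0 r0 mA xA.
have t20 : (0 < 2 * t)%R by rewrite mulr_gt0.
have mg s D : measurable_fun D (fun z : borel_rV R n => (gauss s x z)%:E).
  by apply: measurable_funTS; apply/measurable_EFinP; exact: measurable_gauss.
have g0 s D : forall z : borel_rV R n, D z -> 0 <= (gauss s x z)%:E.
  by move=> z _; rewrite lee_fin gauss_ge0.
have := integral_gauss x t20.
rewrite -[in X in X = _](setUv A) ge0_integral_setU//; [|exact: measurableC| |exact/disj_setPCl].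
  2: exact: g0.
have tail : \int[leb n]_(z in ~` A) (gauss (2 * t) x z)%:E <=
    (expR (- (t * r ^+ 2)) * gauss_mass n t)%:E.
  apply: (@le_trans _ _ (\int[leb n]_(z in ~` A) ((expR (- (t * r ^+ 2)))%:E * (gauss t x z)%:E))).
    apply: ge0_le_integral => //.
    - exact: measurableC.
    - exact: g0.
    - by apply: emeasurable_funM; [exact: measurable_cst|exact: mg].
    - move=> z zA; rewrite -EFinM lee_fin /gauss -expRD ler_expR.
      have rS : (r ^+ 2 <= sqdist x z)%R.
        have rd : (r <= edist x z)%R.
          rewrite (le_trans _ (norm_le_euclid _ _))// leNgt; apply/negP.
          by move=> /xA.
        by rewrite -euclid_sqr ler_pXn2r ?nnegrE//; exact: euclid_ge0.
      by have := ler_wpM2l (ltW t0) rS; lra.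
  rewrite ge0_integralZl//; [|exact: measurableC|first [exact: g0|by rewrite lee_fin expR_ge0]].
  rewrite EFinM lee_wpmul2l ?lee_fin ?expR_ge0// -(integral_gauss x t0).
  by apply: ge0_subset_integral => //; [exact: measurableC|exact: g0].
move=> E; rewrite -(leeD2rE _ _ (ltac:(done) : (expR (- (t * r ^+ 2)) * gauss_mass n t)%:E \is a fin_num)).
apply: (@le_trans _ _ (gauss_mass n (2 * t))%:E); last by rewrite -E leeD2l.
rewrite -EFinD lee_fin (gauss_mass_half n t0) le_eqVlt; apply/orP; left; apply/eqP; ring.
Qed.

End lebesgue_boxes_gaussians.

(** * Hausdorff measure *)

Section hausdorff_outer_measure.
Local Open Scope ereal_scope.
Context {R : realType} {n : nat}.
Implicit Types (A B U : set 'rV[R]_n) (s delta : R).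

Lemma ediam_ubound U x y : U x -> U y -> (edist x y)%:E <= ediam U.
Proof. by move=> Ux Uy; apply: ereal_sup_ubound; exists x => //; exists y. Qed.

Lemma ediam_ge0 U : U !=set0 -> 0 <= ediam U.
Proof.
by move=> [x Ux]; rewrite (le_trans _ (ediam_ubound Ux Ux))// lee_fin euclid_ge0.
Qed.

Lemma ediam_le U (r : \bar R) : (forall x y, U x -> U y -> (edist x y)%:E <= r) ->
  ediam U <= r.
Proof. by move=> h; apply: ge_ereal_sup => _ [x Ux [y Uy <-]]; exact: h. Qed.

(** As the supremum of no distances is -oo, the empty set meets every diameter bound and can pad a
    cover. *)
Lemma ediam0 : ediam (set0 : set 'rV[R]_n) = -oo.
Proof. by apply/eqP; rewrite -leeNy_eq; apply: ediam_le. Qed.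

Lemma gauge0 s : hausdorff_gauge s (set0 : set 'rV[R]_n) = 0.
Proof. by rewrite /hausdorff_gauge eqxx. Qed.

Lemma gaugeE s U : U !=set0 -> hausdorff_gauge s U = poweR (ediam U) s.
Proof. by move=> /set0P U0; rewrite /hausdorff_gauge (negbTE U0). Qed.

Lemma gauge_ge0 s U : 0 <= hausdorff_gauge s U.
Proof. by rewrite /hausdorff_gauge; case: ifP => // _; exact: poweR_ge0. Qed.

(* Covers by arbitrary sets are covers by measurable sets of the discrete
   sigma-algebra, so [hausdorff_content] is a Caratheodory extension. *)
Let discrete := g_sigma_algebraType [set: set 'rV[R]_n].

(** The restriction on diameters is moved into the gauge: a set that is too large costs [+oo], so a
    cover of finite cost is admissible. *)
Let small_gauge s delta : set discrete -> \bar R := fun U =>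
  if ediam U <= delta%:E then hausdorff_gauge s U else +oo.

Let small_gauge_ge0 s delta U : 0 <= small_gauge s delta U.
Proof. by rewrite /small_gauge; case: ifP => // _; exact: gauge_ge0. Qed.

Let small_gauge0 s delta : small_gauge s delta set0 = 0.
Proof. by rewrite /small_gauge ediam0 leNye gauge0. Qed.

Let measurable_discrete (U : set discrete) : measurable U.
Proof. exact: sub_sigma_algebra. Qed.

Let contentE s delta : hausdorff_content s delta = mu_ext (small_gauge s delta).
Proof.
apply/funext => A; apply/eqP; rewrite eq_le; apply/andP; split.
  apply: le_ereal_inf_tmp => _ [U [_ AU] <-].
  have [h|/existsNP[i Ui]] := pselect (forall i, ediam (U i) <= delta%:E).
    apply: ereal_inf_lbound; exists U => //.
    by apply: eq_eseriesr => i _; rewrite /small_gauge h.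
  rewrite [leRHS](_ : _ = +oo) ?leey//.
  apply: (@nneseries_pinfty _ _ xpredT i) => //.
  by rewrite /small_gauge; case: ifPn => // _; apply/negP.
apply: le_ereal_inf_tmp => _ [U [AU Ud] <-].
apply: ereal_inf_lbound; exists U; first by split.
by apply: eq_eseriesr => i _; rewrite /small_gauge Ud.
Qed.

Lemma content0 s delta : hausdorff_content s delta (set0 : set 'rV[R]_n) = 0.
Proof. by rewrite contentE mu_ext0. Qed.

Lemma content_ge0 s delta A : 0 <= hausdorff_content s delta A.
Proof. by rewrite contentE mu_ext_ge0. Qed.

Lemma le_content s delta :
  {homo (@hausdorff_content R n s delta) : A B / A `<=` B >-> A <= B}.
Proof. by move=> A B AB; rewrite !contentE; apply: le_mu_ext. Qed.

Lemma content_sigma_subadditive s delta :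
  sigma_subadditive (@hausdorff_content R n s delta).
Proof.
move=> F; rewrite contentE.
have H := @mu_ext_sigma_subadditive _ discrete R (small_gauge s delta)
  (small_gauge_ge0 s delta) F.
exact: H.
Qed.

HB.instance Definition _ s delta := isOuterMeasure.Build R 'rV[R]_n
  (@hausdorff_content R n s delta) (content0 s delta) (content_ge0 s delta)
  (@le_content s delta) (@content_sigma_subadditive s delta).

Lemma content_gauge s delta U : ediam U <= delta%:E ->
  hausdorff_content s delta U <= hausdorff_gauge s U.
Proof.
move=> Ud; apply: ereal_inf_lbound; exists (fun i => if i == 0%N then U else set0).
  by split=> [x Ux|[|i]]; [exists 0%N|exact: Ud|rewrite /= ediam0 leNye].
rewrite (@nneseriesD1 _ _ 0%N)//; last by move=> i _; exact: gauge_ge0.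
rewrite eseries0 ?adde0// => -[|i] _ //= _; exact: gauge0.
Qed.

Lemma content_antitone s delta delta' A : (delta <= delta')%R ->
  hausdorff_content s delta' A <= hausdorff_content s delta A.
Proof.
move=> dd; apply: le_ereal_inf_tmp => _ [U [AU Ud] <-]; apply: ereal_inf_lbound.
by exists U => //; split=> // i; rewrite (le_trans (Ud i))// lee_fin.
Qed.

Lemma content_le_raw s delta A : (0 < delta)%R ->
  hausdorff_content s delta A <= hausdorff_raw s A.
Proof. by move=> d0; apply: ereal_sup_ubound; exists delta. Qed.

Lemma raw_le s A (r : \bar R) :
  (forall delta, (0 < delta)%R -> hausdorff_content s delta A <= r) ->
  hausdorff_raw s A <= r.
Proof. by move=> h; apply: ge_ereal_sup => _ [delta d0 <-]; exact: h. Qed.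

Lemma raw0 s : hausdorff_raw s (set0 : set 'rV[R]_n) = 0.
Proof.
apply/eqP; rewrite eq_le; apply/andP; split.
  by apply: raw_le => delta _; rewrite content0.
by rewrite -(content0 s 1%R) content_le_raw.
Qed.

Lemma raw_ge0 s A : 0 <= hausdorff_raw s A.
Proof. by rewrite (le_trans (content_ge0 s 1%R A))// content_le_raw. Qed.

Lemma le_raw s : {homo (@hausdorff_raw R n s) : A B / A `<=` B >-> A <= B}.
Proof.
move=> A B AB; apply: raw_le => delta d0.
by rewrite (le_trans (le_content s delta AB))// content_le_raw.
Qed.

Lemma raw_sigma_subadditive s : sigma_subadditive (@hausdorff_raw R n s).
Proof.
move=> F; apply: raw_le => delta d0.
rewrite (le_trans (content_sigma_subadditive s delta F))//.
by apply: lee_nneseries => i _; [move=> _; exact: content_ge0|exact: content_le_raw].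
Qed.

HB.instance Definition _ s := isOuterMeasure.Build R 'rV[R]_n
  (@hausdorff_raw R n s) (raw0 s) (raw_ge0 s) (@le_raw s)
  (@raw_sigma_subadditive s).

(** Nonnegativity makes all terms finite when [r] is, and then the terms can be moved across the
    inequality one at a time. Needed because two Hausdorff measures are suprema over independent
    scales. *)
Lemma ereal_sup_add_le (S T : set \bar R) (r : \bar R) :
  S !=set0 -> T !=set0 -> (forall x, S x -> 0 <= x) -> (forall x, T x -> 0 <= x) ->
  (forall x y, S x -> T y -> x + y <= r) -> ereal_sup S + ereal_sup T <= r.
Proof.
move=> [x0 Sx0] [y0 Ty0] S0 T0 h.
have r0 : 0 <= r by apply: le_trans (h _ _ Sx0 Ty0); apply: adde_ge0; [exact: S0|exact: T0].
have [->|roo] := eqVneq r +oo; first by rewrite leey.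
have rfin : r \is a fin_num by rewrite ge0_fin_numE// ltey.
have fin x y : S x -> T y -> x \is a fin_num /\ y \is a fin_num.
  move=> Sx Ty; have xy : x + y < +oo by rewrite (le_lt_trans (h _ _ Sx Ty)) ?ltey.
  have x0' := S0 _ Sx; have y0' := T0 _ Ty.
  by rewrite !ge0_fin_numE//; split; apply: le_lt_trans xy; [rewrite leeDl|rewrite leeDr].
have hS y : T y -> ereal_sup S <= r - y.
  move=> Ty; apply: ge_ereal_sup => x Sx.
  by rewrite leeBrDr ?h//; have [] := fin _ _ Sx Ty.
have Sge0 : 0 <= ereal_sup S by rewrite (le_trans (S0 _ Sx0))// ereal_sup_ubound.
have Sfin : ereal_sup S \is a fin_num.
  rewrite ge0_fin_numE// (le_lt_trans (hS _ Ty0))//.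
  by rewrite ltey_eq fin_numB rfin (fin _ _ Sx0 Ty0).2.
rewrite addeC -leeBrDr//; apply: ge_ereal_sup => y Ty.
by rewrite leeBrDr// addeC -leeBrDr ?hS// (fin _ _ Sx0 Ty).2.
Qed.

(** A covering set of diameter below [delta0] cannot meet both sets, so a fine cover of the union
    splits into one cover of each. *)
Lemma raw_separated s A B delta0 : (0 < delta0)%R ->
  (forall x y, A x -> B y -> (delta0 <= edist x y)%R) ->
  hausdorff_raw s A + hausdorff_raw s B <= hausdorff_raw s (A `|` B).
Proof.
move=> d00 AB; apply: ereal_sup_add_le.
- by exists (hausdorff_content s 1%R A), 1%R => //=.
- by exists (hausdorff_content s 1%R B), 1%R => //=.
- by move=> _ [? _ <-]; exact: content_ge0.
- by move=> _ [? _ <-]; exact: content_ge0.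
move=> _ _ [d1 d10 <-] [d2 d20 <-].
pose d := Num.min (Num.min d1 d2) (delta0 / 2)%R.
have d0 : (0 < d)%R by rewrite !lt_min d10 d20 divr_gt0.
have dd0 : (d < delta0)%R.
  by rewrite gt_min orbC ltr_pdivrMr// mulr_natr mulr2n ltrDl d00.
apply: (@le_trans _ _ (hausdorff_content s d A + hausdorff_content s d B)).
  by rewrite leeD// content_antitone// !ge_min lexx ?orbT.
rewrite (le_trans _ (content_le_raw s (A `|` B) d0))//.
apply: le_ereal_inf_tmp => _ [U [ABU Ud] <-].
pose V (C : set 'rV[R]_n) i := if U i `&` C == set0 then set0 else U i.
have hV C : C `<=` A `|` B -> hausdorff_content s d C <= \sum_(0 <= i <oo) hausdorff_gauge s (V C i).
  move=> CAB; apply: ereal_inf_lbound; exists (V C) => //; split.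
    move=> x Cx; have [i _ Uix] := ABU x (CAB x Cx); exists i => //.
    by rewrite /V; case: ifPn => // /eqP/seteqP[/(_ x)]; case.
  by move=> i; rewrite /V; case: ifPn => // _; rewrite ediam0 leNye.
apply: le_trans (leeD (hV A (@subsetUl _ A B)) (hV B (@subsetUr _ A B))) _.
rewrite -nneseriesD; [|by move=> *; exact: gauge_ge0..].
apply: lee_nneseries => i _; first by move=> _; rewrite adde_ge0 ?gauge_ge0.
rewrite /V; case: ifPn => [_|/set0P[x [Ux Ax]]].
  by rewrite gauge0 add0e; case: ifPn => // _; rewrite gauge0 gauge_ge0.
case: ifPn => [_|/set0P[y [Uy By]]]; first by rewrite gauge0 adde0.
exfalso; have := le_trans (ediam_ubound Ux Uy) (Ud i).
by rewrite lee_fin leNgt (lt_le_trans dd0)// AB.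
Qed.

End hausdorff_outer_measure.

Section hausdorff_lipschitz.
Local Open Scope ereal_scope.
Context {R : realType} {m n : nat}.

(** The images of the traces of a cover on [A], where [phi] is controlled, form a cover of the
    image. Diameters grow by [lambda], hence the scale [delta / lambda] in the source. *)
Lemma raw_lipschitz (s lambda : R) (A : set 'rV[R]_m) (phi : 'rV[R]_m -> 'rV[R]_n) :
  (0 <= s)%R -> (0 < lambda)%R ->
  (forall x y, A x -> A y -> (edist (phi x) (phi y) <= lambda * edist x y)%R) ->
  hausdorff_raw s (phi @` A) <= (lambda `^ s)%R%:E * hausdorff_raw s A.
Proof.
move=> s0 l0 phil; apply: raw_le => delta d0.
have ls0 : (0 < lambda `^ s)%R by exact: powR_gt0.
rewrite -lee_pdivrMl//.
apply: (@le_trans _ _ (hausdorff_content s (delta / lambda)%R A)); last first.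
  by apply: content_le_raw; rewrite divr_gt0.
apply: le_ereal_inf_tmp => _ [U [AU Ud] <-]; rewrite lee_pdivrMl//.
rewrite -nneseriesZl; last by move=> i _; exact: gauge_ge0.
have diamV i : ediam (phi @` (U i `&` A)) <= lambda%:E * ediam (U i).
  apply: ediam_le => _ _ [x [Ux Ax] <-] [y [Uy Ay] <-].
  rewrite (@le_trans _ _ (lambda * edist x y)%:E)// ?lee_fin ?phil//.
  by rewrite EFinM; apply: lee_wpmul2l; [rewrite lee_fin ltW|exact: ediam_ubound].
apply: (@le_trans _ _ (\sum_(0 <= i <oo) hausdorff_gauge s (phi @` (U i `&` A)))).
  apply: ereal_inf_lbound; exists (fun i => phi @` (U i `&` A)) => //; split.
    by move=> _ [x Ax <-]; have [i _ Ux] := AU x Ax; exists i => //; exists x.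
  move=> i; rewrite (le_trans (diamV i))//.
  rewrite (@le_trans _ _ (lambda%:E * (delta / lambda)%:E))//.
    by rewrite lee_wpmul2l// lee_fin ltW.
  by rewrite -EFinM mulrC divfK ?gt_eqF.
apply: lee_nneseries => i _; first by move=> _; exact: gauge_ge0.
rewrite {1}/hausdorff_gauge; case: ifPn => [_|/set0P[_ [x [Ux Ax] _]]].
  by rewrite mule_ge0 ?gauge_ge0// lee_fin ltW.
have Ui0 : U i !=set0 by exists x.
rewrite gaugeE//.
rewrite -poweR_EFin -poweRM; [|by rewrite lee_fin ltW|exact: ediam_ge0].
apply: gt0_ler_poweR => //; rewrite in_itv/= leey andbT.
  by apply: ediam_ge0; exists (phi x), x.
by apply: mule_ge0; [rewrite lee_fin ltW|exact: ediam_ge0].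
Qed.

End hausdorff_lipschitz.

(** * Hausdorff measure against Lebesgue measure on R^n *)

Section hausdorff_lebesgue.
Local Open Scope ereal_scope.
Context {R : realType} {n : nat}.
Implicit Types A K U : set 'rV[R]_n.

Lemma dyadic_le k l (x y : 'rV[R]_n) : (k <= l)%N -> dyadic l x = dyadic l y ->
  dyadic k x = dyadic k y.
Proof.
move=> /subnK <-; elim: (l - k)%N => // j ih.
by rewrite addSn => /dyadicS/ih.
Qed.

(** A union of cubes of generation [k] is a countable disjoint union, so a bound on each cube sums
    up. The outer measure is arbitrary so as to cover both the content at a fixed scale and the
    Hausdorff measure itself. *)
Lemma saturated_outer_measure_le (nu : {outer_measure set 'rV[R]_n -> \bar R})
    (C : R) k A : (0 <= C)%R ->
  (forall z, nu (dyadic k @^-1` [set z]) <= (C * (2 ^- k) ^+ n)%:E) ->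
  (forall x y, dyadic k x = dyadic k y -> A x -> A y) ->
  measurable (A : set (borel_rV R n)) /\ nu A <= C%:E * leb n A.
Proof.
move=> C0 nuC satA.
pose F i : set (borel_rV R n) := [set x : 'rV[R]_n | A x /\ pickle (dyadic k x) = i].
have FE i : F i = set0 \/ exists z, F i = dyadic k @^-1` [set z].
  have [[x [Ax xi]]|F0] := pselect (exists x, F i x); last first.
    by left; apply/seteqP; split=> // x Fx; apply: F0; exists x.
  right; exists (dyadic k x); apply/seteqP; split=> y /=.
    by move=> [Ay]; rewrite -xi => /(pcan_inj pickleK).
  by move=> yx; split; [exact: satA Ax|rewrite yx].
have mF i : measurable (F i).
  by have [->|[z ->]] := FE i; [exact: measurable0|exact: measurable_dyadic].
have AE : A = \bigcup_i F i.
  apply/seteqP; split=> [x Ax|x [i _ []]//].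
  by exists (pickle (dyadic k x)).
have tF : trivIset setT F.
  by apply/trivIsetP => i j _ _ /eqP ij; apply/seteqP; split=> // x [[_ xi] [_ xj]]; apply: ij; rewrite -xi.
split; first by rewrite AE; exact: bigcupT_measurable.
rewrite {2}AE measure_semi_bigcup//; last exact: bigcupT_measurable.
rewrite -nneseriesZl; last by move=> i _; exact: measure_ge0.
rewrite {1}AE (le_trans (outer_measure_sigma_subadditive nu F))//.
apply: lee_nneseries => i _; first by move=> _; exact: outer_measure_ge0.
have [->|[z ->]] := FE i; first by rewrite outer_measure0 mule_ge0.
by apply: le_trans (nuC z) _; rewrite EFinM -(leb_dyadic k z).
Qed.

Lemma dyadic_ediam k (z : 'rV[int]_n) :
  ediam (dyadic k @^-1` [set z] : set 'rV[R]_n) <= (n%:R * 2 ^- k)%:E.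
Proof.
apply: ediam_le => x y /= xz yz; rewrite lee_fin (le_trans (euclid_le_norm _ _))//.
by rewrite ler_wpM2l// dyadic_close// xz.
Qed.

Lemma gauge_natE U (r : R) : U !=set0 -> ediam U <= r%:E ->
  hausdorff_gauge n%:R U <= (r ^+ n)%:E.
Proof.
move=> U0 Ur; have r0 : (0 <= r)%R by rewrite -lee_fin (le_trans (ediam_ge0 U0)).
rewrite gaugeE//.
rewrite -powR_mulrn// -poweR_EFin.
by apply: gt0_ler_poweR => //; rewrite in_itv/= leey andbT ?ediam_ge0 ?lee_fin.
Qed.

(** A set of diameter r lies in a box of side 2r around any of its points, whence 2^n. The crude
    constant suffices to see that the unit cube has positive Hausdorff measure and that Hausdorff
    null compact sets are Lebesgue null. *)
Lemma leb_le_raw A : measurable (A : set (borel_rV R n)) ->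
  leb n A <= (2 ^+ n)%:E * hausdorff_raw n%:R A.
Proof.
move=> mA; rewrite -lee_pdivrMl ?exprn_gt0//.
apply: le_trans (content_le_raw n%:R A ltr01).
apply: le_ereal_inf_tmp => _ [U [AU Ud] <-]; rewrite lee_pdivrMl ?exprn_gt0//.
have hB i : exists B : set (borel_rV R n), [/\ measurable B, U i `<=` B &
    leb n B <= (2 ^+ n)%:E * hausdorff_gauge n%:R (U i)].
  have [->|/set0P[x Ux]] := eqVneq (U i) set0.
    by exists set0; split=> //; rewrite measure0 mule_ge0 ?gauge_ge0.
  have Ui0 : U i !=set0 by exists x.
  have : ediam (U i) \is a fin_num.
    by rewrite ge0_fin_numE ?ediam_ge0// (le_lt_trans (Ud i)) ?ltry.
  move=> /fineK; set r := fine _ => rE.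
  have r0 : (0 <= r)%R by rewrite -lee_fin rE ediam_ge0.
  pose I j : set (measurableTypeR R) := `[(x ord0 j - r)%R, (x ord0 j + r)%R]%classic.
  exists [set y : 'rV[R]_n | forall j, I j (y ord0 j)]; split.
  - by apply: measurable_box => j; exact: measurable_itv.
  - move=> y Uy j; rewrite /I/= in_itv/= -lter_distl distrC.
    by rewrite (le_trans (coord_le_euclid x y j))// -lee_fin rE ediam_ubound.
  - rewrite (@leb_box _ _ I (fun=> (2 * r)%R)).
    + rewrite prodr_const card_ord exprMn EFinM lee_wpmul2l//.
      by rewrite gaugeE// -rE poweR_EFin powR_mulrn.
    + by move=> j; exact: measurable_itv.
    + move=> j; rewrite /I lebesgue_measure_itv/= lte_fin.
      case: ltP => h; first by rewrite -EFinB; congr EFin; lra.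
      by congr EFin; lra.
have /choice[B hB'] := hB.
rewrite -nneseriesZl; last by move=> i _; exact: gauge_ge0.
apply: (@le_trans _ _ (\sum_(0 <= i <oo) leb n (B i))).
  apply: measure_sigma_subadditive => //; first by move=> i; have [] := hB' i.
  by move=> x /AU[i _ Ux]; exists i => //; have [_ + _] := hB' i; apply.
apply: lee_nneseries => i _; first by move=> _; exact: measure_ge0.
by have [] := hB' i.
Qed.

Definition sym_box (r : R) : set 'rV[R]_n := [set x | forall i, (- r <= x ord0 i <= r)%R].

Lemma measurable_sym_box r : measurable (sym_box r : set (borel_rV R n)).
Proof.
rewrite [X in measurable X](_ : _ =
  [set x : 'rV[R]_n | forall j, (`[(- r)%R, r]%classic : set (measurableTypeR R)) (x ord0 j)]).
  by apply: (measurable_box (A := fun=> _)) => j; exact: measurable_itv.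
by apply/seteqP; split => x /= h i; have := h i; rewrite in_itv.
Qed.

Lemma leb_sym_box r : (0 <= r)%R -> leb n (sym_box r) = ((2 * r) ^+ n)%:E.
Proof.
move=> r0; rewrite [X in leb n X](_ : _ =
  [set x : 'rV[R]_n | forall j, (`[(- r)%R, r]%classic : set (measurableTypeR R)) (x ord0 j)]).
  rewrite (@leb_box _ _ (fun=> _) (fun=> (2 * r)%R)).
  - by rewrite prodr_const card_ord.
  - by move=> i; exact: measurable_itv.
  - move=> i; rewrite lebesgue_measure_itv/= lte_fin.
    by case: ltP => h; rewrite -?EFinB; congr EFin; lra.
by apply/seteqP; split => x /= h i; have := h i; rewrite in_itv.
Qed.

Lemma compact_sub_box K : compact K -> exists2 M : R, (0 < M)%R & K `<=` sym_box M.
Proof.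
move=> /compact_bounded[M [_ hM]]; exists (`|M| + 1)%R; first by rewrite ltr_pwDr.
move=> x Kx i; rewrite -ler_norml (le_trans (coord_le_norm _ _))//.
by apply: hM => //; rewrite (le_lt_trans (ler_norm M))// ltrDl.
Qed.

Lemma leb_compact_fin K : compact K -> leb n K \is a fin_num.
Proof.
move=> cK; have [M M0 KM] := compact_sub_box cK.
rewrite ge0_fin_numE ?measure_ge0//; apply: (@le_lt_trans _ _ (leb n (sym_box M))).
  apply: le_measure; rewrite ?inE//; last exact: measurable_sym_box.
  by apply: closed_measurable_rV; apply: compact_closed cK; exact: norm_hausdorff.
by rewrite leb_sym_box ?ltry// ltW.
Qed.

Definition cubeQ : set 'rV[R]_n := unit_cube.

Lemma raw_cube_fin : hausdorff_raw n%:R cubeQ \is a fin_num.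
Proof.
rewrite ge0_fin_numE ?raw_ge0//.
(* The closed unit cube is not a union of dyadic cubes; this half-open cube contains it and is one
   at every generation. *)
pose A : set 'rV[R]_n := [set x | forall i, (0 <= x ord0 i < 2)%R].
apply: (@le_lt_trans _ _ ((n%:R ^+ n)%:E * leb n A)); last first.
  apply: lte_mul_pinfty; rewrite ?lee_fin ?exprn_ge0//.
  apply: (@le_lt_trans _ _ (leb n (sym_box 2))); last by rewrite leb_sym_box ?ltry.
  apply: le_measure; rewrite ?inE; [|exact: measurable_sym_box|].
    rewrite [X in measurable X](_ : _ =
      [set x : 'rV[R]_n | forall j, (`[0%R, 2%R[%classic : set (measurableTypeR R)) (x ord0 j)]).
      by apply: (measurable_box (A := fun=> _)) => j; exact: measurable_itv.
    by apply/seteqP; split => x /= h i; have := h i; rewrite in_itv.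
  by move=> x Ax i; have /andP[x0 x2] := Ax i; apply/andP; split; lra.
apply: raw_le => delta d0.
have [k kd] : exists k, (n%:R * 2 ^- k <= delta)%R.
  have [k kd] : exists k, (n%:R / delta < k%:R)%R.
    by exists (Num.truncn (n%:R / delta)).+1; exact: truncnS_gt.
  exists k; rewrite ler_pdivrMr ?exprn_gt0// mulrC -ler_pdivrMr//.
  rewrite (le_trans (ltW kd))// -natrX ler_nat ltnW//.
  exact: ltn_expl.
apply: (@le_trans _ _ (hausdorff_content n%:R delta A)).
  by apply: le_content => x Qx i; have /andP[x0 x1] := Qx i; apply/andP; split; lra.
apply: (saturated_outer_measure_le (nu := hausdorff_content n%:R delta) (k := k) _ _ _).2.
- by rewrite exprn_ge0.
- move=> z.
  have [->|/set0P z0] := eqVneq (dyadic k @^-1` [set z] : set 'rV[R]_n) set0.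
    by rewrite outer_measure0 lee_fin mulr_ge0 ?exprn_ge0 ?invr_ge0 ?exprn_ge0.
  rewrite -exprMn; apply: le_trans (gauge_natE z0 (dyadic_ediam k z)).
  by apply: content_gauge; rewrite (le_trans (dyadic_ediam k z)) ?lee_fin.
- move=> x y /(dyadic_le (leq0n k)) /rowP xy Ax i.
  have /andP[x0 x2] := Ax i; have := xy i; rewrite !mxE expr0 !mul1r => E.
  have /andP[y1 y2] := floor_itv (y ord0 i); rewrite -E in y1 y2.
  have f0 : (0 <= Num.floor (x ord0 i))%R by rewrite floor_ge0.
  have f1 : (Num.floor (x ord0 i) < 2)%R.
    rewrite -(ltr_int R) (le_lt_trans (floor_le _))//.
  apply/andP; split; first by rewrite (le_trans _ y1)// ler0z.
  rewrite (lt_le_trans y2)// -[2%R]/(2%:~R) ler_int; lia.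
Qed.

Definition raw_cube : R := fine (hausdorff_raw n%:R cubeQ).

Lemma raw_cubeE : hausdorff_raw n%:R cubeQ = raw_cube%:E.
Proof. by rewrite /raw_cube fineK// raw_cube_fin. Qed.

Lemma raw_cube_gt0 : (0 < raw_cube)%R.
Proof.
have mQ : measurable (cubeQ : set (borel_rV R n)).
  rewrite [X in measurable X](_ : _ =
    [set x : 'rV[R]_n | forall j, (`[0%R, 1%R]%classic : set (measurableTypeR R)) (x ord0 j)]).
    by apply: (measurable_box (A := fun=> _)) => j; exact: measurable_itv.
  by apply/seteqP; split => x /= h i; have := h i; rewrite in_itv.
have := leb_le_raw mQ; rewrite [X in leb n X](_ : _ =
    [set x : 'rV[R]_n | forall j, (`[0%R, 1%R]%classic : set (measurableTypeR R)) (x ord0 j)]).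
  rewrite (@leb_box _ _ (fun=> _) (fun=> 1%R)).
  - rewrite prodr_const expr1n raw_cubeE -EFinM lee_fin => h.
    by rewrite -(@pmulr_rgt0 _ (2 ^+ n)) ?exprn_gt0// (lt_le_trans _ h).
  - by move=> i; exact: measurable_itv.
  - by move=> i; rewrite lebesgue_measure_itv/= lte_fin ltr01 oppr0 adde0.
by apply/seteqP; split => x /= h i; have := h i; rewrite in_itv.
Qed.

(** A dyadic cube lies in the image of the closed unit cube under a similarity of ratio 2^-k. *)
Lemma raw_dyadic k (z : 'rV[int]_n) :
  hausdorff_raw n%:R (dyadic k @^-1` [set z] : set 'rV[R]_n) <=
  (raw_cube * (2 ^- k) ^+ n)%:E.
Proof.
have k0 : (0 < 2 ^+ k :> R)%R by rewrite exprn_gt0.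
pose phi (x : 'rV[R]_n) : 'rV[R]_n := (2 ^- k *: (x + map_mx intr z))%R.
have -> : (raw_cube * (2 ^- k) ^+ n)%:E =
    ((2 ^- k) `^ n%:R)%R%:E * hausdorff_raw n%:R cubeQ.
  by rewrite raw_cubeE -EFinM powR_mulrn 1?mulrC// invr_ge0 ltW.
have L : hausdorff_raw n%:R (phi @` cubeQ) <=
    ((2 ^- k) `^ n%:R)%R%:E * hausdorff_raw n%:R cubeQ.
  apply: raw_lipschitz; [by []|by rewrite invr_gt0|].
  move=> x y _ _; rewrite -(@ler_pXn2r _ 2)// ?nnegrE ?euclid_ge0//.
    rewrite exprMn !euclid_sqr /sqdist mulr_sumr le_eqVlt; apply/orP; left; apply/eqP.
    by apply: eq_bigr => i _; rewrite !mxE; ring.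
  by rewrite mulr_ge0 ?euclid_ge0// invr_ge0 ltW.
apply: le_trans L; apply: le_raw => x /dyadicP xz.
exists (2 ^+ k *: x - map_mx intr z)%R; last first.
  by rewrite /phi subrK scalerA mulVf ?scale1r// gt_eqF.
move=> i; have /andP[] := xz i; rewrite !mxE ler_pdivrMr// ltr_pdivlMr//.
rewrite rmorphD/= mulrC => h1 h2.
by apply/andP; split; lra.
Qed.

(** The set is exhausted by the unions [D k] of the cubes of generation [k] inside it; each
    difference of consecutive unions is again a union of cubes of generation [k]. *)
Lemma raw_open A : open A -> hausdorff_raw n%:R A <= raw_cube%:E * leb n A.
Proof.
move=> oA; pose D k := [set x : 'rV[R]_n | dyadic k @^-1` [set dyadic k x] `<=` A].
have DS : {homo D : k l / (k <= l)%N >-> (k <= l)%O}.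
  by move=> k l kl; apply/subsetPset => x Dx y /(dyadic_le kl) yx; exact: Dx.
have Dsat k l x y : (k <= l)%N -> dyadic l x = dyadic l y -> D k x -> D k y.
  by move=> kl /(dyadic_le kl) xy; rewrite /D/= xy.
have AE : A = \bigcup_k seqD D k.
  rewrite eq_bigcup_seqD; apply/seteqP; split=> [x Ax|x [k _]]; last by apply.
  have [k kA] := nbhs_dyadic (open_nbhs_nbhs (conj oA Ax)).
  by exists k => // y; exact: kA.
have S k : measurable (seqD D k : set (borel_rV R n)) /\
    hausdorff_raw n%:R (seqD D k) <= raw_cube%:E * leb n (seqD D k).
  apply: (saturated_outer_measure_le (nu := @hausdorff_raw R n n%:R) (k := k)).
  - exact: ltW raw_cube_gt0.
  - exact: raw_dyadic.
  - case: k => [|k] x y xy /=; first exact: (Dsat _ _ _ _ (leqnn _) xy).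
    move=> [Dx nDx]; split; first exact: (Dsat _ _ _ _ (leqnn _) xy Dx).
    by move=> /(Dsat _ _ _ _ (leqnSn k) (esym xy)).
rewrite {2}AE measure_semi_bigcup; first last.
- by rewrite -AE; exact: open_measurable_rV.
- exact: trivIset_seqD.
- by move=> k; have [] := S k.
rewrite -nneseriesZl; last by move=> i _; exact: measure_ge0.
rewrite {1}AE (le_trans (raw_sigma_subadditive _ (seqD D)))//.
apply: lee_nneseries => k _; first by move=> _; exact: raw_ge0.
by have [] := S k.
Qed.

Definition thicken K (r : R) : set 'rV[R]_n := [set y | exists2 x, K x & (`|x - y| < r)%R].

Lemma open_thicken K r : open (thicken K r).
Proof.
rewrite openE => y [x Kx xy]; apply/nbhs_ballP; exists (r - `|x - y|)%R => /=; first by rewrite subr_gt0.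
move=> z; rewrite -ball_normE/= => yz; exists x => //.
rewrite (le_lt_trans (ler_distD y x z))//; lra.
Qed.

Lemma sub_thicken K r : (0 < r)%R -> K `<=` thicken K r.
Proof. by move=> r0 x Kx; exists x => //; rewrite subrr normr0. Qed.

(** Continuity from above along the neighbourhoods of radius 1/(k+1): they shrink to [K] because it
    is closed, and have finite measure because it is bounded. *)
Lemma leb_thicken K (e : R) : compact K -> (0 < e)%R ->
  exists2 r, (0 < r)%R & leb n (thicken K r) <= leb n K + e%:E.
Proof.
move=> cK e0; have clK : closed K by apply: compact_closed cK; exact: norm_hausdorff.
pose F k : set (borel_rV R n) := thicken K k.+1%:R^-1.
have F0 k : (0 < k.+1%:R^-1 :> R)%R by rewrite invr_gt0.
have KE : \bigcap_k F k = K.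
  apply/seteqP; split=> x h; last by move=> k _; exact: sub_thicken.
  apply: clK => B /nbhs_ballP[r /= r0 rB].
  pose k := Num.truncn r^-1.
  have [y Ky yx] := h k I; exists y; split => //; apply: rB; rewrite -ball_normE/= distrC.
  rewrite (lt_le_trans yx)// invf_ple ?posrE// ltW//; exact: truncnS_gt.
have mF k : measurable (F k) by apply: open_measurable_rV; exact: open_thicken.
have [M M0 KM] := compact_sub_box cK.
have F0fin : leb n (F 0%N) < +oo.
  apply: (@le_lt_trans _ _ (leb n (sym_box (M + 1)))); last first.
    by rewrite leb_sym_box ?ltry// addr_ge0// ltW.
  apply: le_measure; rewrite ?inE//; first exact: measurable_sym_box.
  move=> y [x /KM Kx xy] i; have := coord_le_norm (x - y) i; rewrite !mxE => /le_lt_trans/(_ xy).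
  by rewrite invr1 ltr_norml => /andP[h1 h2]; have /andP[h3 h4] := Kx i; apply/andP; split; lra.
have mK : measurable (\bigcap_k F k) by rewrite KE; exact: closed_measurable_rV.
have Fdec : {homo F : k l / (k <= l)%N >-> (l <= k)%O}.
  move=> k l kl; apply/subsetPset => y [x Kx xy]; exists x => //.
  by rewrite (lt_le_trans xy)// lef_pV2 ?posrE// ler_nat.
have cv : (leb n \o F) x @[x --> \oo] --> (fine (leb n K))%:E.
  rewrite fineK; last exact: leb_compact_fin.
  by rewrite -[in X in _ --> X]KE; exact: nonincreasing_cvg_mu.
have /fineK <- := leb_compact_fin cK.
have /fine_cvgP[fF /cvgrPdist_lt/(_ e e0) h] := cv.
near \oo%classic => k.

exists k.+1%:R^-1%R => //.
have : (`|fine (leb n K) - (fine \o (leb n \o F)) k| < e)%R by near: k.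
have /fineK <- : leb n (F k) \is a fin_num by near: k.
rewrite -EFinD lee_fin ltr_norml => /andP[h1 _]; move: h1 => /=; lra.
Unshelve. all: by end_near. Qed.

(** A lower bound obtained by shrinking: the similarity that maps the box onto the unit cube has
    ratio 1/(2r). *)
Lemma raw_sym_box r : (0 < r)%R ->
  ((2 * r) ^+ n * raw_cube)%:E <= hausdorff_raw n%:R (sym_box r).
Proof.
move=> r0; have r20 : (0 < 2 * r)%R by rewrite mulr_gt0.
pose phi (x : 'rV[R]_n) : 'rV[R]_n := ((2 * r)^-1 *: (x + const_mx r))%R.
have : hausdorff_raw n%:R cubeQ <= (((2 * r)^-1) `^ n%:R)%R%:E * hausdorff_raw n%:R (sym_box r).
  have L : hausdorff_raw n%:R (phi @` sym_box r) <=
      (((2 * r)^-1) `^ n%:R)%R%:E * hausdorff_raw n%:R (sym_box r).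
    apply: raw_lipschitz; [by []|by rewrite invr_gt0|].
    move=> x y _ _; rewrite -(@ler_pXn2r _ 2)// ?nnegrE ?euclid_ge0//.
      rewrite exprMn !euclid_sqr /sqdist mulr_sumr le_eqVlt; apply/orP; left; apply/eqP.
      by apply: eq_bigr => i _; rewrite !mxE; ring.
    by rewrite mulr_ge0 ?euclid_ge0// invr_ge0 ltW.
  apply: le_trans L; apply: le_raw => x Qx; exists ((2 * r) *: x - const_mx r)%R; last first.
    by rewrite /phi subrK scalerA mulVf ?scale1r// gt_eqF.
  move=> i; have /andP[x0 x1] := Qx i; rewrite !mxE.
  have := ler_wpM2l (ltW r20) x0; have := ler_wpM2l (ltW r20) x1.
  by move=> h1 h2; apply/andP; split; lra.
rewrite raw_cubeE powR_mulrn; last by rewrite invr_ge0 ltW.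
by rewrite exprVn lee_pdivlMl ?exprn_gt0// -EFinM.
Qed.

(* The upper bound comes from open neighbourhoods of [K]; the lower one from
   the upper bound for the complement of [K] in a slightly larger cube. *)
Lemma raw_compact K : compact K -> hausdorff_raw n%:R K = raw_cube%:E * leb n K.
Proof.
move=> cK; have clK : closed K by apply: compact_closed cK; exact: norm_hausdorff.
have c0 := raw_cube_gt0; have Kfin := leb_compact_fin cK.
apply/eqP; rewrite eq_le; apply/andP; split.
  apply/lee_addgt0Pr => e e0.
  have [r r0 Kr] := leb_thicken cK (divr_gt0 e0 c0).
  rewrite (le_trans (le_raw _ (sub_thicken r0)))//.
  rewrite (le_trans (raw_open (@open_thicken K r)))//.
  have c0' : 0 <= raw_cube%:E by rewrite lee_fin ltW.
  rewrite (le_trans (lee_wpmul2l c0' Kr))// -(fineK Kfin) -EFinD -!EFinM -EFinD.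
  by rewrite lee_fin mulrDr [(_ * (e / _))%R]mulrC divfK ?gt_eqF.
have [M M0 KM] := compact_sub_box cK.
have [rKoo|rKfin] := eqVneq (hausdorff_raw n%:R K) +oo; first by rewrite rKoo leey.
have {}rKfin : hausdorff_raw n%:R K \is a fin_num by rewrite ge0_fin_numE ?raw_ge0// ltey.
pose B e : set 'rV[R]_n := thicken (sym_box M) e.
have KB e : (0 < e)%R -> K `<=` B e by move=> e0 x /KM; exact: sub_thicken.
have mK : measurable (K : set (borel_rV R n)) by exact: closed_measurable_rV.
have oB e : open (B e) by exact: open_thicken.
have Bbox e : B e `<=` sym_box (M + e).
  move=> y [x Kx xy] i; have := coord_le_norm (x - y) i; rewrite !mxE => /le_lt_trans/(_ xy).
  by rewrite ltr_norml => /andP[h1 h2]; have /andP[h3 h4] := Kx i; apply/andP; split; lra.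
(* With c the Hausdorff measure of the unit cube: c (2M)^n is at most the measure of [K] plus c (|B
   e| - |K|), and |B e| <= (2(M+e))^n. As e -> 0 the two volumes of cubes cancel. *)
have h e : (0 < e)%R -> ((2 * M) ^+ n * raw_cube + raw_cube * fine (leb n K) <=
    fine (hausdorff_raw n%:R K) + raw_cube * (2 * (M + e)) ^+ n)%R.
  move=> e0.
  have h1 : ((2 * M) ^+ n * raw_cube)%:E <= hausdorff_raw n%:R K + hausdorff_raw n%:R (B e `\` K).
    rewrite (le_trans (raw_sym_box M0))//.
    rewrite (@le_trans _ _ (hausdorff_raw n%:R (B e)))//.
      by apply: le_raw; exact: sub_thicken.
    rewrite (le_trans (le_outer_measureIC _ K _))// leeD//.
    by apply: le_raw; exact: subIsetr.
  have h2 : hausdorff_raw n%:R (B e `\` K) <= raw_cube%:E * leb n (B e `\` K).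
    by apply: raw_open; rewrite setDE; apply: openI => //; exact: closed_openC.
  have h3 : leb n (B e `\` K) = leb n (B e) - leb n K.
    rewrite measureD//.
    - by rewrite setIidr//; exact: KB.
    - exact: open_measurable_rV.
    - apply: le_lt_trans (_ : leb n (sym_box (M + e)) < +oo); last by rewrite leb_sym_box ?ltry// addr_ge0 ?ltW.
      by apply: le_measure; rewrite ?inE//; [exact: open_measurable_rV|exact: measurable_sym_box].
  have h4 : leb n (B e) <= ((2 * (M + e)) ^+ n)%:E.
    rewrite -(leb_sym_box (addr_ge0 (ltW M0) (ltW e0))).
    by apply: le_measure; rewrite ?inE//; [exact: open_measurable_rV|exact: measurable_sym_box].
  have := le_trans h1 (leeD2l _ h2); rewrite h3 -(fineK rKfin) -(fineK Kfin) => h5.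
  have := le_trans h5 (leeD2l _ (lee_wpmul2l _ (leeB h4 (lexx _)))).
  rewrite lee_fin ltW// => /(_ isT); rewrite -EFinB -EFinM -EFinD lee_fin; lra.
rewrite -(fineK rKfin) -(fineK Kfin) -EFinM lee_fin.
suff : ((2 * M) ^+ n * raw_cube + raw_cube * fine (leb n K) <=
    fine (hausdorff_raw n%:R K) + raw_cube * (2 * (M + 0)) ^+ n)%R by rewrite addr0; lra.
pose f e : R := (fine (hausdorff_raw n%:R K) + raw_cube * (2 * (M + e)) ^+ n)%R.
have cf : f e @[e --> (0%R : R)^'+] --> f 0%R.
  apply: cvg_at_right_filter.
  apply: cvgD; first exact: cvg_cst.
  apply: cvgM; first exact: cvg_cst.
  apply: (cvg_comp (fun e => 2 * (M + e))%R (fun u => u ^+ n)%R); last exact: exprn_continuous.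
  by apply: cvgM; [exact: cvg_cst|apply: cvgD; [exact: cvg_cst|exact: cvg_id]].
apply: (cvgr_to_ge cf); near=> e; apply: h; near: e; exact: nbhs_right_gt.
Unshelve. all: by end_near. Qed.

End hausdorff_lebesgue.

(** * Gaussian representation of the Riesz kernel *)

Section power_integrals.
Local Open Scope ereal_scope.
Context {R : realType}.
Notation mu := (@lebesgue_measure R).

Let scale_measurable (a : R) : measurable_fun [set: measurableTypeR R] (fun x : measurableTypeR R => (a * x)%R : measurableTypeR R).
Proof. exact: measurable_funM. Qed.

(** By uniqueness of Lebesgue measure: [a] times its image under x -> a x has the same value on
    half-open intervals. *)
Lemma lebesgue_integral_scale (a : R) (f : R -> \bar R) : (0 < a)%R ->
  measurable_fun setT f -> (forall x, 0 <= f x) ->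
  \int[mu]_x f (a * x)%R = (a^-1)%:E * \int[mu]_x f x.
Proof.
move=> a0 mf f0.
pose na : {nonneg R} := NngNum (ltW a0).
pose m : {measure set (measurableTypeR R) -> \bar R} :=
  mscale na (image_measure mu (@scale_measurable a)).
have muE (A : set (measurableTypeR R)) : measurable A -> mu A = m A.
  move=> mA; apply: (@lebesgue_measure_unique _ m) => // X [[x y] /= _ <-].
  rewrite /m /= /mscale /= /image_measure /pushforward.
  rewrite [X in _ = _ * mu X](_ : _ = `](x / a)%R, (y / a)%R]%classic); last first.
    apply/seteqP; split=> z /=; rewrite !in_itv/= ltr_pdivrMr// ler_pdivlMr//;
      by rewrite [(z * a)%R]mulrC.
  rewrite !lebesgue_measure_itv/= !lte_fin ltr_pM2r ?invr_gt0//.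
  case: ifP => _; last by rewrite mule0.
  by rewrite -!EFinB -EFinM; congr EFin; field; rewrite gt_eqF.
have -> : \int[mu]_x f x = \int[m]_x f x.
  by apply: eq_measure_integral => A mA _; exact: muE.
rewrite ge0_integral_mscale//.
have -> : \int[image_measure mu (@scale_measurable a)]_x f x = \int[mu]_x f (a * x)%R.
  have := @ge0_integral_pushforward _ _ _ _ R _ (@scale_measurable a) mu setT f measurableT mf (fun x _ => f0 x).
  by rewrite preimage_setT.
by rewrite muleA -EFinM mulVf ?gt_eqF// mul1e.
Qed.

Lemma powR_continuous_pos (a t : R) : (0 < t)%R ->
  {for t, continuous (fun x => x `^ a)%R}.
Proof.
move=> t0; apply: differentiable_continuous; apply/derivable1_diffP.
by apply: derivable_powR; rewrite in_itv/= t0.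
Qed.

Lemma powR_cvg_infty0 (q : R) : (0 < q)%R -> (x `^ (- q))%R @[x --> +oo%R] --> (0 : R)%R.
Proof.
move=> q0; apply/cvgrPdist_le => /= e e0.
near=> x; rewrite sub0r normrN ger0_norm ?powR_ge0//.
have x0 : (0 < x)%R by near: x; exact: nbhs_pinfty_gt.
pose c := (e `^ (- q^-1))%R; have c0 : (0 < c)%R by exact: powR_gt0.
have -> : e = (c `^ (- q))%R.
  by rewrite -powRrM mulrNN mulVf ?gt_eqF// powRr1// ltW.
rewrite !powRN lef_pV2 ?posrE ?powR_gt0//.
apply: ge0_ler_powR; rewrite ?nnegrE; [exact: ltW|exact: ltW|exact: ltW|].
by near: x; apply: nbhs_pinfty_ge; rewrite num_real.
Unshelve. all: by end_near. Qed.

(** Applied with q = (d-p)/2, this is the integral whose factor 1/q produces the blow-up as p ->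
    d. *)
Lemma integral_powR_tail (T q : R) : (0 < T)%R -> (0 < q)%R ->
  \int[mu]_(t in `[T, +oo[) (t `^ (- q - 1))%R%:E = (T `^ (- q) / q)%:E.
Proof.
move=> T0 q0.
rewrite (@ge0_continuous_FTC2y _ _ (fun t => - (t `^ (- q)) / q)%R _ 0%R).
- by rewrite -EFinB; congr EFin; rewrite sub0r mulNr opprK.
- by move=> t _; exact: powR_ge0.
- apply/continuous_in_subspaceT => t; rewrite inE/= in_itv/= andbT => Tt.
  by apply: powR_continuous_pos; exact: lt_le_trans Tt.
- rewrite -[X in _ --> X](mul0r (q^-1)%R); apply: cvgMl.
  by rewrite -oppr0; apply: cvgN; exact: powR_cvg_infty0.
- move=> t Tt; apply: derivableM; last exact: derivable_cst.
  apply: derivableN; apply: derivable_powR; rewrite in_itv/= andbT; exact: lt_trans Tt.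
- apply: cvg_at_right_filter; apply: cvgMl; apply: cvgN.
  exact: powR_continuous_pos.
- move=> t; rewrite in_itv/= andbT => Tt.
  have t0 : (0 < t)%R by exact: lt_trans Tt.
  have := is_derive1_powR (- q) t0 => D.
  rewrite derive1E derive_val.
  by rewrite scaler0 add0r /GRing.scale/=; field; rewrite gt_eqF.
Qed.

Lemma measurable_powR_EFin (D : set (measurableTypeR R)) (a : R) :
  measurable_fun D (fun t : R => (t `^ a)%R%:E).
Proof. by apply: measurable_funTS; apply/measurable_EFinP; exact: measurable_powR. Qed.

Lemma integral_powR_head (a : R) : (0 < a)%R ->
  \int[mu]_(t in `]0%R, 1%R]) (t `^ (a - 1))%R%:E <= (a^-1)%:E.
Proof.
move=> a0.
(* The integrand may be singular at 0, so the half-open interval is exhausted by compact ones;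
   starting at 1/2 keeps them nondegenerate. *)
pose F k : set (measurableTypeR R) := `[(k.+2%:R^-1)%R, 1%R]%classic.
have k0 k : (0 < k.+2%:R^-1 :> R)%R by rewrite invr_gt0.
have k1 k : (k.+2%:R^-1 < 1 :> R)%R by rewrite invf_lt1 ?ltr0n// ltr1n.
have FE : \bigcup_k F k = `]0%R, 1%R]%classic.
  apply/seteqP; split=> [t [k _]|t]; rewrite /F /= !in_itv/= => /andP[h t1].
    by rewrite t1 (lt_le_trans _ h).
  exists (Num.truncn t^-1) => //=; rewrite in_itv/= t1 andbT.
  rewrite invf_ple ?posrE// (le_trans (ltW (truncnS_gt _)))// ler_nat.
  exact: leqnSn.
have Fk k : \int[mu]_(t in F k) (t `^ (a - 1))%R%:E <= (a^-1)%:E.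
  have tpos t : t \in `[(k.+2%:R^-1)%R, 1%R] -> (0 < t)%R.
    by rewrite in_itv/= => /andP[h _]; exact: lt_le_trans h.
  rewrite (@continuous_FTC2 _ _ (fun t => t `^ a / a)%R)//.
  - rewrite powR1 -EFinB lee_fin mul1r lerBlDr lerDl.
    by rewrite divr_ge0 ?powR_ge0// ltW.
  - apply/continuous_in_subspaceT => t; rewrite inE/= => /tpos t0.
    exact: powR_continuous_pos.
  - split=> [t||].
    + rewrite in_itv/= => /andP[h _]; apply: derivableM; last exact: derivable_cst.
      by apply: derivable_powR; rewrite in_itv/= andbT (lt_trans _ h).
    + by apply: cvg_at_right_filter; apply: cvgMl; exact: powR_continuous_pos.
    + by apply: cvg_at_left_filter; apply: cvgMl; exact: powR_continuous_pos.
  - move=> t; rewrite in_itv/= => /andP[h _].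
    have t0 : (0 < t)%R by exact: lt_trans h.
    have := is_derive1_powR a t0 => D.
    rewrite derive1E derive_val.
    by rewrite scaler0 add0r /GRing.scale/=; field; rewrite gt_eqF.
have ndF : {homo F : k l / (k <= l)%N >-> (k <= l)%O}.
  move=> k l kl; apply/subsetPset => t; rewrite /F/= !in_itv/= => /andP[h ->].
  by rewrite andbT (le_trans _ h)// lef_pV2 ?posrE// ler_nat.
have cv : \int[mu]_(t in F k) (t `^ (a - 1))%R%:E @[k --> \oo] -->
    \int[mu]_(t in \bigcup_k F k) (t `^ (a - 1))%R%:E.
  apply: ge0_nondecreasing_set_cvg_integral => //.
  - by move=> k; exact: measurable_itv.
  - by move=> k; exact: measurable_powR_EFin.
  - by move=> k t _; rewrite lee_fin powR_ge0.
rewrite -FE; apply: (cvge_to_le cv); exact: nearW.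
Qed.

Lemma powR_expR_bound (M : R) : (0 < M)%R -> exists2 C, (0 < C)%R &
  forall t, (0 < t)%R -> (t `^ M * expR (- t) <= C)%R.
Proof.
(* The maximum M^M exp(-M), attained at t = M; the inequality is ln u <= u - 1 at u = t/M. *)
move=> M0; exists (expR (M * ln M - M)) => [|t t0]; first exact: expR_gt0.
rewrite /powR gt_eqF// -expRD ler_expR.
have : (ln (t / M) <= t / M - 1)%R.
  rewrite [X in ln X](_ : _ = 1 + (t / M - 1))%R; last by rewrite addrC subrK.
  by apply: le_ln1Dx; rewrite ltrBrDl subrr divr_gt0.
rewrite ln_div ?posrE// lerBlDl => /(ler_wpM2l (ltW M0)).
rewrite !mulrDr mulrN1 mulrCA divff ?gt_eqF// mulr1; lra.
Qed.

Lemma gamma_integral_fin (s : R) : (0 < s)%R ->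
  \int[mu]_(t in `]0%R, +oo[) (t `^ (s - 1) * expR (- t))%R%:E < +oo.
Proof.
move=> s0.
(* Exponent s + 1 bounds t^(s-1) exp(-t) by C t^-2, integrable at infinity. *)
have [C C0 hC] := powR_expR_bound (ltr_pwDl s0 ler01).
have mf D : measurable_fun (D : set (measurableTypeR R)) (fun t : R => (t `^ (s - 1) * expR (- t))%R%:E).
  apply: measurable_funTS; apply/measurable_EFinP; apply: measurable_funM.
    exact: measurable_powR.
  by apply: (measurableT_comp (@measurable_expR R)); exact: measurable_funN.
have f0 t : (0 <= (t `^ (s - 1) * expR (- t))%R%:E)%E.
  by rewrite lee_fin mulr_ge0 ?powR_ge0 ?expR_ge0.
have -> : `]0%R, +oo[%classic = `]0%R, 1%R]%classic `|` `]1%R, +oo[%classic :> set R.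
  by rewrite -itv_bndbnd_setU// bnd_simp.
rewrite ge0_integral_setU//=; last first.
  apply/disj_setPS => t [] /=; rewrite !in_itv/= andbT => /andP[_ t1].
  by rewrite ltNge t1.
apply: lte_add_pinfty.
  apply: (@le_lt_trans _ _ (s^-1)%:E); last exact: ltry.
  apply: le_trans (integral_powR_head s0).
  apply: ge0_le_integral => //; first exact: measurable_powR_EFin.
  move=> t; rewrite /= in_itv/= => /andP[t0 _]; rewrite lee_fin ler_piMr ?powR_ge0//.
  by rewrite -expR0 ler_expR oppr_le0 ltW.
apply: (@le_lt_trans _ _ (\int[mu]_(t in `[1%R, +oo[) (t `^ (s - 1) * expR (- t))%R%:E)).
  apply: ge0_subset_integral => // t /=.
  by rewrite !in_itv/= !andbT => /ltW.
apply: (@le_lt_trans _ _ (\int[mu]_(t in `[1%R, +oo[) (C%:E * (t `^ (- 1 - 1))%:E))).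
  apply: ge0_le_integral => //.
    by apply: emeasurable_funM; [exact: measurable_cst|exact: measurable_powR_EFin].
  move=> t /=; rewrite in_itv/= andbT => t1.
  have t0 : (0 < t)%R by exact: lt_le_trans t1.
  rewrite -EFinM lee_fin (_ : s - 1 = (s + 1) + (- 1 - 1))%R; last by ring.
  rewrite powRD; last by apply/implyP => _; rewrite gt_eqF.
  by rewrite -mulrA [(_ * expR _)%R]mulrC mulrA ler_wpM2r ?powR_ge0// hC.
rewrite ge0_integralZl//.
- by rewrite integral_powR_tail// -EFinM ltry.
- exact: measurable_powR_EFin.
- by move=> t _; rewrite lee_fin powR_ge0.
- by rewrite lee_fin ltW.
Qed.

Lemma gamma_measurable (s : R) (D : set (measurableTypeR R)) :
  measurable_fun D (fun t : R => (t `^ (s - 1) * expR (- t))%R%:E).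
Proof.
apply: measurable_funTS; apply/measurable_EFinP; apply: measurable_funM.
  exact: measurable_powR.
by apply: (measurableT_comp (@measurable_expR R)); exact: measurable_funN.
Qed.

Lemma gamma_integral (s : R) : (0 < s)%R ->
  \int[mu]_(t in `]0%R, +oo[) (t `^ (s - 1) * expR (- t))%R%:E = (Gamma s)%:E.
Proof.
move=> s0; rewrite /Gamma /Rintegral fineK// ge0_fin_numE ?gamma_integral_fin//.
by apply: integral_ge0 => t _; rewrite lee_fin mulr_ge0 ?powR_ge0 ?expR_ge0.
Qed.

Lemma gamma_integrable (s : R) : (0 < s)%R ->
  mu.-integrable `]0%R, +oo[ (fun t => (t `^ (s - 1) * expR (- t))%R%:E).
Proof.
move=> s0; apply/integrableP; split; first exact: gamma_measurable.
under eq_integral => t _ do rewrite gee0_abs ?lee_fin ?mulr_ge0 ?powR_ge0 ?expR_ge0//.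
exact: gamma_integral_fin.
Qed.

Lemma Gamma_gt0 (s : R) : (0 < s)%R -> (0 < Gamma s)%R.
Proof.
move=> s0; rewrite -lte_fin -gamma_integral//.
have [c c0 hc] : exists2 c, (0 < c)%R & forall t, (1 <= t <= 2)%R -> (c <= t `^ (s - 1) * expR (- t))%R.
  exists (expR (- `|s - 1| * 2 - 2))%R => [|t /andP[t1 t2]]; first exact: expR_gt0.
  have t0 : (0 < t)%R by exact: lt_le_trans t1.
  rewrite /powR gt_eqF// -expRD ler_expR.
  have l0 : (0 <= ln t)%R by exact: ln_ge0.
  have l1 : (ln t <= 2)%R.
    have := @le_ln1Dx R (t - 1)%R; rewrite (addrC 1%R) subrK; lra.
  have : (- (`|s - 1| * 2) <= (s - 1) * ln t)%R.
    have := ler_norm (- (s - 1))%R; rewrite normrN => h.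
    have := ler_wpM2l (normr_ge0 (s - 1)%R) l1; have := ler_wpM2r l0 h; lra.
  lra.
apply: (@lt_le_trans _ _ (\int[mu]_(t in `[1%R, 2%R]) (cst c%:E t))).
  rewrite integral_cst//= lebesgue_measure_itv/= lte_fin ltr1n -EFinB -EFinM lte_fin.
  by rewrite mulr_gt0// subr_gt0 ltr1n.
apply: (@le_trans _ _ (\int[mu]_(t in `[1%R, 2%R]) (t `^ (s - 1) * expR (- t))%R%:E)).
  apply: ge0_le_integral => //.
  - by move=> t _; rewrite lee_fin ltW.
  - exact: gamma_measurable.
apply: ge0_subset_integral => //.
- exact: gamma_measurable.
- by move=> t _; rewrite lee_fin mulr_ge0 ?powR_ge0 ?expR_ge0.
- by move=> t /=; rewrite !in_itv/= andbT => /andP[t1 _]; exact: lt_le_trans t1.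
Qed.

Lemma powR_exponent_continuous (t s : R) : (0 < t)%R ->
  {for s, continuous (fun p => t `^ p)%R}.
Proof.
move=> t0; rewrite /powR gt_eqF//.
apply: (cvg_comp (fun p => p * ln t)%R expR); last exact: continuous_expR.
by apply: cvgM; [exact: cvg_id|exact: cvg_cst].
Qed.

Lemma Gamma_continuous (s : R) : (0 < s)%R -> {for s, continuous (@Gamma R)}.
Proof.
move=> s0.
pose f (x t : R) : R := (t `^ (x - 1) * expR (- t))%R.
have us : s \in `](s / 2)%R, (s + 1)%R[%classic.
  by rewrite inE/= in_itv/= ltrDl ltr01 andbT gtr_pMr// invf_lt1// ltr1n.
have h := @continuity_under_integral R _ _ mu f `]0%R, +oo[%classic (measurable_itv _) (s / 2)%R (s + 1)%R.
(* Dominating function for exponents between s/2 and s+1: the smaller one controls t < 1, the larger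
   one t >= 1. *)
pose g (t : R) : R := (f (s / 2) t + f (s + 1) t)%R.
apply: (h _ _ g _ _ s us).
- move=> x; rewrite /= in_itv/= => /andP[x0 _]; apply: gamma_integrable.
  by rewrite (lt_trans _ x0)// divr_gt0.
- apply: aeW => t; rewrite /= in_itv/= andbT => t0 x _.
  apply: cvgM; last exact: cvg_cst.
  apply: (cvg_comp (fun x => x - 1)%R (fun p => t `^ p)%R).
    by apply: cvgB; [exact: cvg_id|exact: cvg_cst].
  exact: powR_exponent_continuous.
- rewrite /g (_ : EFin \o _ = (fun t => (f (s / 2) t)%:E) \+ (fun t => (f (s + 1) t)%:E))%E//.
  by apply: integrableD => //; apply: gamma_integrable; [rewrite divr_gt0|rewrite addr_gt0].
- move=> x; rewrite /= in_itv/= => /andP[x1 x2]; apply: aeW => t.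
  rewrite /= in_itv/= andbT => t0.
  rewrite ger0_norm ?mulr_ge0 ?powR_ge0 ?expR_ge0// /g /f -mulrDl ler_wpM2r ?expR_ge0//.
  have [t1|t1] := leP 1%R t.
    by rewrite ler_wpDl ?powR_ge0// ler_powR//; lra.
  rewrite ler_wpDr ?powR_ge0//.
  rewrite /powR gt_eqF// ler_expR; apply: ler_wnM2r; last by lra.
  by apply: ln_le0; exact: ltW.
Qed.

Lemma mem_posE (t : R) : (t \in (`]0%R, +oo[%classic : set R)) = (0 < t)%R.
Proof. by apply/idP/idP; rewrite inE/= in_itv/= andbT. Qed.

Lemma gamma_integral_scale (s a : R) : (0 < s)%R -> (0 < a)%R ->
  \int[mu]_(t in `]0%R, +oo[) (t `^ (s - 1) * expR (- (t * a)))%R%:E =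
  (a `^ (- s) * Gamma s)%:E.
Proof.
move=> s0 a0; rewrite EFinM -gamma_integral//.
rewrite [in LHS]integral_mkcond [in RHS]integral_mkcond.
pose f : R -> \bar R := (fun t => (t `^ (s - 1) * expR (- t))%R%:E) \_ `]0%R, +oo[%classic.
have mf : measurable_fun setT f.
  by apply/(measurable_restrictT _ _).1 => //; exact: gamma_measurable.
have f0 t : 0 <= f t.
  by rewrite /f patchE; case: ifP => // _; rewrite lee_fin mulr_ge0 ?powR_ge0 ?expR_ge0.
have as0 : (0 <= a `^ (1 - s))%R by exact: powR_ge0.
transitivity (\int[mu]_t ((a `^ (1 - s))%:E * f (a * t)%R)).
  apply: eq_integral => t _; rewrite /f !patchE !mem_posE pmulr_rgt0//.
  case: ifPn => // t0; last by rewrite mule0.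
  rewrite -EFinM; congr EFin; rewrite powRM ?ltW// -[in RHS]mulrA [RHS]mulrA -powRD; last first.
    by apply/implyP => _; rewrite gt_eqF.
  by rewrite addrA subrK subrr powRr0 mul1r [(a * t)%R]mulrC.
rewrite ge0_integralZl//; last exact: (measurableT_comp mf (scale_measurable a)).
rewrite lebesgue_integral_scale// muleA -EFinM; congr (_%:E * _).
rewrite -[X in (_ * X)%R](powR_inv1 (ltW a0)) -powRD; last by apply/implyP => _; rewrite gt_eqF.
by congr (_ `^ _)%R; ring.
Qed.

End power_integrals.

(** * The Riesz kernel as a mixture of Gaussians *)

Section riesz_gauss.
Local Open Scope ereal_scope.
Context {R : realType}.
Notation mu := (@lebesgue_measure R).

Lemma tonelli_swap d1 d2 (T1 : measurableType d1) (T2 : measurableType d2)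
    (m1 : {sigma_finite_measure set T1 -> \bar R})
    (m2 : {sigma_finite_measure set T2 -> \bar R}) (f : T1 -> T2 -> \bar R) :
  measurable_fun setT (fun xy : T1 * T2 => f xy.1 xy.2) ->
  (forall x y, 0 <= f x y) ->
  \int[m1]_x \int[m2]_y f x y = \int[m2]_y \int[m1]_x f x y.
Proof.
move=> mf f0.
exact: (@fubini_tonelli _ _ _ _ R m1 m2 (fun xy => f xy.1 xy.2) mf (fun xy => f0 _ _)).
Qed.

Lemma measurable_integral_snd d1 d2 (T1 : measurableType d1) (T2 : measurableType d2)
    (m2 : {sigma_finite_measure set T2 -> \bar R}) (f : T1 -> T2 -> \bar R) :
  measurable_fun setT (fun xy : T1 * T2 => f xy.1 xy.2) ->
  (forall x y, 0 <= f x y) ->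
  measurable_fun setT (fun x => \int[m2]_y f x y).
Proof.
move=> mf f0.
exact: (@measurable_fun_fubini_tonelli_F _ _ _ _ R m2 (fun xy => f xy.1 xy.2) mf (fun xy => f0 _ _)).
Qed.

(** The density of the Gamma integral extended by zero, so that Tonelli applies over the whole
    line. *)
Definition weight (s t : R) : R := if (0 < t)%R then (t `^ (s - 1))%R else 0%R.

Lemma weight_ge0 s t : (0 <= weight s t)%R.
Proof. by rewrite /weight; case: ifP => // _; exact: powR_ge0. Qed.

Lemma measurable_weight s : measurable_fun setT (weight s).
Proof.
rewrite (_ : weight s = (fun t => t `^ (s - 1))%R \_ `]0%R, +oo[%classic); last first.
  by apply/funext => t; rewrite patchE mem_posE.
apply/(measurable_restrictT _ _).1 => //.
by apply: measurable_funTS; exact: measurable_powR.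
Qed.

Lemma integral_weight s (h : R -> R) :
  \int[mu]_t (weight s t * h t)%:E =
  \int[mu]_(t in `]0%R, +oo[) (t `^ (s - 1) * h t)%:E.
Proof.
rewrite [RHS]integral_mkcond; apply: eq_integral => t _.
by rewrite patchE mem_posE /weight; case: ifP => // _; rewrite mul0r.
Qed.

(** Valid on the diagonal too, where the Gaussian is 1 and the integral diverges. Joint
    measurability of the kernel is read off this formula. *)
Lemma riesz_kernelE n (p : R) (u v : 'rV[R]_n) : (0 < p)%R ->
  riesz_kernel p u v =
  ((Gamma (p / 2))^-1)%:E * \int[mu]_t (weight (p / 2) t * gauss t u v)%:E.
Proof.
move=> p0; have s0 : (0 < p / 2)%R by rewrite divr_gt0.
have G0 := Gamma_gt0 s0; rewrite integral_weight /riesz_kernel.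
have [<-{v}|uv] := eqVneq u v.
  suff -> : \int[mu]_(t in `]0%R, +oo[) (t `^ (p / 2 - 1) * gauss t u u)%:E = +oo.
    by rewrite gt0_muley// lte_fin invr_gt0.
  apply/eqyP => A A0.
  (* Chosen so that the integral with the extra factor exp(-t a), which is at most 1, equals the
     prescribed bound [A]. *)
  pose a := ((A / Gamma (p / 2)) `^ (- (p / 2)^-1))%R.
  have a0 : (0 < a)%R by rewrite powR_gt0// divr_gt0.
  have <- : (a `^ (- (p / 2)) * Gamma (p / 2) = A)%R.
    rewrite -powRrM mulrNN mulVf ?gt_eqF// powRr1 ?divr_ge0 ?ltW//.
    by rewrite divfK ?gt_eqF.
  rewrite -gamma_integral_scale//; apply: ge0_le_integral => //.
  - by move=> t _; rewrite lee_fin mulr_ge0 ?powR_ge0 ?expR_ge0.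
  - apply: measurable_funTS; apply/measurable_EFinP; apply: measurable_funM.
      exact: measurable_powR.
    apply: (measurableT_comp (@measurable_expR R)); apply: measurable_funN.
    exact: measurable_funM.
  - apply: measurable_funTS; apply/measurable_EFinP; apply: measurable_funM.
      exact: measurable_powR.
    exact: measurable_gauss.
  - move=> t; rewrite /= in_itv/= andbT => t0; rewrite lee_fin ler_wpM2l ?powR_ge0//.
    rewrite /gauss -euclid_sqr euclidxx expr0n mulr0 ler_expR lerN2.
    by rewrite mulr_ge0// ltW.
have a0 : (0 < sqdist u v)%R by rewrite -euclid_sqr exprn_gt0// euclid_gt0.
rewrite (gamma_integral_scale s0 a0) -EFinM; congr EFin.
rewrite [RHS]mulrC mulfK ?gt_eqF// -euclid_sqr -powR_mulrn ?euclid_ge0//.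
by rewrite -powRrM; congr (_ `^ _)%R; field.
Qed.

Lemma riesz_kernel_ge0 n (p : R) (u v : 'rV[R]_n) : 0 <= riesz_kernel p u v.
Proof.
by rewrite /riesz_kernel; case: ifP => // _; rewrite lee_fin powR_ge0.
Qed.

Lemma measurable_weight_gauss d (T : measurableType d) n s (f g : T -> borel_rV R n) (t : T -> R) :
  measurable_fun setT f -> measurable_fun setT g -> measurable_fun setT t ->
  measurable_fun setT (fun w => (weight s (t w) * gauss (t w) (f w) (g w))%:E).
Proof.
move=> mf mg mt; apply/measurable_EFinP; apply: measurable_funM.
  exact: (measurableT_comp (measurable_weight s) mt).
exact: measurable_gauss.
Qed.

Lemma measurable_riesz_kernel n (p : R) d (T : measurableType d) (f g : T -> borel_rV R n) :
  (0 < p)%R -> measurable_fun setT f -> measurable_fun setT g ->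
  measurable_fun setT (fun w => riesz_kernel p (f w) (g w)).
Proof.
move=> p0 mf mg; under eq_fun do rewrite riesz_kernelE//.
apply: emeasurable_funM; first exact: measurable_cst.
apply: (@measurable_integral_snd _ _ T (measurableTypeR R) mu
  (fun w t => (weight (p / 2) t * gauss t (f w) (g w))%:E)).
  apply: measurable_weight_gauss; [|exact: measurableT_comp measurable_fst..|exact: measurable_snd].
  exact: (measurableT_comp mf measurable_fst).
by move=> w t; rewrite lee_fin mulr_ge0 ?weight_ge0 ?gauss_ge0.
Qed.

Lemma gauss_massE n (t : R) : (0 < t)%R ->
  gauss_mass n t = (pi `^ (n%:R / 2) * t `^ (- (n%:R / 2)))%R.
Proof.
move=> t0; have pit : (0 <= pi / t :> R)%R by rewrite divr_ge0 ?pi_ge0// ltW.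
rewrite /gauss_mass -powR12_sqrt// -powR_mulrn ?powR_ge0// -powRrM.
rewrite (mulrC 2^-1)%R powRM ?pi_ge0 ?invr_ge0 ?ltW//; congr (_ * _)%R.
by rewrite -(powR_inv1 (ltW t0)) -powRrM mulN1r.
Qed.

Lemma weight_gauss_mass n (p t : R) : (0 < t)%R ->
  (weight (p / 2) t * gauss_mass n t =
   pi `^ (n%:R / 2) * t `^ (- ((n%:R - p) / 2) - 1))%R.
Proof.
move=> t0; rewrite /weight t0 gauss_massE// mulrCA -powRD; last first.
  by apply/implyP => _; rewrite gt_eqF.
by congr (_ * (_ `^ _))%R; lra.
Qed.

(** The scales are split at t = 1: below, the Gaussian is at most 1 and the total mass enters;
    above, its integral is at most that for Lebesgue measure. Only the second part blows up as p ->
    n. Restrictions of Lebesgue measure satisfy the hypothesis. *)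
Lemma riesz_potential_le n (m : {finite_measure set (borel_rV R n) -> \bar R})
    (V p : R) (u : 'rV[R]_n) : (0 < p < n%:R)%R -> m setT <= V%:E ->
  (forall t, (0 < t)%R -> \int[m]_v (gauss t u v)%:E <= (gauss_mass n t)%:E) ->
  \int[m]_v riesz_kernel p u v <=
  ((Gamma (p / 2))^-1 * (V * (p / 2)^-1 + pi `^ (n%:R / 2) * ((n%:R - p) / 2)^-1))%:E.
Proof.
move=> /andP[p0 pn] mV mg; have s0 : (0 < p / 2)%R by rewrite divr_gt0.
have G0 : (0 <= (Gamma (p / 2))^-1)%R by rewrite invr_ge0 ltW// Gamma_gt0.
have q0 : (0 < (n%:R - p) / 2)%R by rewrite divr_gt0// subr_gt0.
have mwg : measurable_fun setT (fun w : borel_rV R n * measurableTypeR R =>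
    (weight (p / 2) w.2 * gauss w.2 u w.1)%:E).
  apply: measurable_weight_gauss; [exact: measurable_cst|exact: measurable_fst|exact: measurable_snd].
have wg0 (v : borel_rV R n) t : 0 <= (weight (p / 2) t * gauss t u v)%:E.
  by rewrite lee_fin mulr_ge0 ?weight_ge0 ?gauss_ge0.
under eq_integral do rewrite riesz_kernelE//.
rewrite ge0_integralZl//; first last.
- by move=> v _; exact: integral_ge0.
- exact: (@measurable_integral_snd _ _ (borel_rV R n) (measurableTypeR R) mu
    (fun v t => (weight (p / 2) t * gauss t u v)%:E)).
rewrite EFinM lee_wpmul2l//.
rewrite (@tonelli_swap _ _ (borel_rV R n) (measurableTypeR R) m mu
  (fun v t => (weight (p / 2) t * gauss t u v)%:E))//.
pose G t := \int[m]_v (gauss t u v)%:E.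
have mG : measurable_fun setT G.
  apply: (@measurable_integral_snd _ _ (measurableTypeR R) (borel_rV R n) m
    (fun t v => (gauss t u v)%:E)).
    apply/measurable_EFinP; apply: measurable_gauss; [exact: measurable_fst|exact: measurable_cst|exact: measurable_snd].
  by move=> t v; rewrite lee_fin gauss_ge0.
have G0' t : 0 <= G t by apply: integral_ge0 => v _; rewrite lee_fin gauss_ge0.
have mgs t D : measurable_fun D (fun v : borel_rV R n => (gauss t u v)%:E).
  by apply: measurable_funTS; apply/measurable_EFinP; exact: measurable_gauss.
have -> : \int[mu]_t \int[m]_v (weight (p / 2) t * gauss t u v)%:E =
    \int[mu]_(t in `]0%R, +oo[) ((t `^ (p / 2 - 1))%:E * G t).
  rewrite [RHS]integral_mkcond; apply: eq_integral => t _.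
  under eq_integral do rewrite EFinM.
  rewrite ge0_integralZl//; last 2 first.
  - by move=> v _; rewrite lee_fin gauss_ge0.
  - by rewrite lee_fin weight_ge0.
  by rewrite patchE mem_posE /weight; case: ifP => // _; rewrite mul0e.
have GV t : (0 < t)%R -> G t <= V%:E.
  move=> t0; apply: le_trans mV; rewrite -[leRHS]mul1e -integral_cst//.
  apply: ge0_le_integral => //.
  - by move=> v _; rewrite lee_fin gauss_ge0.
  - by move=> v _; rewrite lee_fin gauss_le1// ltW.
have V0 : (0 <= V)%R by rewrite -lee_fin (le_trans _ mV).
have mfG D : measurable_fun (D : set (measurableTypeR R)) (fun t : R => (t `^ (p / 2 - 1))%:E * G t).
  apply: measurable_funTS; apply: emeasurable_funM => //; exact: measurable_powR_EFin.
have fG0 t : 0 <= (t `^ (p / 2 - 1))%:E * G t by rewrite mule_ge0// lee_fin powR_ge0.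
have -> : `]0%R, +oo[%classic = `]0%R, 1%R]%classic `|` `]1%R, +oo[%classic :> set R.
  by rewrite -itv_bndbnd_setU// bnd_simp.
rewrite ge0_integral_setU//=; last first.
  apply/disj_setPS => t [] /=; rewrite !in_itv/= andbT => /andP[_ t1].
  by rewrite ltNge t1.
rewrite EFinD leeD//.
  apply: (@le_trans _ _ (\int[mu]_(t in `]0%R, 1%R]) (V%:E * (t `^ (p / 2 - 1))%:E))).
    apply: ge0_le_integral => //.
      by apply: emeasurable_funM; [exact: measurable_cst|exact: measurable_powR_EFin].
    move=> t /=; rewrite in_itv/= => /andP[t0 _].
    by rewrite muleC lee_wpmul2r ?lee_fin ?powR_ge0// GV.
  rewrite ge0_integralZl//; last 2 first.
  - exact: measurable_powR_EFin.
  - by move=> t _; rewrite lee_fin powR_ge0.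
  by rewrite EFinM lee_wpmul2l// integral_powR_head.
have c0 : (0 <= pi `^ (n%:R / 2) :> R)%R by exact: powR_ge0.
apply: (@le_trans _ _ (\int[mu]_(t in `[1%R, +oo[) ((pi `^ (n%:R / 2))%:E * (t `^ (- ((n%:R - p) / 2) - 1))%:E))).
  apply: (@le_trans _ _ (\int[mu]_(t in `[1%R, +oo[) ((t `^ (p / 2 - 1))%:E * G t))).
    apply: ge0_subset_integral => // t /=.
    by rewrite !in_itv/= !andbT => /ltW.
  apply: ge0_le_integral => //.
    by apply: emeasurable_funM; [exact: measurable_cst|exact: measurable_powR_EFin].
  move=> t /=; rewrite in_itv/= andbT => t1.
  have t0 : (0 < t)%R by exact: lt_le_trans t1.
  rewrite -EFinM -weight_gauss_mass// EFinM /weight t0.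
  by rewrite lee_wpmul2l ?lee_fin ?powR_ge0// mg.
rewrite ge0_integralZl//; last 2 first.
- exact: measurable_powR_EFin.
- by move=> t _; rewrite lee_fin powR_ge0.
by rewrite integral_powR_tail// powR1 mul1r -EFinM.
Qed.

End riesz_gauss.

(** * Energy estimates *)

Section energy_lower_bound.
Local Open Scope ereal_scope.
Context {R : realType} {n : nat}.
Notation mu := (@lebesgue_measure R).
Variable m : {finite_measure set (borel_rV R n) -> \bar R}.
Notation rV := (borel_rV R n).

Let mgauss s (D : set rV) (x : rV) : measurable_fun D (fun z : rV => (gauss s x z)%:E).
Proof. by apply: measurable_funTS; apply/measurable_EFinP; exact: measurable_gauss. Qed.

Let gauss0 s (x z : rV) : 0 <= (gauss s x z)%:E.
Proof. by rewrite lee_fin gauss_ge0. Qed.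

(** The convolution of [m] with the Gaussian at scale [s]. *)
Let phi (s : R) (z : rV) : \bar R := \int[m]_x (gauss s x z)%:E.

Let mgauss2 s : measurable_fun setT (fun xz : rV * rV => (gauss s xz.1 xz.2)%:E).
Proof.
by apply/measurable_EFinP; apply: measurable_gauss;
  [exact: measurable_cst|exact: measurable_fst|exact: measurable_snd].
Qed.

Let phiE s z : phi s z = \int[m]_x (gauss s z x)%:E.
Proof. by apply: eq_integral => x _; rewrite gaussC. Qed.

Let mphi s : measurable_fun setT (phi s).
Proof.
rewrite (_ : phi s = (fun z => \int[m]_x (gauss s z x)%:E)); last by apply/funext => z; rewrite phiE.
exact: (@measurable_integral_snd _ _ _ rV rV m (fun z x => (gauss s z x)%:E)).
Qed.

Let phi0 s z : 0 <= phi s z.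
Proof. exact: integral_ge0. Qed.

Let phi_fin s z : (0 <= s)%R -> phi s z \is a fin_num.
Proof.
move=> s0; rewrite ge0_fin_numE//.
apply: (@le_lt_trans _ _ (\int[m]_x cst 1 x)).
  apply: ge0_le_integral => //; first by apply/measurable_EFinP; exact: measurable_gauss.
  by move=> x _; rewrite lee_fin gauss_le1.
by rewrite integral_cst// mul1e ltey_eq fin_num_measure.
Qed.

(* The convolution square root of the Gaussian kernel turns its energy into
   an L2 norm. *)
Let gauss_energy_sqr t : (0 < t)%R ->
  (gauss_mass n (4 * t))%:E * \int[m]_x \int[m]_y (gauss t x y)%:E =
  \int[leb n]_z (phi (2 * t) z * phi (2 * t) z).
Proof.
move=> t0; set g := gauss (2 * t); have G0 := gauss_mass_gt0 n (mulr_gt0 (ltr0Sn R 3) t0).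
have mgg (d : measure_display) (T : measurableType d) (f h k : T -> rV) :
    measurable_fun setT f -> measurable_fun setT h -> measurable_fun setT k ->
    measurable_fun setT (fun w => (g _ (f w) (k w) * g _ (h w) (k w))%:E).
  by move=> mf mh mk; apply/measurable_EFinP; apply: measurable_funM; exact: measurable_gauss.
have gg0 (x y z : rV) : 0 <= (g _ x z * g _ y z)%:E.
  by rewrite lee_fin mulr_ge0 ?gauss_ge0.
rewrite -ge0_integralZl//; first last.
- by rewrite lee_fin ltW.
- by move=> x _; exact: integral_ge0.
- exact: (@measurable_integral_snd _ _ _ rV rV m (fun z x => (gauss t z x)%:E)).
transitivity (\int[m]_x \int[leb n]_z ((g _ x z)%:E * phi (2 * t) z)).
  apply: eq_integral => x _; rewrite -ge0_integralZl//; last by rewrite lee_fin ltW.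
  transitivity (\int[m]_y \int[leb n]_z (g _ x z * g _ y z)%:E).
    by apply: eq_integral => y _; rewrite gauss_convolution.
  rewrite (@tonelli_swap _ _ _ rV rV m (leb n) (fun y z => (g _ x z * g _ y z)%:E))//; last first.
    by apply: mgg; [exact: measurable_cst|exact: measurable_fst|exact: measurable_snd].
  apply: eq_integral => z _; under eq_integral do rewrite EFinM.
  rewrite ge0_integralZl//; first by apply/measurable_EFinP; exact: measurable_gauss.
  - by move=> y _; exact: gauss0.
  - exact: gauss0.
transitivity (\int[leb n]_z \int[m]_x ((g _ x z)%:E * phi (2 * t) z)).
  apply: (@tonelli_swap _ _ _ rV rV m (leb n) (fun x z => (g _ x z)%:E * phi (2 * t) z)).
    apply: emeasurable_funM; first exact: mgauss2.
    exact: (measurableT_comp (mphi _) measurable_snd).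
  by move=> x z; apply: mule_ge0; [exact: gauss0|exact: phi0].
apply: eq_integral => z _; rewrite ge0_integralZr//.
- by apply/measurable_EFinP; exact: measurable_gauss.
- by move=> x _; exact: gauss0.
Qed.

(** Most of the convolved mass of [K] stays in its neighbourhood [A], where the squared L^2 norm is
    bounded below linearly. The best [b] would give a multiple of m(K)^2 / V, but [b] is left free
    so that several pieces can share it. The tail error is taken at [T], the worst scale. *)
Lemma gauss_energy_ge (K A : set rV) (T r b V t : R) :
  (0 < T)%R -> (0 <= r)%R -> (0 <= b)%R -> measurable K -> measurable A ->
  (forall x z : 'rV[R]_n, K x -> (`|x - z| < r)%R -> A z) ->
  leb n A <= V%:E -> (Num.sqrt 2 ^+ n * expR (- (T * r ^+ 2)) <= 1)%R ->
  (T <= t)%R ->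
  (gauss_mass n t *
   (2 * b * (1 - Num.sqrt 2 ^+ n * expR (- (T * r ^+ 2))) * fine (m K) - b ^+ 2 * V))%:E <=
  \int[m]_x \int[m]_y (gauss t x y)%:E.
Proof.
move=> T0 r0 b0 mK mA KA AV; set eta := (_ * expR _)%R => eta1 Tt.
have t0 : (0 < t)%R by exact: lt_le_trans Tt.
have t20 : (0 < 2 * t)%R by rewrite mulr_gt0.
(* Proportional to the Gaussian mass, so that the final bound depends on t only through its factor
   [gauss_mass n t]. *)
pose c := (b * gauss_mass n (2 * t))%R.
have G2 := gauss_mass_gt0 n t20.
have G4 : (0 < gauss_mass n (4 * t) :> R)%R by apply: gauss_mass_gt0; rewrite mulr_gt0.
have c0 : (0 <= c)%R by rewrite mulr_ge0// ltW.
have V0 : (0 <= V)%R by rewrite -lee_fin (le_trans _ AV).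
pose w := (gauss_mass n (2 * t) * (1 - eta))%R.
have w0 : (0 <= w)%R by rewrite mulr_ge0 ?subr_ge0//; exact: ltW.
have mKfin : m K \is a fin_num by exact: fin_num_measure.
have c20 : 0 <= (2 * c)%:E by rewrite lee_fin mulr_ge0.
have lower : (2 * c * (w * fine (m K)))%:E <=
    \int[leb n]_(z in A) ((2 * c)%:E * phi (2 * t) z).
  rewrite ge0_integralZl//; last exact: (measurable_funTS (mphi _)).
  rewrite EFinM; apply: lee_wpmul2l => //.
  rewrite [leRHS]integral_mkcond.
  have -> : \int[leb n]_z ((phi (2 * t) \_ A) z) =
      \int[leb n]_z \int[m]_x (gauss (2 * t) x z * \1_A z)%:E.
    apply: eq_integral => z _; rewrite patchE indicE; case: ifP => zA.
      by apply: eq_integral => x _; rewrite mulr1.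
    by rewrite integral0_eq// => x _; rewrite mulr0.
  rewrite -(@tonelli_swap _ _ _ rV rV m (leb n) (fun x z => (gauss (2 * t) x z * \1_A z)%:E)); first last.
  - by move=> x z; rewrite lee_fin mulr_ge0 ?gauss_ge0.
  - apply/measurable_EFinP; apply: measurable_funM; first by apply/measurable_EFinP; exact: (mgauss2 (2 * t)).
    exact: (measurableT_comp (measurable_indic mA) measurable_snd).
  apply: (@le_trans _ _ (\int[m]_(x in K) (cst w%:E x))).
    by rewrite integral_cst// EFinM fineK.
  have inner x : \int[leb n]_z (gauss (2 * t) x z * \1_A z)%:E =
      \int[leb n]_(z in A) (gauss (2 * t) x z)%:E.
    rewrite [RHS]integral_mkcond; apply: eq_integral => z _.
    by rewrite patchE indicE; case: ifP; rewrite ?mulr1 ?mulr0.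
  have minner : measurable_fun setT (fun x : rV => \int[leb n]_z (gauss (2 * t) x z * \1_A z)%:E).
    apply: (@measurable_integral_snd _ _ _ rV rV (leb n) (fun x z => (gauss (2 * t) x z * \1_A z)%:E)).
      apply/measurable_EFinP; apply: measurable_funM; first by apply/measurable_EFinP; exact: (mgauss2 (2 * t)).
      exact: (measurableT_comp (measurable_indic mA) measurable_snd).
    by move=> x z; rewrite lee_fin mulr_ge0 ?gauss_ge0.
  have inner0 x : 0 <= \int[leb n]_z (gauss (2 * t) x z * \1_A z)%:E.
    by apply: integral_ge0 => z _; rewrite lee_fin mulr_ge0 ?gauss_ge0.
  apply: (@le_trans _ _ (\int[m]_(x in K) \int[leb n]_z (gauss (2 * t) x z * \1_A z)%:E)).
    apply: ge0_le_integral => //; first exact: measurable_funTS.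
    move=> x Kx; rewrite inner; apply: le_trans (gauss_tail t0 r0 mA (KA x ^~ Kx)).
    rewrite lee_fin; apply: ler_wpM2l; first exact: ltW.
    rewrite lerB// ler_wpM2l ?exprn_ge0//.
    by rewrite ler_expR lerN2 ler_wpM2r ?sqr_ge0.
  by apply: ge0_subset_integral.
(* [2 c f <= f ^ 2 + c ^ 2], a linearised Cauchy-Schwarz inequality that is
   additive over the pieces of a rectifiable set. *)
have upper : \int[leb n]_(z in A) ((2 * c)%:E * phi (2 * t) z) <=
    \int[leb n]_z (phi (2 * t) z * phi (2 * t) z) + (c ^+ 2 * V)%:E.
  have msq D : measurable_fun (D : set rV) (fun z => phi (2 * t) z * phi (2 * t) z).
    by apply: measurable_funTS; exact: emeasurable_funM.
  have sq0 z : 0 <= phi (2 * t) z * phi (2 * t) z by rewrite mule_ge0.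
  apply: (@le_trans _ _ (\int[leb n]_(z in A) (phi (2 * t) z * phi (2 * t) z + (c ^+ 2)%:E))).
    apply: ge0_le_integral => //.
    - by move=> z _; exact: mule_ge0.
    - by apply: measurable_funTS; apply: emeasurable_funM.
    - by apply: emeasurable_funD.
    - move=> z _; have /fineK <- := phi_fin z (ltW t20).
      rewrite -!EFinM -EFinD lee_fin.
      by have := sqr_ge0 (fine (phi (2 * t) z) - c)%R; nra.
  rewrite ge0_integralD//; last by move=> z _; rewrite lee_fin sqr_ge0.
  apply: leeD; first exact: ge0_subset_integral.
  rewrite integral_cst// [leRHS]EFinM; apply: lee_wpmul2l => //.
  by rewrite lee_fin sqr_ge0.
have := le_trans lower upper; rewrite -gauss_energy_sqr// => E.
have {}E : (2 * c * (w * fine (m K)) - c ^+ 2 * V)%:E <=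
    (gauss_mass n (4 * t))%:E * \int[m]_x \int[m]_y (gauss t x y)%:E.
  by rewrite EFinB leeBlDr.
rewrite -(lee_pmul2l (_ : (gauss_mass n (4 * t))%:E \is a fin_num) (_ : 0 < (gauss_mass n (4 * t))%:E))//.
apply: le_trans E; rewrite -EFinM lee_fin mulrCA mulrA -gauss_mass_4//.
by rewrite /c /w le_eqVlt; apply/orP; left; apply/eqP; ring.
Qed.

Lemma riesz_energy_ge (K A : set rV) (p T r b V : R) : (0 < p < n%:R)%R ->
  (0 < T)%R -> (0 <= r)%R -> (0 <= b)%R -> measurable K -> measurable A ->
  (forall x z : 'rV[R]_n, K x -> (`|x - z| < r)%R -> A z) ->
  leb n A <= V%:E -> (Num.sqrt 2 ^+ n * expR (- (T * r ^+ 2)) <= 1)%R ->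
  ((Gamma (p / 2))^-1 * (pi `^ (n%:R / 2) *
    (T `^ (- ((n%:R - p) / 2)) / ((n%:R - p) / 2))) *
   (2 * b * (1 - Num.sqrt 2 ^+ n * expR (- (T * r ^+ 2))) * fine (m K) - b ^+ 2 * V))%:E <=
  \int[m]_x \int[m]_y riesz_kernel p x y.
Proof.
move=> /andP[p0 pn] T0 r0 b0 mK mA KA AV eta1; set B := (_ - b ^+ 2 * V)%R.
have G0 : (0 <= (Gamma (p / 2))^-1)%R by rewrite invr_ge0 ltW// Gamma_gt0// divr_gt0.
have q0 : (0 < (n%:R - p) / 2)%R by rewrite divr_gt0// subr_gt0.
(* If the bracket is nonpositive the claim is trivial; otherwise it can be pulled out of the
   nonnegative integral over t >= T. *)
have [B0|B0] := leP B 0%R.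
  apply: (@le_trans _ _ 0).
    rewrite lee_fin mulr_ge0_le0// mulr_ge0// mulr_ge0 ?powR_ge0// divr_ge0 ?powR_ge0//.
    exact: ltW.
  by apply: integral_ge0 => x _; apply: integral_ge0 => y _; exact: riesz_kernel_ge0.
pose F (x y : rV) t := (weight (p / 2) t * gauss t x y)%:E.
have F0 x y t : 0 <= F x y t by rewrite lee_fin mulr_ge0 ?weight_ge0 ?gauss_ge0.
have mF3 d (S : measurableType d) (f h : S -> rV) (k : S -> R) :
    measurable_fun setT f -> measurable_fun setT h -> measurable_fun setT k ->
    measurable_fun setT (fun w => F (f w) (h w) (k w)).
  by move=> mf mh mk; exact: measurable_weight_gauss.
have kE (x y : rV) : riesz_kernel p x y = (Gamma (p / 2))^-1%:E * \int[mu]_t F x y t.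
  exact: riesz_kernelE.
have mFt : measurable_fun setT (fun xy : rV * rV => \int[mu]_t F xy.1 xy.2 t).
  apply: (@measurable_integral_snd _ _ _ (rV * rV)%type (measurableTypeR R) mu (fun xy t => F xy.1 xy.2 t)) => //.
  by apply: mF3; [exact: measurableT_comp measurable_fst..|exact: measurable_snd].
have mFx x : measurable_fun setT (fun y : rV => \int[mu]_t F x y t).
  apply: (@measurable_integral_snd _ _ _ rV (measurableTypeR R) mu (fun y t => F x y t)) => //.
  by apply: mF3; [exact: measurable_cst|exact: measurable_fst|exact: measurable_snd].
have -> : \int[m]_x \int[m]_y riesz_kernel p x y =
    (Gamma (p / 2))^-1%:E * \int[m]_x \int[m]_y \int[mu]_t F x y t.
  rewrite -ge0_integralZl//; first last.
  - by move=> x _; apply: integral_ge0 => y _; exact: integral_ge0.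
  - apply: (@measurable_integral_snd _ _ _ rV rV m (fun x y => \int[mu]_t F x y t)) => //.
    by move=> x y; exact: integral_ge0.
  apply: eq_integral => x _; rewrite -ge0_integralZl//; first last.
  - by move=> y _; exact: integral_ge0.
  by apply: eq_integral => y _; rewrite kE.
rewrite -mulrA EFinM lee_wpmul2l ?lee_fin//.
pose E t := \int[m]_x \int[m]_y (gauss t x y)%:E.
have mE1 : measurable_fun setT (fun tx : measurableTypeR R * rV => \int[m]_y (gauss tx.1 tx.2 y)%:E).
  apply: (@measurable_integral_snd _ _ _ (measurableTypeR R * rV)%type rV m (fun tx y => (gauss tx.1 tx.2 y)%:E)) => //.
  apply/measurable_EFinP; apply: measurable_gauss; [|  |exact: measurable_snd].
    exact: (measurableT_comp measurable_fst measurable_fst).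
  exact: (measurableT_comp measurable_snd measurable_fst).
have mE : measurable_fun setT E.
  apply: (@measurable_integral_snd _ _ _ (measurableTypeR R) rV m (fun t x => \int[m]_y (gauss t x y)%:E)) => //.
  by move=> t x; exact: integral_ge0.
have E0 t : 0 <= E t by apply: integral_ge0 => x _; exact: integral_ge0.
have -> : \int[m]_x \int[m]_y \int[mu]_t F x y t = \int[mu]_t ((weight (p / 2) t)%:E * E t).
  transitivity (\int[m]_x \int[mu]_t \int[m]_y F x y t).
    apply: eq_integral => x _.
    apply: (@tonelli_swap _ _ _ rV (measurableTypeR R) m mu (fun y t => F x y t)) => //.
    by apply: mF3; [exact: measurable_cst|exact: measurable_fst|exact: measurable_snd].
  rewrite (@tonelli_swap _ _ _ rV (measurableTypeR R) m mu (fun x t => \int[m]_y F x y t)) => //.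
  - apply: eq_integral => t _.
    rewrite -ge0_integralZl//; first last.
    + by rewrite lee_fin weight_ge0.
    + by move=> x _; exact: integral_ge0.
    + exact: (@measurable_integral_snd _ _ _ rV rV m (fun x y => (gauss t x y)%:E)).
    apply: eq_integral => x _; rewrite -ge0_integralZl//.
    by rewrite lee_fin weight_ge0.
  - apply: (@measurable_integral_snd _ _ _ (rV * measurableTypeR R)%type rV m (fun xt y => F xt.1 y xt.2)) => //.
    apply: mF3; [|exact: measurable_snd|].
      exact: (measurableT_comp measurable_fst measurable_fst).
    exact: (measurableT_comp measurable_snd measurable_fst).
  - by move=> x t; exact: integral_ge0.
have mWE D : measurable_fun (D : set (measurableTypeR R)) (fun t : R => (weight (p / 2) t)%:E * E t).
  apply: measurable_funTS; apply: emeasurable_funM => //.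
  by apply/measurable_EFinP; exact: measurable_weight.
have WE0 t : 0 <= (weight (p / 2) t)%:E * E t by rewrite mule_ge0// lee_fin weight_ge0.
apply: (@le_trans _ _ (\int[mu]_(t in `[T, +oo[) ((weight (p / 2) t)%:E * E t))); last exact: ge0_subset_integral.
have piB : (0 <= pi `^ (n%:R / 2) * B)%R by rewrite mulr_ge0 ?powR_ge0// ltW.
apply: (@le_trans _ _ (\int[mu]_(t in `[T, +oo[) ((pi `^ (n%:R / 2) * B)%:E * (t `^ (- ((n%:R - p) / 2) - 1))%:E))).
  rewrite ge0_integralZl//; first last.
  - by move=> t _; rewrite lee_fin powR_ge0.
  - exact: measurable_powR_EFin.
  by rewrite integral_powR_tail// -EFinM lee_fin mulrAC.
apply: ge0_le_integral => //.
- by move=> t _; rewrite -EFinM lee_fin mulr_ge0 ?powR_ge0.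
- by apply: emeasurable_funM; [exact: measurable_cst|exact: measurable_powR_EFin].
move=> t /=; rewrite in_itv/= andbT => Tt.
have t0 : (0 < t)%R by exact: lt_le_trans Tt.
rewrite -EFinM mulrAC -weight_gauss_mass// -mulrA EFinM lee_wpmul2l ?lee_fin ?weight_ge0//.
exact: (@gauss_energy_ge K A T r b V t).
Qed.

End energy_lower_bound.

(** * Dependence of Hausdorff measure on the exponent *)

Section exponents.
Local Open Scope ereal_scope.
Context {R : realType} {n : nat}.

Lemma gauge_exponent_le (s q : R) (U : set 'rV[R]_n) : (0 <= s <= q)%R -> (0 < q)%R ->
  ediam U <= 1 -> hausdorff_gauge q U <= hausdorff_gauge s U.
Proof.
move=> /andP[s0 sq] q0 U1.
have [->|/set0P U0] := eqVneq U set0; first by rewrite !gauge0.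
rewrite !gaugeE//; have d0 := ediam_ge0 U0.
have : ediam U \is a fin_num by rewrite ge0_fin_numE// (le_lt_trans U1) ?ltry.
move=> /fineK rE; move: d0 U1; rewrite -rE !lee_fin; set r := fine _ => r0 r1.
have [->|rn0] := eqVneq r 0%R; first by rewrite powR0 ?gt_eqF// powR_ge0.
by apply: ger_powR => //; rewrite r1 andbT lt_def rn0.
Qed.

Lemma raw_exponent_le (s q : R) (A : set 'rV[R]_n) : (0 <= s <= q)%R -> (0 < q)%R ->
  hausdorff_raw q A <= hausdorff_raw s A.
Proof.
move=> sq q0; apply: raw_le => delta d0.
(* Powers decrease with the exponent only for diameters at most 1, hence the cap on the scale. *)
pose e := Num.min delta 1%R; have e0 : (0 < e)%R by rewrite lt_min d0 ltr01.
apply: (@le_trans _ _ (hausdorff_content q e A)).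
  by apply: content_antitone; rewrite ge_min lexx.
apply: le_trans (content_le_raw s A e0).
apply: le_ereal_inf_tmp => _ [U [AU Ud] <-].
apply: (@le_trans _ _ (\sum_(0 <= i <oo) hausdorff_gauge q (U i))).
  by apply: ereal_inf_lbound; exists U.
apply: lee_nneseries => i _; first by move=> _; exact: gauge_ge0.
apply: gauge_exponent_le => //; rewrite (le_trans (Ud i))// lee_fin ge_min lexx.
by rewrite orbT.
Qed.

Lemma hausdorff_dim_lt (q : R) (A : set 'rV[R]_n) : hausdorff_dim A < q%:E ->
  exists s : R, [/\ (0 <= s)%R, (s < q)%R & hausdorff_raw s A = 0].
Proof.
move=> /ereal_inf_lt[_ [s [s0 sA] <-]]; rewrite lte_fin => sq.
by exists s.
Qed.

End exponents.

(** * Measures of finite energy do not charge small sets *)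

Section null_sets_of_finite_energy.
Local Open Scope ereal_scope.
Context {R : realType} {n : nat}.
Notation rV := (borel_rV R n).

Lemma measurable_euclid_ball (x : 'rV[R]_n) (r : R) :
  measurable ([set y | edist x y <= r]%R : set rV).
Proof.
have -> : [set y | edist x y <= r]%R =
    [set y : rV | (sqdist x y <= r ^+ 2)%R] `&` (if (0 <= r)%R then setT else set0).
  apply/seteqP; split=> y /=.
    move=> xy; have r0 := le_trans (euclid_ge0 x y) xy; rewrite r0; split=> //.
    by rewrite -euclid_sqr ler_pXn2r ?nnegrE ?euclid_ge0.
  case: ifPn => [r0 [+ _]|_ []//]; rewrite -euclid_sqr.
  by rewrite ler_pXn2r ?nnegrE ?euclid_ge0.
apply: measurableI; last by case: ifP.
rewrite [X in measurable X](_ : _ = (fun y : rV => sqdist x y) @^-1` `]-oo, (r ^+ 2)%R]%classic).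
  rewrite -[X in measurable X]setTI.
  by apply: (measurable_sqdist (f := fun=> x) (g := id)).
by apply/seteqP; split=> y /=; rewrite in_itv.
Qed.

Variable m : {finite_measure set rV -> \bar R}.

Let potential p (x : rV) := \int[m]_y riesz_kernel p x y.

(** Chebyshev: the kernel is at least r^-p on the ball, and r^p <= r^s as r <= 1. For r = 0 the
    kernel is infinite on the diagonal, so a finite potential excludes an atom at [x]. *)
Let ball_mass_le (p r s M : R) (x : rV) : (0 <= s <= p)%R -> (0 < p)%R ->
  (0 <= r <= 1)%R -> (0 <= M)%R -> potential p x <= M%:E ->
  m [set y | edist x y <= r]%R <= (M * r `^ s)%:E.
Proof.
move=> /andP[s0 sp] p0 /andP[r0 r1] M0 pM; set B : set rV := [set y | _]%R.
have mB : measurable B by exact: measurable_euclid_ball.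
have mk D : measurable_fun (D : set rV) (fun y : rV => riesz_kernel p x y).
  by apply: measurable_funTS; apply: measurable_riesz_kernel.
have kB : \int[m]_(y in B) riesz_kernel p x y <= M%:E.
  apply: le_trans pM; apply: ge0_subset_integral => //.
  by move=> y _; exact: riesz_kernel_ge0.
have [rE|rn0] := eqVneq r 0%R.
  have Bx y : B y -> x = y.
    by rewrite /B/= rE => xy; apply: euclid_eq0; apply/eqP; rewrite eq_le xy euclid_ge0.
  suff -> : m B = 0 by rewrite lee_fin mulr_ge0 ?powR_ge0.
  apply/eqP/negPn/negP => mB0; move: kB.
  rewrite (eq_integral (cst +oo)); last first.
    by move=> y; rewrite inE => /Bx <-; rewrite /riesz_kernel eqxx.
  rewrite integral_cst// gt0_mulye ?leye_eq//.
  by rewrite lt_def mB0 measure_ge0.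
have rgt0 : (0 < r)%R by rewrite lt_def rn0.
have h : (r `^ (- p))%:E * m B <= M%:E.
  apply: le_trans kB; rewrite -integral_cst//; apply: ge0_le_integral => //.
  - by move=> y _; rewrite lee_fin powR_ge0.
  - move=> y /= xy; rewrite /riesz_kernel; case: ifPn => [_|xny]; first by rewrite leey.
    rewrite lee_fin !powRN lef_pV2 ?posrE ?powR_gt0 ?euclid_gt0//.
    by apply: ge0_ler_powR; rewrite ?nnegrE ?euclid_ge0// ltW.
rewrite (@le_trans _ _ (r `^ p * M)%:E)//.
  by rewrite EFinM -lee_pdivrMl ?powR_gt0// -powRN.
rewrite lee_fin mulrC ler_wpM2l//.
by apply: ger_powR => //; rewrite rgt0.
Qed.

(** Finite energy makes the potential finite almost everywhere. Where it is at most [k], the mass of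
    small balls is controlled by the [s]-th power of the radius, so covers of small cost bound the
    mass. *)
Lemma finite_energy_null (p s : R) (F : set rV) : (0 <= s <= p)%R -> (0 < p)%R ->
  measurable F -> hausdorff_raw s (F : set 'rV[R]_n) = 0 ->
  \int[m]_x potential p x < +oo -> m F = 0.
Proof.
move=> sp p0 mF F0 foo.
have mpot : measurable_fun setT (potential p).
  apply: (@measurable_integral_snd _ _ _ rV rV m (fun x y => riesz_kernel p x y)).
    by apply: measurable_riesz_kernel; [|exact: measurable_fst|exact: measurable_snd].
  by move=> x y; exact: riesz_kernel_ge0.
have pot0 x : 0 <= potential p x by apply: integral_ge0 => y _; exact: riesz_kernel_ge0.
pose A k : set rV := F `&` [set x | potential p x <= k%:R%:E].
pose N : set rV := F `&` [set x | potential p x = +oo].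
have mA k : measurable (A k) by apply: emeasurable_fun_infty_c => //; exact: measurable_funTS.
have mN : measurable N.
  apply: measurableI => //; rewrite [X in measurable X](_ : _ = potential p @^-1` [set +oo])//.
  by rewrite -[X in measurable X]setTI; apply: mpot => //; exact: emeasurable_set1.
have N0 : m N = 0.
  have ip : m.-integrable setT (potential p).
    apply/integrableP; split=> //.
    by under eq_integral do rewrite gee0_abs//.
  apply: measure_negligible => //; have := integrable_ae measurableT ip.
  apply: negligibleS => x [_ /= px] /= /(_ I); by rewrite px.
have A0 k : m (A k) = 0.
  apply/eqP; rewrite eq_le measure_ge0 andbT; apply/lee_addgt0Pr => e e0; rewrite add0e.
  (* The successor because [k] may be zero; [k] times [e'] is still at most [e]. *)
  pose e' := (e / k.+1%:R)%R; have e'0 : (0 < e')%R by rewrite divr_gt0.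
  (* Scale 1 guarantees the radii at most 1 that the mass bound for balls requires. *)
  have : hausdorff_content s 1%R (F : set 'rV[R]_n) < e'%:E.
    by rewrite (le_lt_trans (content_le_raw s _ ltr01))// F0 lte_fin.
  move=> /ereal_inf_lt[_ [U [FU U1] <-] Ue].
  (* A set meeting [A k] lies in a ball around a point of potential at most
     [k], whose mass is at most [k] times the radius to the power [s]. *)
  have hB i : exists B : set rV, [/\ measurable B, U i `&` A k `<=` B &
      m B <= k%:R%:E * hausdorff_gauge s (U i)].
    have [->|/set0P[x [Ux Ax]]] := eqVneq (U i `&` A k) set0.
      by exists set0; split=> //; rewrite measure0 mule_ge0 ?gauge_ge0.
    have Ui0 : U i !=set0 by exists x.
    have : ediam (U i) \is a fin_num.
      by rewrite ge0_fin_numE ?ediam_ge0// (le_lt_trans (U1 i)) ?ltry.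
    move=> /fineK rE; have r01 : (0 <= fine (ediam (U i)) <= 1)%R.
      by rewrite -!lee_fin rE ediam_ge0//= U1.
    exists [set y | edist x y <= fine (ediam (U i))]%R; split.
    - exact: measurable_euclid_ball.
    - by move=> y [Uy _] /=; rewrite -lee_fin rE ediam_ubound.
    - rewrite (le_trans (@ball_mass_le p _ s k%:R x sp p0 r01 _ Ax.2))//.
      by rewrite gaugeE// -{2}rE poweR_EFin -EFinM.
  have /choice[B hB'] := hB.
  apply: (@le_trans _ _ (\sum_(0 <= i <oo) m (B i))).
    apply: measure_sigma_subadditive => //; first by move=> i; have [] := hB' i.
    by move=> x Ax; have [i _ Ux] := FU x Ax.1; exists i => //; have [_ + _] := hB' i; apply.
  apply: (@le_trans _ _ (\sum_(0 <= i <oo) (k%:R%:E * hausdorff_gauge s (U i)))).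
    apply: lee_nneseries => i _; first by move=> _; exact: measure_ge0.
    by have [] := hB' i.
  rewrite nneseriesZl; last by move=> i _; exact: gauge_ge0.
  apply: (@le_trans _ _ (k%:R%:E * e'%:E)); first by apply: lee_wpmul2l => //; exact: ltW.
  rewrite -EFinM lee_fin /e' mulrCA ger_pMr// ler_pdivrMr// mul1r ler_nat.
  exact: leqnSn.
have FE : F `<=` N `|` \bigcup_k A k.
  move=> x Fx; have := pot0 x; case E : (potential p x) => [r| |]//; last by left.
  rewrite lee_fin => r0; right; exists (Num.truncn r).+1 => //; split=> //=.
  by rewrite E lee_fin ltW// truncnS_gt.
apply/eqP; rewrite eq_le measure_ge0 andbT.
have mAU : measurable (\bigcup_k A k) by exact: bigcupT_measurable.
apply: (@le_trans _ _ (m (N `|` \bigcup_k A k))).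
  by apply: le_measure; rewrite ?inE//; exact: measurableU.
apply: (le_trans (measureU2 _ _ _)) => //; rewrite [X in X + _]N0 add0e.
apply: (@le_trans _ _ (\sum_(0 <= k <oo) m (A k))).
  exact: measure_sigma_subadditive.
by rewrite eseries0.
Qed.

End null_sets_of_finite_energy.

(** * Lipschitz and bi-Lipschitz maps on compact sets *)

Section lipschitz_maps.
Context {R : realType}.

Definition lipschitz_on_set m n (L : R) (K : set 'rV[R]_m) (f : 'rV[R]_m -> 'rV[R]_n) :=
  forall x y, K x -> K y -> edist (f x) (f y) <= L * edist x y.

Lemma lipschitz_continuous m n (L : R) (K : set 'rV[R]_m) (f : 'rV[R]_m -> 'rV[R]_n) :
  lipschitz_on_set L K f -> {within K, continuous f}.
Proof.
move=> Lf; apply/subspace_continuousP => x Kx.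
have c0 : 0 < `|L| * m%:R + 1 by rewrite ltr_wpDl// mulr_ge0.
apply/cvgrPdist_lt => e e0; near=> t.
have Kt : K t by near: t; exact: withinT.
rewrite (le_lt_trans (norm_le_euclid _ _))// (le_lt_trans (Lf _ _ Kx Kt))//.
apply: (@le_lt_trans _ _ (`|L| * (m%:R * `|x - t|))).
  apply: (@le_trans _ _ (`|L| * edist x t)).
    by rewrite ler_wpM2r ?euclid_ge0// ler_norm.
  by rewrite ler_wpM2l// euclid_le_norm.
rewrite mulrA; apply: (@le_lt_trans _ _ ((`|L| * m%:R + 1) * `|x - t|)).
  by rewrite ler_wpM2r// lerDl.
rewrite mulrC -ltr_pdivlMr//; near: t; apply: cvg_within.
by have := nbhsx_ballx x _ (divr_gt0 e0 c0); rewrite -ball_normE.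
Unshelve. all: by end_near. Qed.

Lemma lipschitz_compact m n (L : R) (K : set 'rV[R]_m) (f : 'rV[R]_m -> 'rV[R]_n) :
  lipschitz_on_set L K f -> compact K -> compact (f @` K).
Proof. by move=> /lipschitz_continuous; exact: continuous_compact. Qed.

Lemma compact_closed_rV n (K : set 'rV[R]_n) : compact K -> closed K.
Proof. by apply: compact_closed; exact: norm_hausdorff. Qed.

Lemma compact_measurable_rV n (K : set 'rV[R]_n) : compact K ->
  measurable (K : set (borel_rV R n)).
Proof. by move=> /compact_closed_rV/closed_measurable_rV. Qed.

(** The values of [f] off [A] are arbitrary, while a pushforward needs a map that is measurable on
    the whole space. *)
Definition extend0 m n (A : set 'rV[R]_m) (f : 'rV[R]_m -> 'rV[R]_n) :
    borel_rV R m -> borel_rV R n :=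
  fun x => if x \in A then f x else (0 : 'rV[R]_n).

Lemma extend0E m n (A : set 'rV[R]_m) (f : 'rV[R]_m -> 'rV[R]_n) x :
  A x -> extend0 A f x = f x.
Proof. by move=> Ax; rewrite /extend0 mem_set. Qed.

(* The preimage of [K `\` U] under the inverse [g] is the compact set
   [f @` (K `\` U)]. *)
Lemma measurable_inverse m n (L : R) (K : set 'rV[R]_m) (f : 'rV[R]_m -> 'rV[R]_n)
    (g : 'rV[R]_n -> 'rV[R]_m) :
  lipschitz_on_set L K f -> compact K -> {in K, cancel f g} ->
  measurable_fun setT (extend0 (f @` K) g).
Proof.
move=> Lf cK fg.
apply: (@measurability _ _ (borel_rV R n) (borel_rV R m) setT _ (@open 'rV[R]_m)) => //.
move=> _ [U oU <-]; rewrite setTI.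
have cKU : compact (f @` (K `\` U)).
  apply: (@lipschitz_compact _ _ L); first by move=> x y [Kx _] [Ky _]; exact: Lf.
  by rewrite setDE; apply: compact_closedI => //; exact: open_closedC.
have mK := compact_measurable_rV (lipschitz_compact Lf cK).
have mKU := compact_measurable_rV cKU.
(* Points off the image are sent to 0, so they all belong to the preimage or none does, according to
   whether [U] contains 0. *)
rewrite [X in measurable X](_ : _ = (f @` K `\` f @` (K `\` U)) `|`
    (if (0 : 'rV[R]_m) \in U then ~` (f @` K) else set0)); last first.
  apply/seteqP; split=> y.
    rewrite /extend0 /=; case: ifPn => [|yK].
      rewrite inE => -[x Kx <-]; rewrite fg ?inE// => Ux; left; split; first by exists x.
      move=> [x' [Kx' nUx'] xx']; apply: nUx'.
      by rewrite -(fg x') ?inE// xx' fg ?inE.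
    move=> U0; right; rewrite mem_set//; move=> yK'; move: yK; rewrite mem_set//.
  move=> [[[x Kx <-] nU]|].
    rewrite /= extend0E; last by exists x.
    rewrite fg ?inE//; apply: contrapT => nUx; apply: nU.
    by exists x => //; split.
  case: ifPn => //; rewrite inE => U0 yK /=.
  by rewrite /extend0 memNset.
apply: measurableU; first exact: measurableD.
by case: ifP => _; [exact: measurableC|exact: measurable0].
Qed.

Lemma compact_separated n (A B : set 'rV[R]_n) : compact A -> compact B ->
  A `&` B = set0 ->
  exists2 delta : R, 0 < delta & forall x y, A x -> B y -> delta <= edist x y.
Proof.
move=> /compact_near_coveringP cA /compact_closed_rV clB AB.
have h : \forall r \near (0 : R)^'+, A `<=` (fun x => forall y, B y -> r <= `|x - y|).
  apply: cA => x Ax.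
  have nBx : (~` B) x by move=> Bx; have : set0 x by rewrite -AB.
  have /nbhs_ballP[e /= e0 eB] : nbhs x (~` B).
    by apply: open_nbhs_nbhs; split=> //; exact: closed_openC.
  have e20 : 0 < e / 2 by rewrite divr_gt0.
  near=> x' r => y By.
  have xy : e <= `|x - y|.
    by rewrite leNgt; apply/negP => xy; apply: (eB y) => //; rewrite -ball_normE.
  have xx' : `|x - x'| < e / 2.
    by near: x'; have := nbhsx_ballx x _ e20; rewrite -ball_normE.
  have re : r <= e / 2 by near: r; apply: nbhs_right_le; rewrite divr_gt0.
  have {}xy := le_trans xy (ler_distD x' x y).
  rewrite (le_trans re)// -(lerD2l `|x - x'|); apply: le_trans xy.
  by rewrite [leRHS]splitr lerD2r ltW.
near (0 : R)^'+ => r; exists r => // x y Ax By.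
apply: le_trans (norm_le_euclid _ _).
have hr : A `<=` (fun x => forall y, B y -> r <= `|x - y|) by near: r.
exact: hr.
Unshelve. all: by end_near. Qed.

End lipschitz_maps.

Section restricted_measures.
Local Open Scope ereal_scope.
Context d (T : measurableType d) (R : realType).

Lemma integral_mfrestr (m : {measure set T -> \bar R}) (K D : set T)
    (mK : measurable K) (Koo : m K < +oo) (f : T -> \bar R) :
  measurable D -> measurable_fun D f -> (forall x, 0 <= f x) ->
  \int[mfrestr mK Koo]_(x in D) f x = \int[m]_(x in D `&` K) f x.
Proof.
move=> mD mf f0; pose mr : {measure set T -> \bar R} := mfrestr mK Koo.
have N0 : mr (~` K) = 0 by rewrite /mr /= /mfrestr /mrestr setICl measure0.
rewrite -[LHS]/(\int[mr]_(x in D) f x).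
rewrite (ge0_negligible_integral (measurableC mK) mD mf (fun x _ => f0 x) N0).
rewrite setDE setCK; apply: eq_measure_integral => A mA AD.
rewrite /mr /= /mfrestr /mrestr setIidl//.
by move=> x /AD[].
Qed.

Lemma integral_mfrestrT (m : {measure set T -> \bar R}) (K : set T)
    (mK : measurable K) (Koo : m K < +oo) (f : T -> \bar R) :
  measurable_fun setT f -> (forall x, 0 <= f x) ->
  \int[mfrestr mK Koo]_x f x = \int[m]_(x in K) f x.
Proof. by move=> mf f0; rewrite integral_mfrestr// setTI. Qed.

End restricted_measures.

Section bilipschitz_maps.
Context {R : realType} {d n : nat}.
Variables (lambda : R) (K : set 'rV[R]_d) (phi : 'rV[R]_d -> 'rV[R]_n).
Hypothesis bl : bilipschitz_on lambda K phi.

Lemma bilipschitz_gt0 : 0 < lambda.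
Proof. by case: bl => l1 _; exact: lt_le_trans l1. Qed.

Lemma bilipschitz_le x y : K x -> K y -> edist x y <= lambda * edist (phi x) (phi y).
Proof.
move=> Kx Ky; have [_ /(_ x y Kx Ky)/andP[h _]] := bl.
by rewrite -ler_pdivrMl ?bilipschitz_gt0.
Qed.

Lemma bilipschitz_lipschitz : lipschitz_on_set lambda K phi.
Proof. by move=> x y Kx Ky; have [_ /(_ x y Kx Ky)/andP[]] := bl. Qed.

Definition inverse_on (y : 'rV[R]_n) : 'rV[R]_d := xget 0 [set x | K x /\ phi x = y].

Lemma inverse_onK : {in K, cancel phi inverse_on}.
Proof.
move=> x; rewrite inE => Kx; rewrite /inverse_on; case: xgetP => [z _ [Kz zx]|/(_ x)]; last by case.
apply: euclid_eq0; apply/eqP; rewrite eq_le euclid_ge0 andbT.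
by rewrite (le_trans (bilipschitz_le Kz Kx))// zx euclidxx mulr0.
Qed.

Lemma inverse_on_lipschitz : lipschitz_on_set lambda (phi @` K) inverse_on.
Proof.
by move=> _ _ [x Kx <-] [y Ky <-]; rewrite !inverse_onK ?inE//; exact: bilipschitz_le.
Qed.

Hypothesis cK : compact K.

Lemma bilipschitz_compact : compact (phi @` K).
Proof. exact: lipschitz_compact bilipschitz_lipschitz cK. Qed.

Lemma measurable_inverse_on : measurable_fun setT (extend0 (phi @` K) inverse_on).
Proof. exact: measurable_inverse bilipschitz_lipschitz cK inverse_onK. Qed.

(** On [K] the map is itself the inverse of the Lipschitz map [inverse_on] on the compact image, so
    the same lemma applies. *)
Lemma measurable_extend_bilipschitz : measurable_fun setT (extend0 K phi).
Proof.
have <- : inverse_on @` (phi @` K) = K.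
  apply/seteqP; split=> [_ [_ [x Kx <-] <-]|x Kx].
    by rewrite inverse_onK ?inE.
  by exists (phi x); [exists x|rewrite inverse_onK ?inE].
apply: (measurable_inverse (L := lambda)).
- exact: inverse_on_lipschitz.
- exact: bilipschitz_compact.
- by move=> y; rewrite inE => -[x Kx <-]; rewrite inverse_onK ?inE.
Qed.

End bilipschitz_maps.

(** * Upper bound for the energy of disjoint pieces *)

Section energy_upper_bound.
Local Open Scope ereal_scope.
Context {R : realType}.

(** Stated for pairs of points in two spaces, so as to serve both for a bi-Lipschitz map and for its
    inverse. The hypothesis keeps distinct points [x], [y] from being paired with equal [x'],
    [y']. *)
Lemma riesz_kernel_expand (m n : nat) (lambda p : R) (x y : 'rV[R]_m) (x' y' : 'rV[R]_n) :
  (0 < lambda)%R -> (0 < p)%R -> (edist x y <= lambda * edist x' y')%R ->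
  riesz_kernel p x' y' <= (lambda `^ p)%:E * riesz_kernel p x y.
Proof.
move=> l0 p0 xy'; rewrite /riesz_kernel; have [_|xy] := eqVneq x y.
  by rewrite gt0_muley ?leey// lte_fin powR_gt0.
have e0 := euclid_gt0 xy.
have f0 : (0 < edist x' y')%R.
  by rewrite -(pmulr_rgt0 _ l0) (lt_le_trans e0).
have [x'y'|x'y'] := eqVneq x' y'; first by move: f0; rewrite x'y' euclidxx ltxx.
rewrite -EFinM lee_fin !powRN ler_pdivlMr ?powR_gt0// mulrC ler_pdivrMr ?powR_gt0//.
rewrite -powRM ?(ltW l0) ?(ltW f0)//.
by apply: ge0_ler_powR; rewrite ?nnegrE ?(ltW p0) ?(ltW e0) ?mulr_ge0 ?(ltW l0) ?(ltW f0).
Qed.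

Context {d n : nat}.
Variables (m : nat) (lambda : R) (K : nat -> set 'rV[R]_d)
  (phi : nat -> 'rV[R]_d -> 'rV[R]_n) (E : set 'rV[R]_n).
Hypothesis cK : forall i, compact (K i).
Hypothesis bl : forall i, bilipschitz_on lambda (K i) (phi i).
Hypothesis KE : forall i, (i < m)%N -> phi i @` K i `<=` E.
Hypothesis mE : measurable (E : set (borel_rV R n)).

Let mK i : measurable (K i : set (borel_rV R d)).
Proof. exact: compact_measurable_rV. Qed.

Let Kfin i : leb d (K i) < +oo.
Proof. by rewrite ltey_eq leb_compact_fin. Qed.

Let mphi i := measurable_extend_bilipschitz (bl i) (@cK i).

Let nuK i : {finite_measure set (borel_rV R d) -> \bar R} := mfrestr (mK i) (Kfin i).

Let piece i : {measure set (borel_rV R n) -> \bar R} := image_measure (nuK i) (mphi i).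

Let integral_piece i (f : borel_rV R n -> \bar R) : (i < m)%N ->
  measurable_fun setT f -> (forall x, 0 <= f x) ->
  \int[piece i]_(x in E) f x = \int[leb d]_(v in K i) f (phi i v).
Proof.
move=> im mf f0.
rewrite [LHS](@ge0_integral_pushforward _ _ _ _ R _ (mphi i) (nuK i) E f mE
  (measurable_funTS mf) (fun x _ => f0 x)).
have mfp : measurable_fun setT (f \o extend0 (K i) (phi i)) by exact: measurableT_comp (mphi i).
have mpre : measurable (extend0 (K i) (phi i) @^-1` E).
  by rewrite -[X in measurable X]setTI; exact: (mphi i).
rewrite [LHS](integral_mfrestr (mK i) (Kfin i) mpre (measurable_funTS mfp) (fun x => f0 _)).
rewrite setIidr => [|v Kv]; last by rewrite /= extend0E//; apply: (KE im); exists v.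
by apply: eq_integral => v; rewrite inE => Kv; rewrite /= extend0E.
Qed.

Let pieceE i : (i < m)%N -> piece i E = leb d (K i).
Proof.
move=> im; rewrite -[LHS]mul1e -integral_cst// integral_piece//.
by rewrite integral_cst// mul1e.
Qed.

Let pieceT i : piece i setT = leb d (K i).
Proof.
by rewrite /piece /= /image_measure /pushforward preimage_setT /mfrestr /mrestr setTI.
Qed.

Let V : R := \sum_(i < m) fine (leb d (K i)).
Hypothesis V0 : (0 < V)%R.

Let iV : {nonneg R} := NngNum (ltW (eq_ind_r is_true V0 (invr_gt0 V))).

(** The test measure: the normalized sum of the images of Lebesgue measure on the parameter sets. *)
Let nu : {measure set (borel_rV R n) -> \bar R} := mscale iV (msum piece m).

Let nuE1 : nu E = 1.
Proof.
rewrite -[LHS]/((V^-1)%:E * \sum_(i < m) piece i E).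
under eq_bigr => i _ do rewrite pieceE//.
under eq_bigr => i _ do rewrite -(fineK (leb_compact_fin (@cK i))).
by rewrite sumEFin -EFinM mulVf ?gt_eqF.
Qed.

Let nuT1 : nu setT = 1.
Proof.
rewrite -[LHS]/((V^-1)%:E * \sum_(i < m) piece i setT).
under eq_bigr => i _ do rewrite pieceT.
under eq_bigr => i _ do rewrite -(fineK (leb_compact_fin (@cK i))).
by rewrite sumEFin -EFinM mulVf ?gt_eqF.
Qed.

Let integral_nu (f : borel_rV R n -> \bar R) :
  measurable_fun setT f -> (forall x, 0 <= f x) ->
  \int[nu]_(x in E) f x =
  (V^-1)%:E * \sum_(i < m) \int[leb d]_(v in K i) f (phi i v).
Proof.
move=> mf f0; rewrite /nu ge0_integral_mscale//; last exact: measurable_funTS.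
rewrite ge0_integral_measure_sum//; last exact: measurable_funTS.
by congr (_ * _); apply: eq_bigr => i _; rewrite integral_piece.
Qed.

Hypothesis disj : forall i j, (i < m)%N -> (j < m)%N -> i != j ->
  phi i @` K i `&` phi j @` K j = set0.

Let separation : exists2 delta : R, (0 < delta)%R &
  forall i j : 'I_m, i != j -> forall u v, K i u -> K j v ->
    (delta <= edist (phi i u) (phi j v))%R.
Proof.
have h : \forall r \near (0 : R)^'+, forall i j : 'I_m, i != j ->
    forall u v, K i u -> K j v -> (r <= edist (phi i u) (phi j v))%R.
  apply: filter_forall => i; apply: filter_forall => j.
  have [ij|ij] := eqVneq i j; first by exact: nearW.
  have [delta d0 hd] := compact_separated (bilipschitz_compact (bl i) (@cK i))
    (bilipschitz_compact (bl j) (@cK j)) (disj (ltn_ord i) (ltn_ord j) ij).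
  near=> r => _ u v Ku Kv.
  apply: (@le_trans _ _ delta); first by near: r; exact: nbhs_right_le.
  by apply: hd; [exists u|exists v].
near (0 : R)^'+ => r; exists r => //.
by near: r.
Unshelve. all: by end_near. Qed.

(** The piece containing the point is compared with its parameter set in R^d at the cost of
    lambda^p; on all other pieces the kernel is at most delta^-p. *)
Let potential_le (delta p : R) (i : 'I_m) (u : 'rV[R]_d) : (0 < delta)%R ->
  (forall i j : 'I_m, i != j -> forall u v, K i u -> K j v ->
    (delta <= edist (phi i u) (phi j v))%R) ->
  (0 < p < d%:R)%R -> K i u ->
  \int[nu]_(y in E) riesz_kernel p (phi i u) y <=
  (V^-1 * (lambda `^ p * ((Gamma (p / 2))^-1 *
     (V * (p / 2)^-1 + pi `^ (d%:R / 2) * ((d%:R - p) / 2)^-1)) +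
     delta `^ (- p) * V))%:E.
Proof.
move=> d0 hd pd Ku; have /andP[p0 _] := pd; have l0 := bilipschitz_gt0 (bl i).
set B := ((Gamma _)^-1 * _)%R.
rewrite integral_nu; first last.
- by move=> x; exact: riesz_kernel_ge0.
- exact: measurable_riesz_kernel.
rewrite EFinM lee_wpmul2l ?lee_fin ?invr_ge0 ?(ltW V0)//.
have mk j D : measurable_fun (D : set (borel_rV R d)) (fun v => riesz_kernel p (phi i u) (extend0 (K j) (phi j) v)).
  by apply: measurable_funTS; apply: measurable_riesz_kernel => //; exact: mphi.
have kE j : \int[leb d]_(v in K j) riesz_kernel p (phi i u) (phi j v) =
    \int[leb d]_(v in K j) riesz_kernel p (phi i u) (extend0 (K j) (phi j) v).
  by apply: eq_integral => v; rewrite inE => Kv; rewrite extend0E.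
have Vle (j : 'I_m) : (fine (leb d (K j)) <= V)%R.
  rewrite /V (bigD1 j)//= lerDl; apply: sumr_ge0 => k _.
  by apply: fine_ge0; exact: measure_ge0.
rewrite (bigD1 i)//= EFinD leeD//.
  rewrite kE; apply: (@le_trans _ _ (\int[leb d]_(v in K i) ((lambda `^ p)%:E * riesz_kernel p u v))).
    apply: ge0_le_integral => //.
    - by move=> v _; exact: riesz_kernel_ge0.
    - by apply: measurable_funTS; apply: emeasurable_funM => //; exact: measurable_riesz_kernel.
    - move=> v Kv; rewrite extend0E//; apply: riesz_kernel_expand => //.
      exact: (bilipschitz_le (bl i)).
  have mku : measurable_fun setT (fun v : borel_rV R d => riesz_kernel p u v) by exact: measurable_riesz_kernel.
  have lp0 : 0 <= (lambda `^ p)%:E by rewrite lee_fin powR_ge0.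
  rewrite (ge0_integralZl _ (mK i) (measurable_funTS mku) (fun v _ => riesz_kernel_ge0 p u v) lp0).
  rewrite EFinM; apply: lee_wpmul2l => //.
  rewrite -(integral_mfrestrT (mK i) (Kfin i) mku (fun v => riesz_kernel_ge0 _ _ _)).
  apply: (@riesz_potential_le _ _ (nuK i)) => //.
    rewrite /nuK /= /mfrestr /mrestr setTI -(fineK (leb_compact_fin (@cK i))).
    by rewrite lee_fin.
  move=> t t0; have mg : measurable_fun setT (fun v : borel_rV R d => (gauss t u v)%:E).
    by apply/measurable_EFinP; exact: measurable_gauss.
  rewrite [leLHS](integral_mfrestrT (mK i) (Kfin i) mg); last by move=> v; rewrite lee_fin gauss_ge0.
  rewrite -(integral_gauss u t0); apply: ge0_subset_integral => //.
  by move=> v _; rewrite lee_fin gauss_ge0.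
apply: (@le_trans _ _ (\sum_(j < m | j != i) (delta `^ (- p) * fine (leb d (K j)))%:E)).
  apply: lee_sum => j ji; rewrite kE.
  apply: (@le_trans _ _ (\int[leb d]_(v in K j) cst ((delta `^ (- p))%:E) v)).
    apply: ge0_le_integral => //.
    - by move=> v _; exact: riesz_kernel_ge0.
    - move=> v Kv; rewrite extend0E// /riesz_kernel /=.
      have dd : (delta <= edist (phi i u) (phi j v))%R by apply: hd => //; rewrite eq_sym.
      have e0 := lt_le_trans d0 dd.
      have [E0|_] := eqVneq (phi i u) (phi j v); first by move: e0; rewrite E0 euclidxx ltxx.
      rewrite lee_fin !powRN lef_pV2 ?posrE ?powR_gt0//.
      by apply: ge0_ler_powR; rewrite ?nnegrE ?euclid_ge0// ltW.
  by rewrite integral_cst// EFinM (fineK (leb_compact_fin (@cK j))).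
rewrite sumEFin lee_fin -mulr_sumr ler_wpM2l ?powR_ge0//.
rewrite /V [leRHS](bigD1 i)//= lerDr.
by apply: fine_ge0; exact: measure_ge0.
Qed.

(** As [delta] does not depend on [p], the interaction term disappears once the bound is multiplied
    by d - p. *)
Lemma riesz_energy_le : exists2 delta : R, (0 < delta)%R &
  forall p, (0 < p < d%:R)%R -> riesz_energy p E <=
  (V^-1 * (lambda `^ p * ((Gamma (p / 2))^-1 *
     (V * (p / 2)^-1 + pi `^ (d%:R / 2) * ((d%:R - p) / 2)^-1)) +
     delta `^ (- p) * V))%:E.
Proof.
have [delta d0 hd] := separation; exists delta => // p pd.
have /andP[p0 _] := pd.
pose P : probability (borel_rV R n) R :=
  HB.pack_for (probability (borel_rV R n) R) (Measure.sort nu)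
    (Measure_isProbability.Build _ _ _ (Measure.sort nu) nuT1).
apply: (@le_trans _ _ (\int[P]_(x in E) \int[P]_(y in E) riesz_kernel p x y)).
  by apply: ereal_inf_lbound; exists P.
set M := (V^-1 * _)%R.
have k0 x : 0 <= \int[P]_(y in E) riesz_kernel p x y.
  by apply: integral_ge0 => y _; exact: riesz_kernel_ge0.
rewrite [leLHS](_ : _ = \int[nu]_(x in E) \int[nu]_(y in E) riesz_kernel p x y)//.
have mpot : measurable_fun setT (fun x : borel_rV R n => \int[nu]_(y in E) riesz_kernel p x y).
  under eq_fun do rewrite integral_mkcond.
  apply: (@measurable_integral_snd _ _ _ (borel_rV R n) (borel_rV R n) P
    (fun x y => ((fun y : borel_rV R n => riesz_kernel p x y) \_ E) y)).
    rewrite (_ : (fun xy => _) = (fun xy : borel_rV R n * borel_rV R n =>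
        riesz_kernel p xy.1 xy.2 * (\1_E xy.2)%:E)); last first.
      apply/funext => -[x y] /=; rewrite patchE indicE.
      by case: ifP => _; rewrite ?mule1 ?mule0.
    apply: emeasurable_funM.
      by apply: measurable_riesz_kernel; [|exact: measurable_fst|exact: measurable_snd].
    by apply/measurable_EFinP; exact: (measurableT_comp (measurable_indic mE) measurable_snd).
  move=> x y; rewrite patchE; case: ifP => // _; exact: riesz_kernel_ge0.
rewrite integral_nu//.
(* Since V > 0 some piece is nonempty, and the nonnegative potential at one of its points is at most
   [M]. *)
have M0 : (0 <= M)%R.
  rewrite -lee_fin; have [i Ki] : exists i : 'I_m, K i !=set0.
    apply/not_existsP => h; move: V0; rewrite /V big1 ?ltxx// => i _.
    by have [->|/set0P/h//] := eqVneq (K i) set0; rewrite measure0.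
  have [u Ku] := Ki; apply: le_trans (potential_le d0 hd pd Ku).
  by apply: integral_ge0 => y _; exact: riesz_kernel_ge0.
apply: (@le_trans _ _ ((V^-1)%:E * \sum_(i < m) (M%:E * leb d (K i)))).
  apply: lee_wpmul2l; first by rewrite lee_fin invr_ge0 ltW.
  apply: lee_sum => i _; rewrite -integral_cst//.
  have -> : \int[leb d]_(v in K i) \int[nu]_(y in E) riesz_kernel p (phi i v) y =
      \int[leb d]_(v in K i) \int[nu]_(y in E) riesz_kernel p (extend0 (K i) (phi i) v) y.
    by apply: eq_integral => v; rewrite inE => Kv; rewrite extend0E.
  apply: ge0_le_integral => //.
  - by apply: measurable_funTS; apply: (measurableT_comp mpot); exact: mphi.
  - by move=> v Kv; rewrite extend0E//; exact: (potential_le d0 hd pd Kv).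
under eq_bigr => i _ do rewrite -(fineK (leb_compact_fin (@cK i))) -EFinM.
by rewrite sumEFin -EFinM lee_fin -mulr_sumr mulrCA mulVf ?mulr1// gt_eqF.
Qed.

End energy_upper_bound.

(** * Lower bound for the energy through pieces pulled back to R^d *)

Section energy_lower_bound_pieces.
Local Open Scope ereal_scope.
Context {R : realType} {d n : nat}.
Variables (m : nat) (lambda : R) (K : nat -> set 'rV[R]_d)
  (phi : nat -> 'rV[R]_d -> 'rV[R]_n) (E : set 'rV[R]_n).
Hypothesis cK : forall i, compact (K i).
Hypothesis bl : forall i, bilipschitz_on lambda (K i) (phi i).
Hypothesis KE : forall i, (i < m)%N -> phi i @` K i `<=` E.
Hypothesis mE : measurable (E : set (borel_rV R n)).
Variable mu : probability (borel_rV R n) R.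

Let lt_oo (D : set (borel_rV R n)) : measurable D -> mu D < +oo.
Proof. by move=> mD; rewrite ltey_eq fin_num_measure. Qed.

Let measurable_kernel p (x : 'rV[R]_n) : (0 < p)%R ->
  measurable_fun setT (fun y : borel_rV R n => riesz_kernel p x y).
Proof. by move=> p0; exact: measurable_riesz_kernel. Qed.

Let measurable_potential p (D : set (borel_rV R n)) : (0 < p)%R -> measurable D ->
  measurable_fun setT (fun x : borel_rV R n => \int[mu]_(y in D) riesz_kernel p x y).
Proof.
move=> p0 mD.
under eq_fun => x do rewrite -(integral_mfrestrT mD (lt_oo mD) (measurable_kernel x p0) (fun y => riesz_kernel_ge0 _ _ _)).
apply: (@measurable_integral_snd _ _ _ (borel_rV R n) (borel_rV R n) (mfrestr mD (lt_oo mD))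
  (fun x y => riesz_kernel p x y)).
  by apply: measurable_riesz_kernel; [|exact: measurable_fst|exact: measurable_snd].
by move=> x y; exact: riesz_kernel_ge0.
Qed.

Let img i := phi i @` K i.

Let mimg i : measurable (img i : set (borel_rV R n)).
Proof. by apply: compact_measurable_rV; exact: bilipschitz_compact (bl i) (@cK i). Qed.

(** The images may overlap; made disjoint, their self-energies add up to at most the total
    energy. *)
Let A i : set (borel_rV R n) := seqDU img i.

Let mA i : measurable (A i).
Proof. by apply: measurableD => //; exact: bigsetU_measurable. Qed.

Let psi i : borel_rV R n -> borel_rV R d := extend0 (img i) (inverse_on (K i) (phi i)).

Let mpsi i : measurable_fun setT (psi i).
Proof. exact: measurable_inverse_on (bl i) (@cK i). Qed.

Let Aimg i x : A i x -> exists2 u, K i u & [/\ phi i u = x & psi i x = u].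
Proof.
move=> [[u Ku ux] _]; exists u => //; split=> //.
rewrite /psi extend0E; last by exists u.
by rewrite -ux (inverse_onK (bl i)) ?inE.
Qed.

(** The part of [mu] on [A i], transported to the parameter space, where the Gaussian estimate is
    available. *)
Let piece i : {finite_measure set (borel_rV R d) -> \bar R} :=
  image_measure (mfrestr (mA i) (lt_oo (mA i))) (mpsi i).

Let integral_piece i (f : borel_rV R d -> \bar R) :
  measurable_fun setT f -> (forall x, 0 <= f x) ->
  \int[piece i]_u f u = \int[mu]_(x in A i) f (psi i x).
Proof.
move=> mf f0.
rewrite [LHS](@ge0_integral_pushforward _ _ _ _ R _ (mpsi i) (mfrestr (mA i) (lt_oo (mA i)))
  setT f measurableT mf (fun x _ => f0 x)) preimage_setT.
have mfp : measurable_fun setT (f \o psi i) by exact: measurableT_comp (mpsi i).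
exact: (integral_mfrestrT (mA i) (lt_oo (mA i)) mfp (fun x => f0 _)).
Qed.

Let pieceK i : piece i (K i) = mu (A i).
Proof.
rewrite /piece /= /image_measure /pushforward /mfrestr /mrestr; congr (mu _).
by apply/setIidr => x /Aimg[u Ku [_ xu]] /=; rewrite xu.
Qed.

Let piece_energy_le p i : (0 < p)%R ->
  \int[piece i]_u \int[piece i]_v riesz_kernel p u v <=
  (lambda `^ p)%:E * \int[mu]_(x in A i) \int[mu]_(y in A i) riesz_kernel p x y.
Proof.
move=> p0; have l0 := bilipschitz_gt0 (bl i).
have lp0 : 0 <= (lambda `^ p)%:E by rewrite lee_fin powR_ge0.
have mkuv : measurable_fun setT (fun u : borel_rV R d => \int[piece i]_v riesz_kernel p u v).
  apply: (@measurable_integral_snd _ _ _ (borel_rV R d) (borel_rV R d) (piece i)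
    (fun x y => riesz_kernel p x y)).
    by apply: measurable_riesz_kernel; [|exact: measurable_fst|exact: measurable_snd].
  by move=> x y; exact: riesz_kernel_ge0.
have pot0 p' (D : set (borel_rV R n)) x : 0 <= \int[mu]_(y in D) riesz_kernel p' x y.
  by apply: integral_ge0 => y _; exact: riesz_kernel_ge0.
rewrite (integral_piece i mkuv); last first.
  by move=> u; apply: integral_ge0 => v _; exact: riesz_kernel_ge0.
rewrite -(ge0_integralZl _ (mA i) (measurable_funTS (measurable_potential p0 (mA i)))
  (fun x _ => pot0 p (A i) x) lp0).
apply: ge0_le_integral => //.
- by move=> x _; apply: integral_ge0 => v _; exact: riesz_kernel_ge0.
- by apply: measurable_funTS; exact: (measurableT_comp mkuv (mpsi i)).
- apply: measurable_funTS; apply: emeasurable_funM => //.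
  exact: measurable_potential.
move=> x /Aimg[u Ku [ux xu]].
have mk1 (z : 'rV[R]_n) D : measurable_fun (D : set (borel_rV R n)) (fun y => riesz_kernel p z y).
  by apply: measurable_funTS; exact: measurable_riesz_kernel.
rewrite integral_piece; first last.
- by move=> v; exact: riesz_kernel_ge0.
- exact: measurable_riesz_kernel.
rewrite -(ge0_integralZl _ (mA i) (mk1 x (A i)) (fun y _ => riesz_kernel_ge0 p x y) lp0).
apply: ge0_le_integral => //.
- by move=> y _; exact: riesz_kernel_ge0.
- by apply: measurable_funTS; apply: measurable_riesz_kernel => //; exact: mpsi.
- by apply: emeasurable_funM.
move=> y /Aimg[v Kv [vy yv]]; apply: riesz_kernel_expand => //.
by rewrite xu yv -ux -vy; exact: (bilipschitz_lipschitz (bl i)).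
Qed.

Let energy_ge_sum p : (0 < p)%R ->
  \sum_(i < m) \int[mu]_(x in A i) \int[mu]_(y in A i) riesz_kernel p x y <=
  \int[mu]_(x in E) \int[mu]_(y in E) riesz_kernel p x y.
Proof.
move=> p0; have pot0 (D : set (borel_rV R n)) x : 0 <= \int[mu]_(y in D) riesz_kernel p x y.
  by apply: integral_ge0 => y _; exact: riesz_kernel_ge0.
have AE i : (i < m)%N -> A i `<=` E by move=> im x [] /(KE im).
have sub : \big[setU/set0]_(i <- index_iota 0 m) A i `<=` E.
  rewrite big_mkord -bigcup_mkord => x [i /= im]; exact: AE.
have mpot D : measurable_fun (D : set (borel_rV R n))
    (fun x : borel_rV R n => \int[mu]_(y in E) riesz_kernel p x y).
  by apply: measurable_funTS; exact: measurable_potential.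
apply: (@le_trans _ _ (\int[mu]_(x in \big[setU/set0]_(i <- index_iota 0 m) A i)
    \int[mu]_(y in E) riesz_kernel p x y)); last first.
  by apply: ge0_subset_integral => //; exact: bigsetU_measurable.
rewrite ge0_integral_bigsetU//; first last.
- by apply/trivIsetP => i j _ _ ij; have /trivIsetP := trivIset_seqDU img; apply.
- exact: iota_uniq.
rewrite big_mkord; apply: lee_sum => i _; apply: ge0_le_integral => //.
  by apply: measurable_funTS; exact: measurable_potential.
move=> x _; apply: ge0_subset_integral => //.
- by apply: measurable_funTS; exact: measurable_riesz_kernel.
- by move=> y _; exact: riesz_kernel_ge0.
- exact: AE.
Qed.

Hypothesis muE : mu E = 1.

(** The estimates on the pieces are linear in their masses and use a common [b], so only the total
    mass, at least 1, and the total volume, at most [V], enter the sum. *)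
Lemma energy_ge_pieces (s p T r b V : R) : (0 <= s <= p)%R -> (0 < p < d%:R)%R ->
  (0 < T)%R -> (0 < r)%R -> (0 <= b)%R ->
  hausdorff_raw s (E `\` \bigcup_(i < m) phi i @` K i) = 0 ->
  \sum_(i < m) leb d (thicken (K i) r) <= V%:E ->
  (Num.sqrt 2 ^+ d * expR (- (T * r ^+ 2)) <= 1)%R ->
  (lambda `^ (- p) * ((Gamma (p / 2))^-1 * (pi `^ (d%:R / 2) *
    (T `^ (- ((d%:R - p) / 2)) / ((d%:R - p) / 2))) *
   (2 * b * (1 - Num.sqrt 2 ^+ d * expR (- (T * r ^+ 2))) - b ^+ 2 * V)))%:E <=
  \int[mu]_(x in E) \int[mu]_(y in E) riesz_kernel p x y.
Proof.
move=> sp pd T0 r0 b0 F0 VK eta1; have /andP[p0 pltd] := pd.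
have l0 : (0 < lambda)%R by exact: bilipschitz_gt0 (bl 0%N).
(* Finite energy, the only case left, is what makes the residual set negligible for [mu]. *)
have [->|Ioo] := eqVneq (\int[mu]_(x in E) \int[mu]_(y in E) riesz_kernel p x y) +oo.
  exact: leey.
set F := (E `\` _) in F0.
have mU : measurable (\bigcup_(i < m) img i : set (borel_rV R n)).
  by rewrite bigcup_mkord; exact: bigsetU_measurable.
have mF : measurable (F : set (borel_rV R n)) by exact: measurableD.
pose muR : {finite_measure set (borel_rV R n) -> \bar R} := mfrestr mE (lt_oo mE).
have muF : mu F = 0.
  have mk x : measurable_fun setT (fun y : borel_rV R n => riesz_kernel p x y).
    exact: measurable_riesz_kernel.
  have -> : mu F = muR F by rewrite /muR /= /mfrestr /mrestr setIidl// => x [].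
  apply: (finite_energy_null sp p0 mF F0).
  under eq_integral do rewrite (integral_mfrestrT mE (lt_oo mE) (mk _) (fun y => riesz_kernel_ge0 _ _ _)).
  rewrite [ltLHS](integral_mfrestrT mE (lt_oo mE) (measurable_potential p0 mE)) ?ltey//.
  by move=> x; apply: integral_ge0 => y _; exact: riesz_kernel_ge0.
have Asum : 1 <= \sum_(i < m) mu (A i).
  rewrite -muE -(@measure_bigsetU _ _ _ mu A)//; last first.
    exact: trivIset_seqDU.
  rewrite -(bigsetU_seqDU img) -bigcup_mkord.
  apply: (@le_trans _ _ (mu (\bigcup_(i < m) img i `|` F))).
    apply: le_measure; rewrite ?inE//; first exact: measurableU.
    move=> x Ex; have [?|?] := pselect ((\bigcup_(i < m) img i) x); first by left.
    by right; split.
  by rewrite (le_trans (measureU2 _ _ _))// [X in _ + X]muF adde0.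
apply: le_trans (energy_ge_sum p0).
set C := ((Gamma _)^-1 * _)%R; set eta := (Num.sqrt 2 ^+ d * _)%R in eta1 *.
have C0 : (0 <= C)%R.
  have q0 : (0 < (d%:R - p) / 2)%R by rewrite divr_gt0// subr_gt0.
  rewrite mulr_ge0 ?invr_ge0 ?(ltW (Gamma_gt0 _)) ?divr_gt0//.
  by rewrite mulr_ge0 ?powR_ge0// divr_ge0 ?powR_ge0// ltW.
have Vfin (i : 'I_m) : leb d (thicken (K i) r) \is a fin_num.
  rewrite ge0_fin_numE ?measure_ge0//; apply: le_lt_trans (ltry V); apply: le_trans VK.
  rewrite (bigD1 i)//= leeDl//; apply: sume_ge0 => j _; exact: measure_ge0.
have step (i : 'I_m) : (C * (2 * b * (1 - eta) * fine (mu (A i)) -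
    b ^+ 2 * fine (leb d (thicken (K i) r))))%:E <=
    (lambda `^ p)%:E * \int[mu]_(x in A i) \int[mu]_(y in A i) riesz_kernel p x y.
  apply: le_trans (piece_energy_le i p0); rewrite -pieceK.
  apply: (@riesz_energy_ge _ _ (piece i) (K i) (thicken (K i) r)) => //.
  - exact: ltW.
  - exact: compact_measurable_rV.
  - by apply: open_measurable_rV; exact: open_thicken.
  - by move=> x z Kx xz; exists x.
  - by rewrite fineK.
have sums : (C * (2 * b * (1 - eta) - b ^+ 2 * V))%:E <=
    (lambda `^ p)%:E * \sum_(i < m) \int[mu]_(x in A i) \int[mu]_(y in A i) riesz_kernel p x y.
  rewrite ge0_sume_distrr; last first.
    by move=> i _; apply: integral_ge0 => x _; apply: integral_ge0 => y _; exact: riesz_kernel_ge0.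
  apply: le_trans (lee_sum _ (fun i _ => step i)); rewrite sumEFin lee_fin -mulr_sumr ler_wpM2l//.
  rewrite big_split/= -mulr_sumr sumrN -mulr_sumr lerB//.
    rewrite ler_peMr ?mulr_ge0 ?subr_ge0//.
    move: Asum; under eq_bigr => i _ do rewrite -(fineK (fin_num_measure mu _ (mA i))).
    by rewrite sumEFin lee_fin.
  rewrite ler_wpM2l ?sqr_ge0//.
  move: VK; under eq_bigr => i _ do rewrite -(fineK (Vfin i)).
  by rewrite sumEFin lee_fin.
by rewrite powRN EFinM lee_pdivrMl ?powR_gt0.
Qed.

End energy_lower_bound_pieces.

(** * Rectifiable sets *)

Section rectifiable_pieces.
Local Open Scope ereal_scope.
Context {R : realType} {d n : nat}.
Hypothesis d0 : (0 < d)%N.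

Let dR : (0 < d%:R :> R)%R. Proof. by rewrite ltr0n. Qed.

Lemma hausdorff_measureE (A : set 'rV[R]_n) :
  hausdorff_measure d A = ((@raw_cube R d)^-1)%:E * hausdorff_raw d%:R A.
Proof.
rewrite /hausdorff_measure -[hausdorff_raw d%:R unit_cube]/(hausdorff_raw d%:R cubeQ).
by rewrite raw_cubeE inver gt_eqF ?raw_cube_gt0// muleC.
Qed.

(** The pieces are indexed by all natural numbers with one common constant; beyond [m] they are
    empty, and any map is bi-Lipschitz on the empty set. *)
Lemma rectifiable_piecesP (E : set 'rV[R]_n) (e : R) : (0 < e)%R ->
  strongly_rectifiable d E ->
  exists (m : nat) (K : nat -> set 'rV[R]_d) (phi : nat -> 'rV[R]_d -> 'rV[R]_n),
  [/\ forall i, compact (K i),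
      forall i, bilipschitz_on (1 + e) (K i) (phi i),
      forall i, (i < m)%N -> phi i @` K i `<=` E,
      forall i j, (i < m)%N -> (j < m)%N -> i != j ->
        hausdorff_raw d%:R (phi i @` K i `&` phi j @` K j) = 0 &
      exists s : R, [/\ (0 <= s)%R, (s < d%:R)%R &
        hausdorff_raw s (E `\` \bigcup_(i < m) phi i @` K i) = 0]].
Proof.
move=> e0 /(_ e e0)[m [K [phi [cK bl disj dimF]]]].
pose K' k := if insub k is Some i then K i else set0.
pose phi' k := if insub k is Some i then phi i else (fun=> 0%R : 'rV[R]_n).
have KE (i : 'I_m) : K' i = K i by rewrite /K' valK.
have phiE (i : 'I_m) : phi' i = phi i by rewrite /phi' valK.
exists m, K', phi'; split.
- move=> k; rewrite /K'; case: insub => [i|]; first by have [] := cK i.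
  exact: compact0.
- move=> k; rewrite /K' /phi'; case: insub => [i|]; last first.
    by split=> //; rewrite lerDl ltW.
  have [l le [l1 hl]] := bl i; split=> [|x y Kx Ky]; first by rewrite lerDl ltW.
  have /andP[h1 h2] := hl x y Kx Ky; have l0 : (0 < l)%R by exact: lt_le_trans l1.
  apply/andP; split.
    apply: le_trans h1; apply: ler_wpM2r; first exact: euclid_ge0.
    by rewrite lef_pV2 ?posrE ?(lt_trans l0 le)// ltW.
  by apply: (le_trans h2); apply: ler_wpM2r; [exact: euclid_ge0|exact: ltW].
- by move=> k km; have := (cK (Ordinal km)).2; rewrite -KE -phiE.
- move=> i j im jm ij; have := disj (Ordinal im) (Ordinal jm) ij.
  rewrite -!KE -!phiE hausdorff_measureE => /eqP; rewrite mule_eq0 => /orP[|/eqP//].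
  by rewrite eqe invr_eq0 gt_eqF// raw_cube_gt0.
- have := hausdorff_dim_lt dimF; rewrite (_ : \bigcup_i (phi i @` K i) = \bigcup_(i < m) phi' i @` K' i)//.
  apply/seteqP; split=> x [i] /=.
    by move=> _ ix; exists i => //=; rewrite KE phiE.
  by move=> im; rewrite -[i]/(val (Ordinal im)) KE phiE => ix; exists (Ordinal im).
Qed.

Variables (m : nat) (lambda : R) (K : nat -> set 'rV[R]_d)
  (phi : nat -> 'rV[R]_d -> 'rV[R]_n) (E : set 'rV[R]_n).
Hypothesis cK : forall i, compact (K i).
Hypothesis bl : forall i, bilipschitz_on lambda (K i) (phi i).
Hypothesis KE : forall i, (i < m)%N -> phi i @` K i `<=` E.

Let img i := phi i @` K i.

Let cimg i : compact (img i).
Proof. exact: bilipschitz_compact (bl i) (@cK i). Qed.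

Let l0 : (0 < lambda)%R := bilipschitz_gt0 (bl 0%N).

Let lpow (A : set 'rV[R]_d) i : A `<=` K i ->
  hausdorff_raw d%:R (phi i @` A) <= (lambda ^+ d)%:E * hausdorff_raw d%:R A.
Proof.
move=> AK; rewrite -powR_mulrn ?(ltW l0)//; apply: raw_lipschitz => //.
by move=> x y Ax Ay; apply: (bilipschitz_lipschitz (bl i)); exact: AK.
Qed.

Lemma raw_le_pieces (s : R) : (0 <= s)%R -> (s < d%:R)%R ->
  hausdorff_raw s (E `\` \bigcup_(i < m) phi i @` K i) = 0 ->
  hausdorff_raw d%:R E <=
  (lambda ^+ d * (@raw_cube R d * \sum_(i < m) fine (leb d (K i))))%:E.
Proof.
move=> s0 sd F0; set F := E `\` _ in F0.
have {}F0 : hausdorff_raw d%:R F = 0.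
  apply/eqP; rewrite eq_le raw_ge0 andbT -F0.
  by apply: raw_exponent_le => //; rewrite s0 ltW.
apply: (@le_trans _ _ (hausdorff_raw d%:R (\bigcup_(i < m) img i) + hausdorff_raw d%:R F)).
  apply: le_trans (le_outer_measureIC _ (\bigcup_(i < m) img i) _) _.
  by apply: leeD; apply: le_raw => x [].
rewrite F0 adde0 bigcup_mkord.
apply: (le_trans (outer_measure_subadditive _ img m)).
rewrite mulrA mulr_sumr -sumEFin; apply: lee_sum => i _.
apply: (le_trans (lpow (@subset_refl _ _))).
rewrite raw_compact; last exact: cK.
by rewrite -(fineK (leb_compact_fin (@cK i))) -!EFinM mulrA.
Qed.

(** Disjoint compact images are at positive distance, so the separated case of additivity gives the
    sum by induction on the number of pieces. *)
Lemma sum_leb_disjoint_le :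
  (forall i j, (i < m)%N -> (j < m)%N -> i != j -> img i `&` img j = set0) ->
  (@raw_cube R d * \sum_(i < m) fine (leb d (K i)))%:E <=
  (lambda ^+ d)%:E * hausdorff_raw d%:R E.
Proof.
move=> disj.
have imgE k : (k <= m)%N -> \sum_(i < k) hausdorff_raw d%:R (img i) <=
    hausdorff_raw d%:R (\big[setU/set0]_(i < k) img i).
  elim: k => [|k ih] km; first by rewrite !big_ord0 raw0.
  rewrite !big_ord_recr/=.
  have cU : compact (\big[setU/set0]_(i < k) img i) by apply: bigsetU_compact.
  have dU : \big[setU/set0]_(i < k) img i `&` img k = set0.
    rewrite -bigcup_mkord; apply/seteqP; split=> // x [[i /= ik xi] xk].
    have : (img i `&` img k) x by split.
    by rewrite (disj i k (ltn_trans ik km) km (negbT (ltn_eqF ik))).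
  have [delta delta0 hd] := compact_separated cU (cimg (i:=k)) dU.
  apply: le_trans (raw_separated _ delta0 hd).
  by apply: leeD => //; apply: ih; exact: ltnW.
apply: (@le_trans _ _ ((lambda ^+ d)%:E * \sum_(i < m) hausdorff_raw d%:R (img i))); last first.
  apply: lee_wpmul2l; first by rewrite lee_fin exprn_ge0// ltW.
  apply: le_trans (imgE m (leqnn m)) _; apply: le_raw.
  by rewrite -bigcup_mkord => x [i /= im]; exact: KE.
rewrite ge0_sume_distrr; last by move=> i _; exact: raw_ge0.
rewrite mulr_sumr -sumEFin; apply: lee_sum => i _.
rewrite EFinM (fineK (leb_compact_fin (@cK i))) -raw_compact; last exact: cK.
have -> : K i = inverse_on (K i) (phi i) @` img i.
  apply/seteqP; split=> [x Kx|_ [_ [x Kx <-] <-]]; last by rewrite (inverse_onK (bl i)) ?inE.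
  by exists (phi i x); [exists x|rewrite (inverse_onK (bl i)) ?inE].
rewrite -powR_mulrn ?(ltW l0)//; apply: raw_lipschitz => //.
exact: (inverse_on_lipschitz (bl i)).
Qed.

Hypothesis null : forall i j, (i < m)%N -> (j < m)%N -> i != j ->
  hausdorff_raw d%:R (img i `&` img j) = 0.

Let overlap i := img i `&` \big[setU/set0]_(j < i) img j.

(** The parameters whose image already belongs to an earlier piece; for [i] below [m] they form a
    null compact set. *)
Let bad i := inverse_on (K i) (phi i) @` overlap i.

Let coverlap i : compact (overlap i).
Proof.
apply: compact_closedI; first exact: cimg.
by apply: compact_closed_rV; apply: bigsetU_compact.
Qed.

Let cbad i : compact (bad i).
Proof.
apply: (lipschitz_compact (L := lambda)); last exact: coverlap.
by move=> x y [ix _] [iy _]; exact: (inverse_on_lipschitz (bl i)).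
Qed.

Let bad0 i : (i < m)%N -> leb d (bad i) = 0.
Proof.
move=> im; apply/eqP; rewrite eq_le measure_ge0 andbT.
apply: (le_trans (leb_le_raw (compact_measurable_rV (@cbad i)))).
suff -> : hausdorff_raw d%:R (bad i) = 0 by rewrite mule0.
apply/eqP; rewrite eq_le raw_ge0 andbT.
apply: (@le_trans _ _ ((lambda `^ d%:R)%:E * hausdorff_raw d%:R (overlap i))).
  apply: raw_lipschitz => //.
  by move=> x y [ix _] [iy _]; exact: (inverse_on_lipschitz (bl i)).
suff -> : hausdorff_raw d%:R (overlap i) = 0 by rewrite mule0.
apply/eqP; rewrite eq_le raw_ge0 andbT.
apply: (@le_trans _ _ (hausdorff_raw d%:R (\big[setU/set0]_(j < i) (img i `&` img j)))).
  apply: le_raw; rewrite -(bigcup_mkord i (fun j => img i `&` img j)).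
  by move=> x [xi]; rewrite -bigcup_mkord => -[j ji xj]; exists j.
apply: (le_trans (outer_measure_subadditive _ (fun j => img i `&` img j) i)).
rewrite big1// => j _; apply: null => //; first exact: ltn_trans im.
by rewrite gtn_eqF.
Qed.

(** Removing only the null set [bad i] could destroy compactness, so an open neighbourhood of it
    with small volume is removed. *)
Lemma disjoint_piecesP (e : R) : (0 < e)%R -> exists K' : nat -> set 'rV[R]_d,
  [/\ forall i, compact (K' i), forall i, K' i `<=` K i,
    forall i j, (i < m)%N -> (j < m)%N -> i != j ->
      phi i @` K' i `&` phi j @` K' j = set0 &
    (\sum_(i < m) fine (leb d (K i)) <= \sum_(i < m) fine (leb d (K' i)) + e)%R].
Proof.
move=> e0; pose e' := (e / m.+1%:R)%R; have e'0 : (0 < e')%R by rewrite divr_gt0.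
have /choice[r hr] : forall i, exists r : R, (0 < r)%R /\
    leb d (thicken (bad i) r) <= leb d (bad i) + e'%:E.
  by move=> i; have [r r0 h] := leb_thicken (@cbad i) e'0; exists r.
pose K' i := K i `&` ~` thicken (bad i) (r i).
have cK' i : compact (K' i).
  by apply: compact_closedI; [exact: cK|apply: open_closedC; exact: open_thicken].
have lt_disj i j : (j < i)%N -> phi i @` K' i `&` phi j @` K' j = set0.
  move=> ji; apply/seteqP; split=> // x [[u [Ku nu] ux] [v [Kv _] vx]].
  apply: nu; have [r0 _] := hr i; apply: (sub_thicken r0).
  exists x; last by rewrite -ux (inverse_onK (bl i)) ?inE.
  split; first by exists u.
  by rewrite -bigcup_mkord; exists j => //; exists v.
exists K'; split=> //.
- by move=> i x [].
- move=> i j im jm; rewrite neq_ltn => /orP[ij|ij]; last exact: lt_disj.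
  by rewrite setIC; exact: lt_disj.
apply: (@le_trans _ _ (\sum_(i < m) (fine (leb d (K' i)) + e'))%R).
  apply: ler_sum => i _; have [r0 hri] := hr i.
  rewrite -lee_fin EFinD (fineK (leb_compact_fin (@cK i))) (fineK (leb_compact_fin (@cK' i))).
  have mT : measurable (thicken (bad i) (r i) : set (borel_rV R d)).
    by apply: open_measurable_rV; exact: open_thicken.
  have mK' := compact_measurable_rV (@cK' i).
  apply: (@le_trans _ _ (leb d (K' i `|` thicken (bad i) (r i)))).
    apply: le_measure; rewrite ?inE; [exact: compact_measurable_rV|exact: measurableU|].
    move=> x Kx; have [?|?] := pselect (thicken (bad i) (r i) x); first by right.
    by left; split.
  apply: (le_trans (measureU2 _ mK' mT)); apply: leeD => //.
  by apply: (le_trans hri); rewrite bad0// add0e.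
rewrite big_split/= lerD2l sumr_const card_ord -mulr_natl /e' mulrCA ger_pMr//.
by rewrite ler_pdivrMr// mul1r ler_nat.
Qed.

End rectifiable_pieces.

(** * Capacity asymptotics *)

Section capacity.
Local Open Scope ereal_scope.
Context {R : realType} {n : nat}.
Implicit Types (E : set 'rV[R]_n) (p M : R).

Lemma riesz_capacity_le p E M : (0 < p)%R -> (0 < M)%R ->
  M%:E <= riesz_energy p E -> (riesz_capacity p E `^ p <= M^-1)%R.
Proof.
move=> p0 M0; rewrite /riesz_capacity; case: riesz_energy => [v| |]//.
- rewrite lee_fin => Mv; have v0 := lt_le_trans M0 Mv.
  rewrite -powRrM mulNr mulVf ?gt_eqF// powR_inv1 ?(ltW v0)//.
  by rewrite lef_pV2 ?posrE.
- by move=> _; rewrite powR0 ?gt_eqF// invr_ge0 ltW.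
Qed.

(** The positive lower bound excludes zero energy, for which [powR] would return the default value
    0. *)
Lemma riesz_capacity_ge p E M M' : (0 < p)%R -> (0 < M')%R ->
  M'%:E <= riesz_energy p E -> riesz_energy p E <= M%:E ->
  (M^-1 <= riesz_capacity p E `^ p)%R.
Proof.
move=> p0 M'0; rewrite /riesz_capacity; case: riesz_energy => [v| |]//.
rewrite !lee_fin => Mv vM; have v0 := lt_le_trans M'0 Mv.
rewrite -powRrM mulNr mulVf ?gt_eqF// powR_inv1 ?(ltW v0)//.
by rewrite lef_pV2 ?posrE// (lt_le_trans v0).
Qed.

End capacity.

(** * Limits of the explicit bounds as p -> d *)

Section asymptotics.
Context {R : realType} {d : nat}.
Hypothesis d0 : (0 < d)%N.

Let dR : 0 < d%:R :> R. Proof. by rewrite ltr0n. Qed.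

Let s0 : 0 < d%:R / 2 :> R. Proof. by rewrite divr_gt0. Qed.

Lemma sphere_area_gt0 : 0 < sphere_area R d.
Proof. by rewrite /sphere_area divr_gt0 ?Gamma_gt0// mulr_gt0// powR_gt0// pi_gt0. Qed.

Lemma cvg_powR_exponent (a : R) : 0 < a ->
  a `^ p @[p --> (d%:R : R)^'-] --> a ^+ d.
Proof.
move=> a0; rewrite -powR_mulrn ?(ltW a0)//; apply: cvg_at_left_filter.
exact: powR_exponent_continuous.
Qed.

Lemma cvg_Gamma_half : Gamma (p / 2) @[p --> (d%:R : R)^'-] --> Gamma (d%:R / 2 : R).
Proof.
apply: cvg_at_left_filter.
apply: (cvg_comp (fun p => p / 2) (@Gamma R)); last exact: Gamma_continuous.
by apply: cvgM; [exact: cvg_id|exact: cvg_cst].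
Qed.

Lemma cvg_gap : d%:R - p @[p --> (d%:R : R)^'-] --> (0 : R).
Proof.
rewrite -[X in _ --> X](subrr (d%:R : R)); apply: cvg_at_left_filter.
by apply: cvgB; [exact: cvg_cst|exact: cvg_id].
Qed.

Lemma cvg_powR_gap (T : R) : 0 < T ->
  T `^ ((d%:R - p) / 2) @[p --> (d%:R : R)^'-] --> (1 : R).
Proof.
move=> T0; have cg : (d%:R - p) / 2 @[p --> (d%:R : R)^'-] --> (0 : R).
  rewrite -[X in _ --> X](mul0r (2^-1 : R)).
  by apply: cvgM; [exact: cvg_gap|exact: cvg_cst].
rewrite -[X in _ --> X](powRr0 T).
exact: (cvg_comp _ _ cg (powR_exponent_continuous (s := 0) T0)).
Qed.

(** The profile is the inverse of the lower energy bound divided by d - p, simplified so that no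
    factor is singular; [eta] stands for the squared tail factor. *)
Lemma cvg_upper_profile (lambda T V eta : R) : 0 < lambda -> 0 < T ->
  lambda `^ p * Gamma (p / 2) * T `^ ((d%:R - p) / 2) * (V / (2 * pi `^ (d%:R / 2) * eta))
    @[p --> (d%:R : R)^'-] --> lambda ^+ d * V / eta / sphere_area R d.
Proof.
move=> l0 T0.
have -> : lambda ^+ d * V / eta / sphere_area R d =
    lambda ^+ d * Gamma (d%:R / 2) * 1 * (V / (2 * pi `^ (d%:R / 2) * eta)).
  by rewrite /sphere_area !invfM invrK; ring.
apply: cvgM; last exact: cvg_cst.
apply: cvgM; last exact: cvg_powR_gap.
by apply: cvgM; [exact: cvg_powR_exponent|exact: cvg_Gamma_half].
Qed.

(** The profile is the inverse of d - p times the bound of [riesz_energy_le]: the singular term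
    becomes the constant 2 pi^(d/2) and the others acquire a vanishing factor. *)
Lemma cvg_lower_profile (lambda V delta : R) : 0 < lambda -> 0 < V -> 0 < delta ->
  (V^-1 * (lambda `^ p * ((Gamma (p / 2))^-1 *
     (V * ((p / 2)^-1 * (d%:R - p)) + 2 * pi `^ (d%:R / 2))) +
     delta `^ (- p) * V * (d%:R - p)))^-1
    @[p --> (d%:R : R)^'-] --> V / lambda ^+ d / sphere_area R d.
Proof.
move=> l0 V0 delta0; have G0 := Gamma_gt0 s0.
have c0 : 0 < pi `^ (d%:R / 2) :> R by rewrite powR_gt0// pi_gt0.
set A := (X in X / sphere_area R d).
have -> : A / sphere_area R d = (V^-1 * (lambda ^+ d * ((Gamma (d%:R / 2))^-1 *
     (V * ((d%:R / 2)^-1 * 0) + 2 * pi `^ (d%:R / 2))) + delta ^- d * V * 0))^-1.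
  rewrite !mulr0 add0r addr0 /A /sphere_area; field.
  by rewrite !gt_eqF// ?exprn_gt0.
apply: cvgV.
  by rewrite gt_eqF// !mulr0 add0r addr0 !mulr_gt0 ?invr_gt0 ?exprn_gt0.
apply: cvgM; first exact: cvg_cst.
apply: cvgD; last first.
  apply: cvgM; last exact: cvg_gap.
  apply: cvgM; last exact: cvg_cst.
  rewrite -exprVn; under eq_fun do rewrite powRN.
  rewrite exprVn; apply: cvgV; first by rewrite gt_eqF// exprn_gt0.
  exact: cvg_powR_exponent.
apply: cvgM; first exact: cvg_powR_exponent.
apply: cvgM.
  by apply: cvgV; [rewrite gt_eqF|exact: cvg_Gamma_half].
apply: cvgD; last exact: cvg_cst.
apply: cvgM; first exact: cvg_cst.
apply: cvgM; last exact: cvg_gap.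
apply: cvgV; first by rewrite gt_eqF.
by apply: cvg_at_left_filter; apply: cvgM; [exact: cvg_id|exact: cvg_cst].
Qed.

(** The accumulated losses of the two bounds: one power (1+e)^d from distorting the kernel, one from
    comparing volumes with Hausdorff measure, the summand e from thickening or shrinking pieces, and
    (1-e)^2 from the Gaussian tail. *)
Lemma small_error (h eps : R) : 0 < eps -> exists e : R,
  [/\ 0 < e, e < 1, (1 + e) ^+ d * ((1 + e) ^+ d * h + e) / (1 - e) ^+ 2 < h + eps &
      h - eps < (h / (1 + e) ^+ d - e) / (1 + e) ^+ d].
Proof.
move=> eps0.
have cid : e @[e --> (0 : R)^'+] --> (0 : R) by apply: cvg_at_right_filter; exact: cvg_id.
have c1D : 1 + e @[e --> (0 : R)^'+] --> (1 : R).
  by rewrite -[X in _ --> X](addr0 1); apply: cvgD => //; exact: cvg_cst.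
have c1 : (1 + e) ^+ d @[e --> (0 : R)^'+] --> (1 : R).
  rewrite -[X in _ --> X](expr1n R d).
  by apply: (cvg_comp _ (fun u => u ^+ d) c1D); exact: exprn_continuous.
have c1B : 1 - e @[e --> (0 : R)^'+] --> (1 : R).
  by rewrite -[X in _ --> X](subr0 1); apply: cvgB => //; exact: cvg_cst.
have c2 : (1 - e) ^+ 2 @[e --> (0 : R)^'+] --> (1 : R).
  rewrite -[X in _ --> X](expr1n R 2).
  by apply: (cvg_comp _ (fun u => u ^+ 2) c1B); exact: exprn_continuous.
have ub : (1 + e) ^+ d * ((1 + e) ^+ d * h + e) / (1 - e) ^+ 2 @[e --> (0 : R)^'+] --> h.
  rewrite [X in _ --> X](_ : h = 1 * (1 * h + 0) / 1); last by field.
  apply: cvgM; last by apply: cvgV => //; rewrite oner_neq0.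
  by apply: cvgM => //; apply: cvgD => //; apply: cvgM => //; exact: cvg_cst.
have lb : (h / (1 + e) ^+ d - e) / (1 + e) ^+ d @[e --> (0 : R)^'+] --> h.
  rewrite [X in _ --> X](_ : h = (h / 1 - 0) / 1); last by field.
  apply: cvgM; last by apply: cvgV => //; rewrite oner_neq0.
  apply: cvgB => //; apply: cvgM; first exact: cvg_cst.
  by apply: cvgV => //; rewrite oner_neq0.
near (0 : R)^'+ => e; exists e; split.
- by near: e; exact: nbhs_right_gt.
- by near: e; apply: nbhs_right_lt.
- by near: e; apply: (cvgr_lt _ ub); rewrite ltrDl.
- by near: e; apply: (cvgr_gt _ lb); rewrite ltrBlDr ltrDl.
Unshelve. all: by end_near. Qed.

End asymptotics.

Section capacity_bounds.
Context {R : realType} {d n : nat}.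
Hypothesis d0 : (0 < d)%N.
Variables (E : set 'rV[R]_n) (h : R).
Hypotheses (cE : compact E) (rectE : strongly_rectifiable d E).
Hypothesis rawE : hausdorff_raw d%:R E = (@raw_cube R d * h)%:E.

Let dR : 0 < d%:R :> R. Proof. by rewrite ltr0n. Qed.

Let c0 : 0 < @raw_cube R d := raw_cube_gt0.

Let mE : measurable (E : set (borel_rV R n)) := compact_measurable_rV cE.

Let S : R := sphere_area R d.

Let S0 : 0 < S := sphere_area_gt0 d0.

Let h0 : 0 <= h.
Proof. by have := raw_ge0 d%:R E; rewrite rawE lee_fin pmulr_rge0. Qed.

(** The positivity of the energy in the second conclusion is recorded for the opposite bound. *)
Let capacity_limsup (eps : R) : 0 < eps -> \forall p \near (d%:R : R)^'-,
  riesz_capacity p E `^ p / (d%:R - p) <= h / S + eps /\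
  exists2 M : R, 0 < M & (M%:E <= riesz_energy p E)%E.
Proof.
move=> eps0; have [e [e0 e1 ub _]] := @small_error R d h _ (mulr_gt0 eps0 S0).
have [m [K [phi [cK bl KE null [s [s0 sd F0]]]]]] := rectifiable_piecesP e0 rectE.
have lam0 : 0 < 1 + e by rewrite addr_gt0.
have ld0 : 0 < (1 + e) ^+ d by rewrite exprn_gt0.
pose V := (1 + e) ^+ d * h + e.
have V0 : 0 < V by rewrite ltr_wpDl// mulr_ge0// ltW.
(* The images may overlap, so the volumes are bounded through shrunken disjoint pieces, which costs
   half of e; the other half pays for the neighbourhoods. *)
have sumK : \sum_(i < m) fine (leb d (K i)) <= (1 + e) ^+ d * h + e / 2.
  have [K' [cK' K'K disj le]] := disjoint_piecesP cK bl null (divr_gt0 e0 (ltr0Sn R 1)).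
  apply: (le_trans le); rewrite lerD2r.
  have bl' i : bilipschitz_on (1 + e) (K' i) (phi i).
    by have [? hb] := bl i; split=> // x y /K'K Kx /K'K Ky; exact: hb.
  have K'E i : (i < m)%N -> phi i @` K' i `<=` E.
    by move=> im _ [x /K'K Kx <-]; apply: (KE i im); exists x.
  have := sum_leb_disjoint_le cK' bl' K'E disj.
  by rewrite rawE -EFinM lee_fin mulrCA ler_pM2l.
pose e' := e / 2 / m.+1%:R; have e'0 : 0 < e' by rewrite !divr_gt0.
have [r r0 hr] : exists2 r : R, 0 < r & forall i : 'I_m,
    (leb d (thicken (K i) r) <= (fine (leb d (K i)) + e')%:E)%E.
  have H : \forall r \near (0 : R)^'+, forall i : 'I_m,
      (leb d (thicken (K i) r) <= (fine (leb d (K i)) + e')%:E)%E.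
    apply: filter_forall => i; have [r0 r00 hr0] := leb_thicken (@cK i) e'0.
    near=> r; rewrite EFinD (fineK (leb_compact_fin (@cK i))); apply: le_trans hr0.
    have rr0 : r <= r0 by near: r; exact: nbhs_right_le.
    apply: le_measure; rewrite ?inE; [by apply: open_measurable_rV; exact: open_thicken..|].
    by move=> y [x Kx xy]; exists x => //; exact: lt_le_trans rr0.
  by near (0 : R)^'+ => r; exists r => //; near: r.
have VK : (\sum_(i < m) leb d (thicken (K i) r) <= V%:E)%E.
  apply: (le_trans (lee_sum _ (fun i _ => hr i))); rewrite sumEFin lee_fin big_split/=.
  have -> : V = (1 + e) ^+ d * h + e / 2 + e / 2 by rewrite /V -addrA -splitr.
  rewrite sumr_const card_ord lerD// -[e' *+ m]mulr_natr.
  by rewrite /e' mulrAC ler_pdivrMr// ler_pM2l ?divr_gt0// ler_nat.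
pose C : R := Num.sqrt 2 ^+ d; have C0 : 0 < C by rewrite exprn_gt0// sqrtr_gt0.
(* Makes T r^2 = C/e, so the tail error is C exp(-C/e), at most e because exp(u) >= u. *)
pose T := C / (e * r ^+ 2); have T0 : 0 < T by rewrite divr_gt0// mulr_gt0// exprn_gt0.
pose eta := C * expR (- (T * r ^+ 2)).
have eta_e : eta <= e.
  have -> : eta = C * expR (- (C / e)).
    by congr (_ * expR (- _)); rewrite /T; field; rewrite !gt_eqF.
  rewrite expRN ler_pdivrMr ?expR_gt0// -ler_pdivrMl//.
  by rewrite mulrC (le_trans _ (expR_ge1Dx _))// lerDr.
have eta1 : eta <= 1 by rewrite (le_trans eta_e)// ltW.
have neta0 : 0 < 1 - eta by rewrite subr_gt0 (le_lt_trans eta_e).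
(* The bound for b = (1 - eta)/V, which maximizes 2 b (1 - eta) - b^2 V with value (1 - eta)^2 /
   V. *)
pose LB p := (1 + e) `^ (- p) * ((Gamma (p / 2))^-1 * (pi `^ (d%:R / 2) *
  (T `^ (- ((d%:R - p) / 2)) / ((d%:R - p) / 2))) * ((1 - eta) ^+ 2 / V)).
have cU := @cvg_upper_profile R d d0 (1 + e) T V ((1 - eta) ^+ 2) lam0 T0.
have Ulim : (1 + e) ^+ d * V / (1 - eta) ^+ 2 / sphere_area R d < h / S + eps.
  rewrite ltr_pdivrMr// mulrDl divfK ?gt_eqF//; apply: le_lt_trans ub.
  rewrite ler_wpM2l ?mulr_ge0 ?(ltW ld0) ?(ltW V0)//.
  rewrite lef_pV2 ?posrE ?exprn_gt0 ?subr_gt0//.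
  - by rewrite ler_pXn2r ?nnegrE ?subr_ge0 ?(ltW e1)// lerB.
  - exact: le_lt_trans e1.
near=> p.
have pd : p < d%:R by near: p; exact: nbhs_left_lt.
have sp : s <= p by near: p; apply: nbhs_left_ge.
have p0 : 0 < p by near: p; apply: nbhs_left_gt.
have gap0 : 0 < d%:R - p by rewrite subr_gt0.
have G0 : 0 < Gamma (p / 2) by rewrite Gamma_gt0// divr_gt0.
have pi0 : 0 < pi `^ (d%:R / 2) :> R by rewrite powR_gt0// pi_gt0.
have LB0 : 0 < LB p.
  by rewrite /LB !(mulr_gt0, powR_gt0, invr_gt0, exprn_gt0)// pi_gt0.
have energy : ((LB p)%:E <= riesz_energy p E)%E.
  apply: le_ereal_inf_tmp => _ [mu muE <-].
  have b0 : 0 <= (1 - eta) / V by rewrite divr_ge0// ltW.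
  have sp' : 0 <= s <= p by rewrite s0.
  have pd' : 0 < p < d%:R by rewrite p0.
  have := energy_ge_pieces cK bl KE mE muE sp' pd' T0 r0 b0 F0 VK eta1.
  congr (_ <= _)%E; congr (_%:E).
  by rewrite /LB -/C -/eta; congr (_ * (_ * _)); field; rewrite gt_eqF.
split; last by exists (LB p).
have capM := riesz_capacity_le p0 LB0 energy.
apply: (@le_trans _ _ ((LB p)^-1 / (d%:R - p))).
  by rewrite ler_pM2r ?invr_gt0.
have -> : (LB p)^-1 / (d%:R - p) = (1 + e) `^ p * Gamma (p / 2) *
    T `^ ((d%:R - p) / 2) * (V / (2 * pi `^ (d%:R / 2) * (1 - eta) ^+ 2)).
  rewrite /LB !powRN; field.
  by rewrite !gt_eqF ?powR_gt0 ?pi_gt0.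
by apply: ltW; near: p; exact: (cvgr_lt _ cU).
Unshelve. all: by end_near. Qed.

Let capacity_liminf (eps : R) : 0 < eps -> \forall p \near (d%:R : R)^'-,
  h / S - eps <= riesz_capacity p E `^ p / (d%:R - p).
Proof.
move=> eps0; have [e [e0 e1 _ lb]] := @small_error R d h _ (mulr_gt0 eps0 S0).
have [m [K [phi [cK bl KE null [s [s0 sd F0]]]]]] := rectifiable_piecesP e0 rectE.
have lam0 : 0 < 1 + e by rewrite addr_gt0.
have ld0 : 0 < (1 + e) ^+ d by rewrite exprn_gt0.
have [K' [cK' K'K disj le]] := disjoint_piecesP cK bl null e0.
have bl' i : bilipschitz_on (1 + e) (K' i) (phi i).
  by have [? hb] := bl i; split=> // x y /K'K Kx /K'K Ky; exact: hb.
have K'E i : (i < m)%N -> phi i @` K' i `<=` E.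
  by move=> im _ [x /K'K Kx <-]; apply: (KE i im); exists x.
pose W := \sum_(i < m) fine (leb d (K' i)).
(* The original pieces cover [E] up to a null set, so h <= (1+e)^d times their total volume, which
   is at most W + e. *)
have hW : h / (1 + e) ^+ d - e <= W.
  rewrite lerBlDr ler_pdivrMr// -(ler_pM2l c0) -lee_fin -rawE.
  apply: (le_trans (raw_le_pieces d0 cK bl s0 sd F0)); rewrite lee_fin mulrC -mulrA.
  by rewrite ler_pM2l// ler_wpM2r// ltW.
have capn0 p : p < d%:R -> 0 <= riesz_capacity p E `^ p / (d%:R - p).
  by move=> pd; rewrite divr_ge0 ?powR_ge0// subr_ge0 ltW.
have lbW : h - eps * S < W / (1 + e) ^+ d.
  by rewrite (lt_le_trans lb)// ler_pM2r ?invr_gt0.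
(* Without volume there is no test measure, but then h/S - eps is negative and the bound is
   trivial. *)
have [W0|W0] := leP W 0.
  near=> p; apply: (@le_trans _ _ 0); last first.
    by apply: capn0; near: p; exact: nbhs_left_lt.
  rewrite subr_le0 ler_pdivrMr// -subr_le0 (le_trans (ltW lbW))//.
  by rewrite pmulr_lle0 ?invr_gt0.
have [delta delta0 hd] := riesz_energy_le cK' bl' K'E mE W0 disj.
have cL := cvg_lower_profile d0 lam0 W0 delta0.
have Llim : h / S - eps < W / (1 + e) ^+ d / sphere_area R d.
  by rewrite ltr_pdivlMr// mulrBl divfK ?gt_eqF.
near=> p.
have pd : p < d%:R by near: p; exact: nbhs_left_lt.
have p0 : 0 < p by near: p; apply: nbhs_left_gt.
have gap0 : 0 < d%:R - p by rewrite subr_gt0.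
have G0 : 0 < Gamma (p / 2) by rewrite Gamma_gt0// divr_gt0.
have pi0 : 0 < pi `^ (d%:R / 2) :> R by rewrite powR_gt0// pi_gt0.
have [_ [M M0 hM]] : riesz_capacity p E `^ p / (d%:R - p) <= h / S + 1 /\
    exists2 M : R, 0 < M & (M%:E <= riesz_energy p E)%E.
  by near: p; exact: capacity_limsup.
have pd' : 0 < p < d%:R by rewrite p0.
have capM := riesz_capacity_ge p0 M0 hM (hd p pd').
apply: (@le_trans _ _ ((W^-1 * ((1 + e) `^ p * ((Gamma (p / 2))^-1 *
     (W * ((p / 2)^-1 * (d%:R - p)) + 2 * pi `^ (d%:R / 2))) +
     delta `^ (- p) * W * (d%:R - p)))^-1)).
  by apply: ltW; near: p; exact: (cvgr_gt _ cL).
rewrite ler_pdivlMr//; apply: le_trans capM; rewrite le_eqVlt; apply/orP; left; apply/eqP.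
rewrite -[X in _ * X = _]invrK -invfM -/W; congr (_^-1).
by field; rewrite !gt_eqF.
Unshelve. all: by end_near. Qed.

Lemma cvg_riesz_capacity :
  riesz_capacity p E `^ p / (d%:R - p) @[p --> (d%:R : R)^'-] --> h / S.
Proof.
apply/cvgrPdist_le => eps eps0; near=> p.
have : riesz_capacity p E `^ p / (d%:R - p) <= h / S + eps /\
    exists2 M : R, 0 < M & (M%:E <= riesz_energy p E)%E.
  by near: p; exact: capacity_limsup.
have : h / S - eps <= riesz_capacity p E `^ p / (d%:R - p).
  by near: p; exact: capacity_liminf.
by move=> h1 [h2 _]; rewrite ler_norml; apply/andP; split; lra.
Unshelve. all: by end_near. Qed.

End capacity_bounds.

Theorem theorem1p1 (R : realType) (d n : nat) (hd : (1 <= d)%N)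
    (hdn : (d <= n)%N) (E : set 'rV[R]_n) (hE : compact E)
    (hrect : strongly_rectifiable d E) :
  (riesz_capacity p E `^ p / (d%:R - p))%:E @[p --> (d%:R : R)^'-] -->
    (hausdorff_measure d E / (sphere_area R d)%:E)%E.
Proof.
have c0 := @raw_cube_gt0 R d.
(* Any distortion would do: this decomposition only shows that the Hausdorff measure of [E] is
   finite, so that the limit is a real number. *)
have [m [K [phi [cK bl KE _ [s [s0 sd F0]]]]]] := rectifiable_piecesP ltr01 hrect.
have rawfin : hausdorff_raw d%:R E \is a fin_num.
  rewrite ge0_fin_numE ?raw_ge0//.
  exact: le_lt_trans (raw_le_pieces hd cK bl s0 sd F0) (ltry _).
pose h : R := fine (hausdorff_measure d E).
have hE' : hausdorff_measure d E = h%:E.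
  by rewrite /h hausdorff_measureE -(fineK rawfin) -EFinM.
have rawE : hausdorff_raw d%:R E = (@raw_cube R d * h)%:E.
  rewrite EFinM -hE' hausdorff_measureE muleA -EFinM mulfV ?gt_eqF//.
  by rewrite mul1e.
rewrite hE' inver gt_eqF ?sphere_area_gt0// -EFinM.
apply/fine_cvgP; split; first exact: nearW.
exact: (cvg_riesz_capacity hd hE hrect rawE).
Qed.
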